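(* Let $\phi$ be a branching mechanism. Let $\beta\ge 0$ be a constant and $\nu$ a $\sigma$-finite measure on $(0,\infty)$ such that $\int_{(0,\infty)}u\,\nu(du)<\infty$. If $\beta>0$, assume in addition $\phi'(\infty)=\infty$. Define the $\sigma$-finite measure $\mathbf{N}$ on $(D[0,\infty),\mathcal{A})$ by $$\mathbf{N}(dw)=\beta\,\mathbf{N}_0(dw)+\int_{(0,\infty)}\nu(dx)\,\mathbf{Q}_x(dw),$$ where $\mathbf{N}_0$ is the excursion law of the CB-process with branching mechanism $\phi$ (the first term being absent if $\beta=0$). Let $\rho$ be a Borel measure on $(0,\infty)$ such that $\rho(0,t]<\infty$ for each $0<t<\infty$. Suppose that $N=\sum_{i=1}^\infty\delta_{(s_i,w_i)}$ is a Poisson random measure on $(0,\infty)\times D[0,\infty)$ with intensity $\rho(ds)\mathbf{N}(dw)$. For $t\ge 0$ let $$Y_t=\int_{(0,t]}\int_{D[0,\infty)}w(t-s)\,N(ds,dw)=\sum_{0<s_i\le t}w_i(t-s_i)$$ and let $\mathcal{G}_t$ be the $\sigma$-algebra generated by the random variables $\{N((0,u]\times A):A\in\mathcal{A}_{t-u},\,0\le u\le t\}$. Then $\{(Y_t,\mathcal{G}_t):t\ge 0\}$ is a Markov process with inhomogeneous transition semigroup $(P_{r,t})_{t\ge r\ge 0}$ given by $$\int_{[0,\infty)}e^{-\lambda y}P_{r,t}(x,dy)=\exp\bigg\{-xv_{t-r}(\lambda)-\int_{(r,t]}\psi(v_{t-s}(\lambda))\,\rho(ds)\bigg\},\qquad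 \lambda\ge 0,\ x\ge 0,$$ where $\psi(z)=\beta z+\int_{(0,\infty)}(1-e^{-zu})\,\nu(du)$, $z\ge 0$.
   Context: A branching mechanism is a function $\phi(z)=bz+cz^2+\int_{(0,\infty)}(e^{-zu}-1+zu)\,m(du)$, $z\ge 0$, with $b\in\mathbb{R}$, $c\ge 0$ and $m$ a $\sigma$-finite measure on $(0,\infty)$ with $\int_{(0,\infty)}(u\wedge u^2)\,m(du)<\infty$; $\phi'(\infty)=\lim_{z\to\infty}\phi'(z)$. For $\lambda\ge 0$, $t\mapsto v_t(\lambda)$ is the unique nonnegative solution of $v_t(\lambda)=\lambda-\int_0^t\phi(v_s(\lambda))\,ds$. $(Q_t)_{t\ge 0}$ is the (Feller) transition semigroup on $[0,\infty)$ given by $\int_{[0,\infty)}e^{-\lambda y}Q_t(x,dy)=e^{-xv_t(\lambda)}$, and $(Q_t^\circ)_{t\ge 0}$ is its restriction to $(0,\infty)$. The CB-process with branching mechanism $\phi$ is the Markov process in $[0,\infty)$ with transition semigroup $(Q_t)$. $D[0,\infty)$ is the space of nonnegative càdlàg paths $w$ on $[0,\infty)$; $\mathcal{A}=\sigma(\{w(s):0\le s<\infty\})$, $\mathcal{A}_t=\sigma(\{w(s):0\le s\le t\})$. $\mathbf{Q}_x$ is the law on $(D[0,\infty),\mathcal{A})$ of the CB-process started from $x$. Let $\tau_0(w)=\inf\{s>0:w(s)=0\}$ and let $D_1[0,\infty)$ be the set of $w\in D[0,\infty)$ with $w(0)=0$ and $w(t)=0$ for $t\ge\tau_0(w)$.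 When $\phi'(\infty)=\infty$ there are unique $\sigma$-finite measures $(l_t)_{t>0}$ on $(0,\infty)$ with $v_t(\lambda)=\int_{(0,\infty)}(1-e^{-\lambda u})\,l_t(du)$ for $t>0,\lambda\ge 0$, and the excursion law $\mathbf{N}_0$ is the $\sigma$-finite measure on $(D[0,\infty),\mathcal{A})$ supported by $D_1[0,\infty)$ (not charging the zero path) such that for $0<t_1<\cdots<t_n$ and $x_1,\dots,x_n\in(0,\infty)$: $\mathbf{N}_0(w(t_1)\in dx_1,\dots,w(t_n)\in dx_n)=l_{t_1}(dx_1)Q^\circ_{t_2-t_1}(x_1,dx_2)\cdots Q^\circ_{t_n-t_{n-1}}(x_{n-1},dx_n)$.
   Formalization: For β>0 the Markov property is asserted only at times t with ρ{t}=0 (excursions starting at an atom of ρ are 0 at that instant, so the formula fails there), and G_t is completed by null events, as Y_t is only a.s. equal to a G_t-measurable variable. *)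

(* Defs.v *)
From HB Require Import structures.
From mathcomp Require Import all_boot all_order all_algebra.
From mathcomp Require Import all_classical all_reals all_analysis.
From mathcomp Require Import measurable_realfun.

Set Implicit Arguments.
Unset Strict Implicit.
Unset Printing Implicit Defensive.

Import Order.TTheory GRing.Theory Num.Theory.
Import numFieldNormedType.Exports.

Local Open Scope classical_set_scope.
Local Open Scope ring_scope.

(* Conventions. A measure on (0,oo) is a Borel measure on R giving no mass to
   ]-oo, 0].  A Markov kernel on [0,oo) is a probability kernel on R whose values
   at starting points x >= 0 give no mass to ]-oo, 0[; its values at x < 0 are
   irrelevant.  Times are elements of R, only nonnegative ones being relevant. *)

Section branching.
Context {R : realType}.

Definition on_pos (mu : {measure set R -> \bar R}) : Prop := mu `]-oo, 0]%classic = 0%E.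

Definition branching_parameters (c : R) (m : {measure set R -> \bar R}) : Prop :=
  [/\ 0 <= c, on_pos m &
      (\int[m]_(u in `]0%R, +oo[) (Num.min u (u ^+ 2))%:E < +oo)%E].

Definition branching_mechanism (b c : R) (m : {measure set R -> \bar R}) (z : R) : R :=
  b * z + c * z ^+ 2 +
  \int[m]_(u in `]0, +oo[) (expR (- (z * u)) - 1 + z * u).

Definition infinite_slope (phi : R -> R) : Prop :=
  derive1 phi z @[z --> +oo] --> +oo.

(* [v t lambda] is v_t(lambda).  Integrability is required because the
   real-valued integral is 0 by convention for non-integrable functions. *)
Definition is_cumulant_flow (phi : R -> R) (v : R -> R -> R) : Prop :=
  forall lambda t : R, 0 <= lambda -> 0 <= t ->
    [/\ 0 <= v t lambda,
        (@lebesgue_measure R).-integrable `[0, t]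
          (fun s => (phi (v s lambda))%:E) &
        v t lambda = lambda -
          \int[@lebesgue_measure R]_(s in `[0, t]) phi (v s lambda)].

Definition is_transition_semigroup (P : R -> R -> R.-pker R ~> R) : Prop :=
  [/\ forall r t x : R, 0 <= r -> r <= t -> 0 <= x -> P r t x `]-oo, 0[%classic = 0%E,
      forall (r x : R) (A : set R), 0 <= r -> 0 <= x -> measurable A ->
        P r r x A = \d_x A &
      forall (r s t x : R) (A : set R), 0 <= r -> r <= s -> s <= t -> 0 <= x ->
        measurable A ->
        P r t x A = (\int[P r s x]_(y in `[0%R, +oo[) P s t y A)%E].

Definition laplace (mu : {measure set R -> \bar R}) (lambda : R) : \bar R :=
  (\int[mu]_(y in `[0%R, +oo[) (expR (- (lambda * y)))%:E)%E.

Definition is_CB_semigroup (v : R -> R -> R) (Q : R -> R.-pker R ~> R) : Prop :=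
  is_transition_semigroup (fun r t => Q (t - r)) /\
  forall t x lambda : R, 0 <= t -> 0 <= x -> 0 <= lambda ->
    laplace (Q t x) lambda = (expR (- (x * v t lambda)))%:E.

Definition is_entrance_family (v : R -> R -> R)
    (l : R -> {sigma_finite_measure set R -> \bar R}) : Prop :=
  forall t : R, 0 < t -> on_pos (l t) /\
    forall lambda : R, 0 <= lambda ->
      (v t lambda)%:E =
      (\int[l t]_(u in `]0%R, +oo[) (1 - expR (- (lambda * u)))%:E)%E.

End branching.

(* The space D[0,oo), each path being extended by 0 to negative times. *)
Record cadlag (R : realType) := Cadlag {
  path_fun :> R -> R;
  path_lt0 : forall t : R, t < 0 -> path_fun t = 0;
  path_ge0 : forall t : R, 0 <= path_fun t;
  path_right : forall t : R, 0 <= t -> path_fun s @[s --> t^'+] --> path_fun t;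
  path_left : forall t : R, 0 < t -> cvg (path_fun s @[s --> t^'-]) }.

Section path_space.
Context {R : realType}.

Let zero_fun : R -> R := fun=> 0.

Let zero_lt0 t : t < 0 -> zero_fun t = 0. Proof. by []. Qed.

Let zero_ge0 t : 0 <= zero_fun t. Proof. by []. Qed.

Let zero_right t : 0 <= t -> zero_fun s @[s --> t^'+] --> zero_fun t.
Proof. by move=> _; exact: cvg_cst. Qed.

Let zero_left t : 0 < t -> cvg (zero_fun s @[s --> t^'-]).
Proof. by move=> _; exact: is_cvg_cst. Qed.

Definition zero_path : cadlag R :=
  Cadlag zero_lt0 zero_ge0 zero_right zero_left.

HB.instance Definition _ := gen_eqMixin (cadlag R).
HB.instance Definition _ := gen_choiceMixin (cadlag R).
HB.instance Definition _ := isPointed.Build (cadlag R) zero_path.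

Definition coordinate_events (I : set R) : set (set (cadlag R)) :=
  [set A | exists s (B : set R),
     [/\ I s, measurable B & A = [set w : cadlag R | B (w s)]]].

Definition coordinate_sigma (I : set R) : set (set (cadlag R)) :=
  <<s coordinate_events I >>.

Let A_events := coordinate_events `[0, +oo[.

HB.instance Definition _ := @isMeasurable.Build (sigma_display A_events)
  (cadlag R) (coordinate_sigma `[0, +oo[) (@sigma_algebra0 _ setT A_events)
  (@sigma_algebraC _ A_events) (@sigma_algebra_bigcup _ setT A_events).

End path_space.

Section markov.
Context {R : realType} d (Omega : measurableType d) (Pr : {measure set Omega -> \bar R}).

Definition is_filtration (I : set R) (F : R -> set (set Omega)) : Prop :=
  [/\ forall t, I t -> sigma_algebra setT (F t),
      forall t, I t -> F t `<=` measurable &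
      forall s t, I s -> I t -> s <= t -> F s `<=` F t].

Definition augmented (F : R -> set (set Omega)) (t : R) : set (set Omega) :=
  <<s F t `|` [set A | measurable A /\ Pr A = 0%E] >>.

Definition is_conditional_expectation (G : set (set Omega))
    (X Z : Omega -> R) : Prop :=
  [/\ forall B : set R, measurable B -> G (Z @^-1` B),
      Pr.-integrable setT (EFin \o Z) &
      forall A, G A ->
        (\int[Pr]_(om in A) (Z om)%:E = \int[Pr]_(om in A) (X om)%:E)%E].

Definition is_markov_process (I : set R) (F : R -> set (set Omega))
    (X : R -> Omega -> R) (P : R -> R -> R.-pker R ~> R) : Prop :=
  [/\ is_filtration I F,
      forall t om, I t -> 0 <= X t om,
      forall t (B : set R), I t -> measurable B -> F t (X t @^-1` B) &
      forall r t (f : R -> R), I r -> I t -> r <= t ->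
        measurable_fun setT f -> (exists M : R, forall y, `|f y| <= M) ->
        is_conditional_expectation (F r) (f \o X t)
          (fun om => \int[P r t (X r om)]_(y in `[0, +oo[) f y)].

End markov.

Section laws.
Context {R : realType}.

Definition is_CB_law (Q : R -> R.-pker R ~> R)
    (QQ : R.-pker R ~> cadlag R) : Prop :=
  forall x : R, 0 <= x ->
    QQ x [set w : cadlag R | w 0 = x] = 1%E /\
    is_markov_process (QQ x) `[0, +oo[ (fun t => coordinate_sigma `[0, t])
      (fun t (w : cadlag R) => w t) (fun r t => Q (t - r)).

Definition tau0 (w : cadlag R) : \bar R :=
  ereal_inf [set s%:E | s in [set s | 0 < s /\ w s = 0]].

Definition D1 : set (cadlag R) :=
  [set w : cadlag R | w 0 = 0 /\
     forall t, 0 <= t -> (tau0 w <= t%:E)%E -> w t = 0].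

(* The integral of
     Q_{t_{i+1} - t_i}(x, dx_{i+1}) ... Q_{t_{i+k} - t_{i+k-1}}(x_{i+k-1}, dx_{i+k})
   over B_{i+1} * ... * B_{i+k}. *)
Fixpoint transitions (Q : R -> R.-pker R ~> R) (t : nat -> R)
    (B : nat -> set R) (i k : nat) (x : R) : \bar R :=
  if k is k'.+1 then
    (\int[Q (t i.+1 - t i)%R x]_(y in B i.+1) transitions Q t B i.+1 k' y)%E
  else 1%E.

Definition is_excursion_law (Q : R -> R.-pker R ~> R)
    (l : R -> {sigma_finite_measure set R -> \bar R})
    (N0 : {measure set (cadlag R) -> \bar R}) : Prop :=
  N0.-negligible (~` (D1 `\ zero_path)) /\
  forall (n : nat) (t : nat -> R) (B : nat -> set R),
    0 < t 0%N -> (forall i, (i < n)%N -> t i < t i.+1) ->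
    (forall i, (i <= n)%N -> measurable (B i) /\ B i `<=` `]0, +oo[) ->
    N0 [set w : cadlag R | forall i, (i <= n)%N -> B i (w (t i))] =
    (\int[l (t 0%N)]_(x in B 0%N) transitions Q t B 0 n x)%E.

Definition immigration_law (beta : R) (N0 : {measure set (cadlag R) -> \bar R})
    (nu : {measure set R -> \bar R}) (QQ : R.-pker R ~> cadlag R) :
    set (cadlag R) -> \bar R :=
  fun A => (beta%:E * N0 A + \int[nu]_(x in `]0%R, +oo[) QQ x A)%E.

Definition immigration_mechanism (beta : R) (nu : {measure set R -> \bar R}) (z : R) : R :=
  beta * z + \int[nu]_(u in `]0, +oo[) (1 - expR (- (z * u))).

End laws.

Section poisson_random_measure.
Context {R : realType} d (Omega : measurableType d) (Pr : probability Omega R).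

(* The library's [poisson_pmf] is not used because it is 1 at rate 0. *)
Definition is_poisson_random_measure d' (E : measurableType d')
    (mu : set E -> \bar R) (N : Omega -> {measure set E -> \bar R}) : Prop :=
  [/\ forall A, measurable A -> measurable_fun [set: Omega] (fun om => N om A : \bar R),
      forall A (k : nat), measurable A -> (mu A < +oo)%E ->
        Pr [set om | N om A = k%:R%:E] =
        (fine (mu A) ^+ k / k`!%:R * expR (- fine (mu A)))%:E &
      forall n (A : 'I_n -> set E) (C : 'I_n -> set (\bar R)),
        (forall i, measurable (A i)) -> (forall i, (mu (A i) < +oo)%E) ->
        trivIset setT A -> (forall i, measurable (C i)) ->
        Pr [set om | forall i, C i (N om (A i))] =
        (\prod_(i < n) Pr [set om | C i (N om (A i))])%E].

Definition immigration_process
    (N : Omega -> {measure set (R * cadlag R) -> \bar R})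
    (t : R) (om : Omega) : \bar R :=
  (\int[N om]_(p in `]0%R, t] `*` setT) (p.2 (t - p.1))%:E)%E.

Definition immigration_filtration
    (N : Omega -> {measure set (R * cadlag R) -> \bar R})
    (t : R) : set (set Omega) :=
  <<s [set S | exists (u : R) A (C : set (\bar R)),
       [/\ 0 <= u <= t, coordinate_sigma `[0, t - u] A, measurable C &
           S = [set om | C (N om (`]0, u] `*` A))]]] >>.

End poisson_random_measure.

(* Main.v *)
(** For a Poisson random measure [N] with intensity [mu] and [F >= 0], Campbell's
    formula says that the expectation of [exp (- N(F))] is
    [exp (- mu(1 - e^{-F}))].  Write [L] for the measure [N] of the statement.  The
    Markov property of the CB-process and of the excursion law says that under [L],
    for times [q <= p] ([q > 0] or [beta = 0]) and weights depending on the path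
    up to time [q], [1 - e^{-lambda w(p)}] and [1 - e^{-v_{p-q}(lambda) w(q)}] have
    the same integral; moreover [L(1 - e^{-lambda w(q)}) = psi (v_q(lambda))].
    Splitting the immigrants at time [r], Campbell's formula then gives the Laplace
    transform of [Y_t] jointly with the counts [N(]0,u] * A)] of the past at [r],
    and inverting Laplace transforms yields the conditional law of [Y_t].  The
    kernel [P_{r,t}(x, .)] is the law of a [Q_{t-r}(x, .)] variable plus an
    independent contribution of the immigrants of [(r, t]].

    The filtration only sees an immigrant of time [s] through the rectangles
    [(0, u] * A] with [u >= s], that is through its path strictly before [t - s].
    [Y_t] is nevertheless measurable up to null events because [L] charges no path
    with a jump at a given time [u > 0]. *)

Require Import Defs.
From HB Require Import structures.
From mathcomp Require Import all_boot all_order all_algebra.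
From mathcomp Require Import all_classical all_reals all_analysis.
From mathcomp Require Import measurable_realfun.
From mathcomp Require Import finmap ring lra.

Set Implicit Arguments.
Unset Strict Implicit.
Unset Printing Implicit Defensive.

Import Order.TTheory GRing.Theory Num.Theory.
Import numFieldNormedType.Exports.

Local Open Scope classical_set_scope.
Local Open Scope ring_scope.

(** * Integration *)

(** The excursion law may be infinite, so nothing can be normalised or conditioned: the integrable
    quantity is $1-e^{-\lambda w(q)}$, and identities for $e^{-\lambda w(q)}$ itself are recovered
    by subtraction against an integrable weight. A second obstacle is that [rho] may have atoms. An
    excursion starting exactly at $t$ has $w(0)=0$ and is invisible in $Y_t$, so the exponent of the
    immigrants of $(r,t]$ lacks the term $\beta\lambda\rho\{t\}$, whereas it is the full integral of
    [psi] that is additive along the flow [v]. The kernels are therefore built from the given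
    immigrants of $(r,t]$ plus the deterministic amount $\beta\rho\{t\}$, and the Markov property of
    $Y$ is asserted at times where this amount vanishes. Taking the immigrants from the given
    probability space spares a separate construction of their law. A third obstacle is adaptedness:
    the sets whose counts are observable are closed under complement only where counts are finite,
    so the relevant past is covered by countably many rectangles $\{w(q)>\epsilon\}$ of finite
    intensity. *)

Section generic.
Local Open Scope ereal_scope.

Import HBNNSimple.

(** Monotone class induction: a nonnegative measurable function is an increasing limit of simple
    functions, which are nonnegative combinations of indicators. It carries identities from sets to
    functions throughout. *)
Lemma ge0_measurable_ind d (T : measurableType d) (R : realType)
    (P : (T -> \bar R) -> Prop) :
  (forall A, measurable A -> P (EFin \o \1_A)) ->
  (forall (k : R) f, (0 <= k)%R -> measurable_fun setT f ->
     (forall x, 0 <= f x) -> P f -> P (fun x => k%:E * f x)) ->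
  (forall f g, measurable_fun setT f -> (forall x, 0 <= f x) ->
     measurable_fun setT g -> (forall x, 0 <= g x) ->
     P f -> P g -> P (fun x => f x + g x)) ->
  (forall f_ : (T -> \bar R)^nat, (forall n, measurable_fun setT (f_ n)) ->
     (forall n x, 0 <= f_ n x) ->
     (forall x, nondecreasing_seq (f_ ^~ x)) ->
     (forall n, P (f_ n)) -> P (fun x => limn (f_ ^~ x))) ->
  forall f, (forall x, 0 <= f x) -> measurable_fun setT f -> P f.
Proof.
move=> P1 PZ PD Pl f f0 mf.
pose f_ := nnsfun_approx measurableT mf.
have -> : f = fun x => limn (fun n => (f_ n x)%:E).
  by apply/funext => x; apply/esym/cvg_lim => //; exact: cvg_nnsfun_approx.
apply: (Pl (fun n x => (f_ n x)%:E)).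
- by move=> n; exact/measurable_EFinP.
- by move=> n x; rewrite lee_fin.
- by move=> x m n mn; rewrite lee_fin; exact/lefP/nd_nnsfun_approx.
move=> n; move: (f_ n) => h.
(* The simple function becomes a sum over the list of its values, so that an induction on the list
   uses only [PD] and [PZ]; the empty sum is the indicator of [set0]. *)
have -> : (fun x => (h x)%:E) = fun x =>
    \sum_(r <- fset_set (range h)) (r%:E * (\1_(h @^-1` [set r]) x)%:E).
  apply/funext => x; rewrite fimfunE fsbig_finite//= -sumEFin.
  by apply: eq_bigr => r _; rewrite EFinM.
have : forall r, r \in (fset_set (range h) : seq R) -> (0 <= r)%R.
  by move=> r; rewrite in_fset_set// => /set_mem[x _ <-].
elim: (fset_set (range h) : seq R) => [_|r s IH rs].
  under eq_fun do rewrite big_nil.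
  rewrite [X in P X](_ : _ = EFin \o \1_set0); first exact: P1.
  by apply/funext => x; rewrite /= indic0.
under eq_fun do rewrite big_cons.
have r0 : (0 <= r)%R by exact/rs/mem_head.
have s0 t : t \in s -> (0 <= t)%R by move=> ts; apply: rs; rewrite in_cons ts orbT.
have mi (t : R) : measurable_fun setT (fun x => (\1_(h @^-1` [set t]) x)%:E : \bar R).
  by apply/measurable_EFinP; exact: measurable_indic.
apply: PD.
- exact: measurable_funeM.
- by move=> x; rewrite mule_ge0// lee_fin.
- by apply: emeasurable_sum => t; exact: measurable_funeM.
- move=> x; rewrite big_seq; apply: sume_ge0 => t ts.
  by rewrite mule_ge0 ?lee_fin// s0.
- apply: PZ => //.
  by apply: (P1 (h @^-1` [set r])).
- exact: IH.
Qed.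

Section mixture.
Context d1 d2 (T1 : measurableType d1) (T2 : measurableType d2) (R : realType).
Variables (M : {measure set T1 -> \bar R}) (D : set T1).
Variable k : T1 -> {measure set T2 -> \bar R}.
Hypothesis mD : measurable D.
Hypothesis mk : forall U, measurable U -> measurable_fun setT (k ^~ U).

(** The measurability proofs are arguments so that a measure structure can be attached to the name.
    Densities, convolutions, compositions of kernels and the laws [QQ x] averaged over [nu] are all
    of this form. *)
Definition mixture of measurable D &
    (forall U, measurable U -> measurable_fun setT (k ^~ U)) :=
  fun A => \int[M]_(x in D) k x A.

Local Notation mix := (mixture mD mk).

Let mix0 : mix set0 = 0.
Proof. by rewrite /mixture integral0_eq// => x _; rewrite measure0. Qed.

Let mix_ge0 A : 0 <= mix A.
Proof. exact: integral_ge0. Qed.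

Let mix_sigma_additive : semi_sigma_additive mix.
Proof.
move=> U mU tU mUU; rewrite [X in _ --> X](_ : _ =
  \int[M]_(x in D) (\sum_(n <oo) k x (U n))); last first.
  apply: eq_integral => V _.
  by apply/esym/cvg_lim => //; exact/measure_semi_sigma_additive.
apply/cvg_closeP; split.
  by apply: is_cvg_nneseries => n _ _; exact: integral_ge0.
rewrite closeE// integral_nneseries// => n.
exact/measurable_funTS/mk.
Qed.

HB.instance Definition _ := isMeasure.Build _ _ _ mix
  mix0 mix_ge0 mix_sigma_additive.

Lemma measurable_integral_kernel (f : T2 -> \bar R) :
  (forall x, 0 <= f x) -> measurable_fun setT f ->
  measurable_fun setT (fun x => \int[k x]_y f y).
Proof. by move=> f0 mf; exact: measurable_fun_integral_kernel. Qed.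

Lemma integral_mixture (f : T2 -> \bar R) :
  (forall x, 0 <= f x) -> measurable_fun setT f ->
  \int[mix]_y f y = \int[M]_(x in D) \int[k x]_y f y.
Proof.
move: f; apply: ge0_measurable_ind.
- move=> A mA; rewrite integral_indic// setIT.
  by apply: eq_integral => x _; rewrite integral_indic// setIT.
- move=> c f c0 mf f0 IH.
  rewrite (ge0_integralZl mix measurableT mf (fun x _ => f0 x))//.
  rewrite IH -(ge0_integralZl M mD)//.
  + apply: eq_integral => x _.
    by rewrite (ge0_integralZl (k x) measurableT mf (fun x _ => f0 x)).
  + exact/measurable_funTS/measurable_integral_kernel.
  + by move=> x _; exact: integral_ge0.
- move=> f g mf f0 mg g0 IHf IHg.
  rewrite (ge0_integralD mix measurableT (fun x _ => f0 x) mf (fun x _ => g0 x) mg).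
  rewrite IHf IHg -(ge0_integralD M mD).
  + apply: eq_integral => x _.
    by rewrite (ge0_integralD (k x) measurableT (fun x _ => f0 x) mf (fun x _ => g0 x) mg).
  + by move=> x _; exact: integral_ge0.
  + exact/measurable_funTS/measurable_integral_kernel.
  + by move=> x _; exact: integral_ge0.
  + exact/measurable_funTS/measurable_integral_kernel.
- move=> f mf f0 ndf IH; rewrite monotone_convergence//.
  under eq_fun do rewrite IH.
  rewrite -monotone_convergence//.
  + by apply: eq_integral => x _; rewrite monotone_convergence// => y _; exact: ndf.
  + by move=> n; exact/measurable_funTS/measurable_integral_kernel.
  + by move=> n x _; exact: integral_ge0.
  + move=> x _ m n mn; apply: ge0_le_integral => //.
    by move=> y _; exact: ndf.
Qed.

End mixture.

Section expeR_extra.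
Context {R : realType}.

Lemma measurable_fineT d (T : measurableType d) (Y : T -> \bar R) :
  measurable_fun setT Y -> measurable_fun setT (fun x => fine (Y x)).
Proof. by move=> mY; apply: measurableT_comp mY; exact: fine_measurable. Qed.

(** Since [expeR] is increasing and onto the nonnegative extended reals, the preimage of a ray is a
    ray or the whole line. *)
Lemma measurable_expeR : measurable_fun setT (@expeR R).
Proof.
apply: (measurability (@ErealGenOInfty.G R)).
  exact: ErealGenOInfty.measurableE.
move=> _ [_ [r ->] <-]; rewrite setTI.
have [r0|r0] := ltP r 0%R.
  rewrite [X in measurable X](_ : _ = setT)//; apply/seteqP; split => // x _ /=.
  by rewrite in_itv/= andbT (lt_le_trans _ (expeR_ge0 _))// lte_fin.
have [y yr] : exists y, expeR y = r%:E by apply: expeR_total; rewrite lee_fin.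
rewrite [X in measurable X](_ : _ = `]y, +oo[%classic); last first.
  by apply/seteqP; split => x /=; rewrite !in_itv/= !andbT -yr lte_expeR.
exact: emeasurable_itv.
Qed.

Lemma expeRN_le1 (x : \bar R) : 0 <= x -> expeR (- x) <= 1.
Proof. by move=> x0; rewrite -expeR0 lee_expeR leeNl oppe0. Qed.

Lemma expeRN_fin_num (x : \bar R) : 0 <= x -> expeR (- x) \is a fin_num.
Proof.
move=> x0; rewrite ge0_fin_numE ?expeR_ge0//.
by rewrite (le_lt_trans (expeRN_le1 x0))// ltry.
Qed.

Lemma cvg_expeRN (x_ : (\bar R)^nat) (x : \bar R) :
  0 <= x -> x_ @ \oo --> x -> expeR (- x_ n) @[n --> \oo] --> expeR (- x).
Proof.
case: x => [x| |]//.
- move=> _ /fine_cvgP[fx cx].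
  apply: cvg_trans (_ : (expR (- fine (x_ n))%R)%:E @[n --> \oo] --> _).
    apply: near_eq_cvg; near=> n; have : x_ n \is a fin_num by near: n.
    by case: (x_ n).
  apply/fine_cvgP; split; first exact: nearW.
  have cNx : (- fine (x_ n))%R @[n --> \oo] --> (- x)%R by exact: (cvgN cx).
  exact: (cvg_comp _ _ cNx (@continuous_expR R (- x)%R)).
- move=> _ /cvgeyPge cx /=.
  apply/fine_cvgP; split.
    have := cx 0%R; apply: filterS => n /=.
    by case: (x_ n) => [r||]//=; rewrite leeNy_eq.
  apply/cvgrPdist_le => e e0.
  have := cx (- ln e)%R; apply: filterS => n /=.
  case: (x_ n) => [r| |]//=.
  + rewrite lee_fin lerNl sub0r normrN ger0_norm ?expR_ge0// => h.
    by rewrite -(lnK (x := e))// ?posrE// ler_expR.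
  + by rewrite subr0 normr0 => _; exact: ltW.
Unshelve. all: by end_near. Qed.

End expeR_extra.
End generic.

(** * Uniqueness of Laplace transforms *)

Section threshold.
Context {R : realType}.
Implicit Types x u : R.

Lemma bernoulli_ineq x n : -1 <= x -> 1 + n%:R * x <= (1 + x) ^+ n.
Proof.
move=> x1; elim: n => [|n IH]; first by rewrite mul0r addr0 expr0.
have x10 : 0 <= 1 + x by lra.
rewrite exprS; apply: le_trans (ler_wpM2l x10 IH).
rewrite -natr1; have : 0 <= n%:R * x ^+ 2 by rewrite mulr_ge0// sqr_ge0.
by rewrite expr2; nra.
Qed.

(** From $(1-u)^n(1+u)^n=(1-u^2)^n\le 1$ and Bernoulli's inequality for $(1+u)^n$. *)
Lemma exprB1_le u n : 0 <= u <= 1 -> (1 - u) ^+ n <= (1 + n%:R * u)^-1.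
Proof.
move=> /andP[u0 u1].
have h0 : 0 < 1 + n%:R * u by rewrite ltr_pwDl// mulr_ge0.
rewrite -[leRHS]mul1r ler_pdivlMr//.
apply: (@le_trans _ _ ((1 - u) ^+ n * (1 + u) ^+ n)).
  rewrite ler_wpM2l//; first by rewrite exprn_ge0// subr_ge0.
  by apply: bernoulli_ineq; lra.
rewrite -exprMn; apply: exprn_ile1; nra.
Qed.

(** With $y=\sqrt{x}$, Bernoulli's inequality bounds $n y^n$, and the other factor $y^n$ tends to
    0. *)
Lemma cvg_mulrn_expr x : 0 <= x -> x < 1 -> n%:R * x ^+ n @[n --> \oo] --> 0.
Proof.
move=> x0 x1; have [->|xn0] := eqVneq x 0.
  apply: cvg_near_cst; near=> n; rewrite expr0n.
  have : (0 < n)%N by near: n; exact: nbhs_infty_gt.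
  by rewrite lt0n => /negPf ->; rewrite mulr0.
have {xn0}x0 : 0 < x by rewrite lt_def xn0.
pose y := Num.sqrt x.
have y0 : 0 < y by rewrite sqrtr_gt0.
have yx : y ^+ 2 = x by rewrite sqr_sqrtr// ltW.
have y1 : y < 1 by rewrite -(@expr_lt1 _ 2)// ?yx// ltW.
pose h := y^-1 - 1.
have h0 : 0 < h by rewrite subr_gt0 invf_gt1.
have key n : n%:R * y ^+ n <= h^-1.
  have : 1 + n%:R * h <= (1 + h) ^+ n by apply: bernoulli_ineq; lra.
  have -> : 1 + h = y^-1 by rewrite /h addrC subrK.
  rewrite exprVn => nh.
  have yn : 0 < y ^+ n by rewrite exprn_gt0.
  have : n%:R * h <= (y ^+ n)^-1 by lra.
  rewrite -[X in _ <= X]mul1r ler_pdivlMr// mulrAC -ler_pdivlMr//.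
  by rewrite mul1r.
apply: (@squeeze_cvgr _ _ _ _ (fun=> 0) (fun n => h^-1 * y ^+ n)).
- near=> n; rewrite mulr_ge0 ?exprn_ge0 ?(ltW x0)//=.
  rewrite -yx exprAC expr2 mulrA ler_wpM2r//.
  by rewrite exprn_ge0// ltW.
- exact: cvg_cst.
- rewrite -[X in _ --> X](mulr0 h^-1); apply: cvgM; first exact: cvg_cst.
  by apply: cvg_expr; rewrite ger0_norm ?ltW.
Unshelve. all: by end_near. Qed.

(** Bernoulli's inequality gives the lower bound $1-n(2x)^n$. *)
Lemma threshold_cvg1 x : 0 <= x -> 2 * x < 1 ->
  (1 - x ^+ n) ^+ (n * 2 ^ n) @[n --> \oo] --> (1 : R).
Proof.
move=> x0 x1.
have xn n : 0 <= x ^+ n <= 1 by rewrite exprn_ge0//= exprn_ile1//; lra.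
apply: (@squeeze_cvgr _ _ _ _ (fun n => 1 - n%:R * (2 * x) ^+ n) (fun=> 1)).
- near=> n; have /andP[xn0 xn1] := xn n; apply/andP; split.
    apply: le_trans (bernoulli_ineq (x := - x ^+ n) _ _); last by lra.
    by rewrite exprMn natrM natrX; lra.
  by apply: exprn_ile1; lra.
- rewrite -[X in _ --> X]subr0; apply: cvgB; first exact: cvg_cst.
  by apply: cvg_mulrn_expr => //; lra.
- exact: cvg_cst.
Unshelve. all: by end_near. Qed.

(** The upper bound is $(1+n(2x)^n)^{-1}\le 1/(n+1)$. The factor [n] in the exponent gives the limit
    0 at $x=1/2$ as well, so that no point is exceptional. *)
Lemma threshold_cvg0 x : x <= 1 -> 1 <= 2 * x ->
  (1 - x ^+ n) ^+ (n * 2 ^ n) @[n --> \oo] --> (0 : R).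
Proof.
move=> x1 x2; have x0 : 0 <= x by lra.
have xn n : 0 <= x ^+ n <= 1 by rewrite exprn_ge0//= exprn_ile1//; lra.
apply: (@squeeze_cvgr _ _ _ _ (fun=> 0) harmonic).
- near=> n; have /andP[xn0 xn1] := xn n; apply/andP; split.
    by rewrite exprn_ge0//; lra.
  apply: le_trans (exprB1_le _ (xn n)) _.
  rewrite /harmonic/= lef_pV2 ?posrE//; last first.
    by rewrite ltr_pwDl// mulr_ge0.
  rewrite -natr1 addrC lerD2l natrM natrX -mulrA -exprMn ler_peMr//.
  by rewrite exprn_ege1.
- exact: cvg_cst.
- exact: cvg_harmonic.
Unshelve. all: by end_near. Qed.

End threshold.

Section laplace_uniqueness.
Context d (T : measurableType d) (R : realType).
Variables (mu1 mu2 : {measure set T -> \bar R}) (X : T -> \bar R).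
Hypothesis mX : measurable_fun setT X.
Hypothesis X0 : forall x, (0 <= X x)%E.
Hypothesis fin1 : (mu1 setT < +oo)%E.
Hypothesis fin2 : (mu2 setT < +oo)%E.
Hypothesis lap12 : forall a : R, 0 <= a ->
  (\int[mu1]_x expeR (- (a%:E * X x)) = \int[mu2]_x expeR (- (a%:E * X x)))%E.

Let e (a : R) x := fine (expeR (- (a%:E * X x))%E).

Let eE a x : 0 <= a -> expeR (- (a%:E * X x))%E = (e a x)%:E.
Proof. by move=> a0; rewrite fineK// expeRN_fin_num// mule_ge0. Qed.

Let e01 a x : 0 <= a -> 0 <= e a x <= 1.
Proof.
by move=> a0; rewrite -!lee_fin -eE// expeR_ge0/= expeRN_le1// mule_ge0.
Qed.

Let me a : measurable_fun setT (e a).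
Proof.
apply: measurable_fineT.
apply: measurableT_comp; first exact: measurable_expeR.
apply: measurableT_comp => //; exact: measurable_funeM.
Qed.

Let eX a x n : 0 <= a -> e a x ^+ n = e (a *+ n) x.
Proof.
move=> a0; elim: n => [|n IH].
  (* By the convention $0\cdot\infty=0$, [e 0 x] is 1 even where [X x] is infinite, in agreement
     with the zeroth power. *)
  by rewrite mulr0n expr0 /e mul0e oppe0 expeR0.
have an0 : 0 <= a *+ n by rewrite mulrn_wge0.
rewrite exprS IH; apply: EFin_inj; rewrite EFinM -!eE ?mulrn_wge0// -expeRD.
congr expeR; rewrite -oppeD; last first.
  by rewrite ge0_adde_def// inE mule_ge0.
by rewrite mulrS EFinD ge0_muleDl// lee_fin.
Qed.

Let fin_int (mu : {measure set T -> \bar R}) (f : T -> R) (M : R) :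
  (mu setT < +oo)%E -> measurable_fun setT f -> (forall x, `|f x| <= M) ->
  mu.-integrable setT (EFin \o f).
Proof.
move=> muT mf fM; apply: measurable_bounded_integrable => //.
by exists M; split; [exact: num_real|move=> y My x _; exact: le_trans (fM x) (ltW My)].
Qed.

Let int_e (mu : {measure set T -> \bar R}) a : 0 <= a -> (mu setT < +oo)%E ->
  mu.-integrable setT (EFin \o e a).
Proof.
move=> a0 muT; apply: (@fin_int mu _ 1) => // x.
by have /andP[h0 h1] := e01 x a0; rewrite ger0_norm.
Qed.

(** Powers of $e^{-aX}$ are the exponentials $e^{-iaX}$, so the hypothesis passes to polynomials by
    linearity. *)
Let int_poly a (p : {poly R}) : 0 <= a ->
  (\int[mu1]_x (p.[e a x])%:E = \int[mu2]_x (p.[e a x])%:E)%E.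
Proof.
move=> a0.
have intp (mu : {measure set T -> \bar R}) : (mu setT < +oo)%E ->
    (\int[mu]_x (p.[e a x])%:E =
     \sum_(i < size p) (p`_i)%:E * \int[mu]_x expeR (- ((a *+ i)%:E * X x)))%E.
  move=> muT; under eq_integral do rewrite horner_coef -sumEFin.
  rewrite integral_sum//; last first.
    move=> i; under eq_fun do rewrite eX// EFinM.
    by apply: integrableZl => //; apply: int_e => //; rewrite mulrn_wge0.
  apply: eq_bigr => i _; under eq_integral do rewrite eX// EFinM.
  rewrite integralZl//; last by apply: int_e => //; rewrite mulrn_wge0.
  by congr (_ * _)%E; apply: eq_integral => x _; rewrite eE// mulrn_wge0.
rewrite !intp//; apply: eq_bigr => i _; rewrite lap12// mulrn_wge0//.
Qed.

(* With [x = e^{-aX}] and [a = ln 2 / t], the polynomials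
   [(1 - x^n)^(n 2^n)] converge to the indicator of [X > t]. *)
Let ray (t : R) : 0 < t -> mu1 (X @^-1` `]t%:E, +oo[) = mu2 (X @^-1` `]t%:E, +oo[).
Proof.
move=> t0; pose a := ln 2 / t.
have a0 : 0 < a by rewrite divr_gt0// ln_gt0// ltr1n.
pose p n : {poly R} := (1 - 'X^n) ^+ (n * 2 ^ n).
have pE n x : (p n).[e a x] = (1 - e a x ^+ n) ^+ (n * 2 ^ n).
  by rewrite /p horner_exp !hornerE.
have xt x : (t%:E < X x)%E = (2 * e a x < 1).
  have : expeR (- (ln 2)%:E) = (2^-1 : R)%:E by rewrite /= expRN lnK// posrE.
  move=> h; rewrite -ltr_pdivlMl// mulr1 -lte_fin -eE ?(ltW a0)// -h.
  rewrite lte_expeR lteN2.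
  rewrite -(lte_pmul2l (z := a%:E)) ?lte_fin//.
  by rewrite -EFinM /a mulfVK// gt_eqF.
have cvgp (mu : {measure set T -> \bar R}) : (mu setT < +oo)%E ->
    (\int[mu]_x ((p n).[e a x])%:E @[n --> \oo] --> mu (X @^-1` `]t%:E, +oo[))%E.
  move=> muT.
  have mA : measurable (X @^-1` `]t%:E, +oo[).
    by rewrite -[X in measurable X]setTI; apply: mX => //; exact: emeasurable_itv.
  have -> : mu (X @^-1` `]t%:E, +oo[) =
      (\int[mu]_x (\1_(X @^-1` `]t%:E, +oo[) x)%:E)%E.
    by rewrite integral_indic// setIT.
  have := @dominated_convergence _ _ _ mu setT measurableT
    (fun n x => ((p n).[e a x])%:E) (fun x => (\1_(X @^-1` `]t%:E, +oo[) x)%:E)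
    (cst 1%E).
  case.
  - move=> n; apply/measurable_EFinP; under eq_fun do rewrite pE.
    apply: measurable_funX; apply: measurable_funB => //.
    by apply: measurable_funX.
  - exact/measurable_EFinP/measurable_indic.
  - apply: aeW => x _; apply/fine_cvgP; split; first exact: nearW.
    have xA : (x \in X @^-1` `]t%:E, +oo[) = (t%:E < X x)%E.
      by apply/idP/idP => [/set_mem|h]; [|apply/mem_set]; rewrite /= in_itv/= andbT.
    rewrite /= indicE xA xt.
    have /andP[ea0 ea1] := e01 x (ltW a0).
    under eq_fun do rewrite pE.
    case: ltP => h; first exact: threshold_cvg1.
    exact: threshold_cvg0.
  - by apply/(@fin_int mu (cst 1) 1) => // x; rewrite /= normr1.
  - apply: aeW => x n _; rewrite lee_fin pE.
    have /andP[ea0 ea1] := e01 x (ltW a0).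
    have h0 : 0 <= 1 - e a x ^+ n by rewrite subr_ge0 exprn_ile1.
    rewrite ger0_norm ?exprn_ge0// exprn_ile1//.
    by rewrite lerBlDr lerDl exprn_ge0.
  - by move=> _ _.
have c1 := cvgp _ fin1; have c2 := cvgp _ fin2.
rewrite -(cvg_lim _ c1)// -(cvg_lim _ c2)//.
by congr (limn _); apply/funext => n; rewrite int_poly// ltW.
Qed.

(** The measures of the rays are known from [ray], and the rays form a generating class stable under
    intersection. *)
Theorem laplace_unique (C : set (\bar R)) : measurable C ->
  mu1 (X @^-1` C) = mu2 (X @^-1` C).
Proof.
have tot : mu1 setT = mu2 setT.
  have := lap12 (lexx 0); under eq_integral do rewrite mul0e oppe0 expeR0.
  under [in X in _ = X -> _]eq_integral do rewrite mul0e oppe0 expeR0.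
  by rewrite !integral_cst// !mul1e.
have mXp (r : R) : measurable (X @^-1` `]r%:E, +oo[).
  by rewrite -[X in measurable X]setTI; apply: mX => //; exact: emeasurable_itv.
have rayT r : mu1 (X @^-1` `]r%:E, +oo[) = mu2 (X @^-1` `]r%:E, +oo[).
  have [r0|r0|->] := ltgtP r 0.
  - rewrite (_ : _ @^-1` _ = setT)//; apply/seteqP; split => // x _ /=.
    by rewrite in_itv/= andbT (lt_le_trans _ (X0 x))// lte_fin.
  - exact: ray.
  (* [ray] needs a positive threshold, since $a=\ln 2/t$; the ray at 0 is the increasing union of
     the rays at $1/(n+1)$. *)
  - have XE : X @^-1` `]0%:E, +oo[ = \bigcup_n X @^-1` `](n.+1%:R^-1)%:E, +oo[.
      apply/seteqP; split => [x|x [n _]] /=; rewrite !in_itv/= !andbT.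
        case XxE : (X x) => [y| |]//=; rewrite ?lte_fin => y0.
          exists (Num.truncn y^-1) => //=; rewrite in_itv/= andbT XxE lte_fin.
          by rewrite invf_plt ?posrE// truncnS_gt.
        by exists 0 => //=; rewrite in_itv/= XxE ltry.
      by apply: lt_trans; rewrite lte_fin.
    have nd : nondecreasing_seq (fun n => X @^-1` `](n.+1%:R^-1)%:E, +oo[).
      move=> m n mn; apply/subsetPset => x /=; rewrite !in_itv/= !andbT.
      by apply: le_lt_trans; rewrite lee_fin lef_pV2 ?posrE// ler_nat.
    have c1 := nondecreasing_cvg_mu (mu := mu1) (fun n => mXp _)
      (bigcupT_measurable _ (fun n => mXp _)) nd.
    have c2 := nondecreasing_cvg_mu (mu := mu2) (fun n => mXp _)
      (bigcupT_measurable _ (fun n => mXp _)) nd.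
    rewrite XE -(cvg_lim _ c1)// -(cvg_lim _ c2)//.
    by congr (limn _); apply/funext => n /=; exact: ray.
move=> mC.
(* The whole line is added because a countable cover by members of [G] is required and rays with
   real endpoints miss [-oo]. *)
pose G := [set A : set (\bar R) | A = setT \/ exists r : R, A = `]r%:E, +oo[%classic].
have mG : measurable = <<s G >> :> set (set (\bar R)).
  apply: (etrans (@ErealGenOInfty.measurableE R)).
  apply/seteqP; split.
    by apply: sub_sigma_algebra2 => A [r ->]; right; exists r.
  apply: smallest_sub; first exact: smallest_sigma_algebra.
  move=> A [->|[r ->]]; first exact: (@measurableT _ (g_sigma_algebraType _)).
  by apply: sub_sigma_algebra; exists r.
apply: (@measure_unique _ R (\bar R) G (fun=> setT) mG _ _ _
  (pushforward mu1 X) (pushforward mu2 X)) => //.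
- move=> A B [->|[r ->]]; first by rewrite setTI.
  move=> [->|[s ->]]; first by rewrite setIT; right; exists r.
  right; exists (Num.max r s); apply/seteqP.
  split=> x /=; rewrite !in_itv/= !andbT EFin_max gt_max.
    by move=> [-> ->].
  by move=> /andP[].
- by left.
- by rewrite bigcup_const.
- move=> A [->|[r ->]]; last exact: rayT.
  exact: tot.
Qed.

End laplace_uniqueness.

(** * Poisson random measures *)

Section expeR_sums.
Context {R : realType}.
Local Open Scope ereal_scope.

Lemma expeRN_sum (I : Type) (s : seq I) (x : I -> \bar R) :
  (forall i, 0 <= x i) ->
  expeR (- \sum_(i <- s) x i) = \prod_(i <- s) expeR (- x i).
Proof.
move=> x0; elim: s => [|i s IH]; first by rewrite !big_nil oppe0 expeR0.
rewrite !big_cons -IH -expeRD oppeD//.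
by apply: ge0_adde_def; rewrite inE; [exact: x0|exact: sume_ge0].
Qed.

Lemma nneseries_exp (x : R) : (0 <= x)%R ->
  \sum_(k <oo) (x ^+ k / k`!%:R)%:E = (expR x)%:E.
Proof.
move=> x0; rewrite expRE -EFin_lim; last first.
  rewrite /pseries/=; under eq_fun do rewrite mulrC.
  exact: is_cvg_series_exp_coeff.
apply/congr_lim/funext => n/=; rewrite /pseries/= /series/= -sumEFin//.
by under eq_bigr do rewrite mulrC.
Qed.

End expeR_sums.

(** * Laplace functional of a Poisson random measure *)

Section campbell.
Local Open Scope ereal_scope.
Context d d' (Omega : measurableType d) (E : measurableType d') (R : realType).
Variables (Pr : probability Omega R) (mu : {sigma_finite_measure set E -> \bar R}).
Variable N : Omega -> {measure set E -> \bar R}.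
Hypothesis hN : is_poisson_random_measure Pr mu N.

Lemma measurable_prm A : measurable A ->
  measurable_fun [set: Omega] (fun om => N om A : \bar R).
Proof. by case: hN => + _ _; exact. Qed.

(** Sum over the values of $N(A)$, which are almost surely natural numbers because the Poisson
    weights add up to 1. *)
Lemma poisson_laplace A (a : R) : measurable A -> mu A < +oo -> (0 <= a)%R ->
  \int[Pr]_om expeR (- (a%:E * N om A)) =
  expeR (- ((1 - expR (- a))%:E * mu A)).
Proof.
move=> mA muA a0; have [_ pois _] := hN.
pose m := fine (mu A); have m0 : (0 <= m)%R by rewrite fine_ge0.
have muE : mu A = m%:E by rewrite fineK// ge0_fin_numE.
pose F k := [set om | N om A = k%:R%:E].
have mF k : measurable (F k).
  rewrite [F k](_ : _ = setT `&` (fun om => N om A) @^-1` [set k%:R%:E]).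
    by apply: measurable_prm => //; exact: emeasurable_set1.
  by rewrite setTI.
have PF k : Pr (F k) = (m ^+ k / k`!%:R * expR (- m))%:E by rewrite pois.
have tF : trivIset setT F.
  apply/trivIsetP => i j _ _ ij; apply/seteqP; split => // om [Fi Fj].
  have := etrans (esym (Fi : N om A = _)) (Fj : N om A = _) => -[].
  by move/eqP; rewrite eqr_nat (negPf ij).
(* Used with [c = 1] for the total mass and with $c=e^{-a}$ for the transform. *)
have sumF (c : R) : (0 <= c)%R ->
    \sum_(k <oo) (c ^+ k)%:E * Pr (F k) = expeR (- (m - c * m)%:E).
  move=> c0; under eq_eseriesr.
    move=> k _; rewrite PF -EFinM mulrA mulrA -exprMn mulrC EFinM; over.
  rewrite nneseriesZl; last first.
    by move=> k _; rewrite lee_fin divr_ge0// exprn_ge0// mulr_ge0.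
  rewrite nneseries_exp ?mulr_ge0// -EFinM -expRD/= opprB.
  by rewrite addrC.
have PU : Pr (\bigcup_k F k) = 1.
  rewrite measure_semi_bigcup//; last exact: bigcupT_measurable.
  have := sumF 1%R ler01; rewrite mul1r subrr oppe0 expeR0 => <-.
  by apply: eq_eseriesr => k _; rewrite expr1n mul1e.
have mX : measurable_fun setT (fun om => N om A) by exact: measurable_prm.
have mf : measurable_fun setT (fun om => expeR (- (a%:E * N om A))).
  apply: (measurableT_comp measurable_expeR).
  by apply: measurableT_comp => //; exact: measurable_funeM.
have mFU : measurable (\bigcup_k F k) by exact: bigcupT_measurable.
rewrite (ge0_negligible_integral (measurableC mFU))//; last 2 first.
- by move=> om _; exact: expeR_ge0.
- by have := probability_setC Pr mFU; rewrite PU subee.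
rewrite setTD setCK (ge0_integral_bigcup Pr mF)//; last 2 first.
- exact: measurable_funTS.
- by move=> om _; exact: expeR_ge0.
transitivity (\sum_(k <oo) (expR (- a) ^+ k)%:E * Pr (F k)).
  apply: eq_eseriesr => k _.
  rewrite (eq_integral (cst (expR (- a) ^+ k)%:E)); last first.
    move=> om /set_mem Xk; rewrite (Xk : N om A = _) -EFinM /= -expRM_natl.
    by congr (expR _)%:E; rewrite mulrN mulrC.
  by rewrite integral_cst.
by rewrite sumF ?expR_ge0// muE -EFinM mulrBl mul1r.
Qed.

(** Independence is given for events; the factors are passed from indicators to functions one at a
    time, the others being held fixed. *)
Lemma prm_prod_expectation n (A : 'I_n -> set E) (h : 'I_n -> \bar R -> R) :
  (forall i, measurable (A i)) -> (forall i, mu (A i) < +oo) ->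
  trivIset setT A -> (forall i, measurable_fun setT (h i)) ->
  (forall i y, (0 <= h i y)%R) -> (forall i y, 0 <= y -> (h i y <= 1)%R) ->
  \int[Pr]_om (\prod_(i < n) h i (N om (A i)))%R%:E =
  \prod_(i < n) \int[Pr]_om (h i (N om (A i)))%:E.
Proof.
move=> mA muA tA mh h0 h1; have [_ _ ind] := hN.
(* The factors of index at least [k] are indicators: [k = 0] is the independence of events, [k = n]
   the claim. *)
suff H k : (forall i : 'I_n, (k <= i)%N -> exists2 B, measurable B & h i = \1_B) ->
    \int[Pr]_om (\prod_(i < n) h i (N om (A i)))%R%:E =
    \prod_(i < n) \int[Pr]_om (h i (N om (A i)))%:E.
  by apply: (H n) => i; rewrite leqNgt ltn_ord.
elim: k h mh h0 h1 => [|k IH] h mh h0 h1 hk.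
  have /choice[C hC] : forall i, exists B, measurable B /\ h i = \1_B.
    by move=> i; have [B mB hB] := hk i (leq0n _); exists B.
  have mC i : measurable (C i) by case: (hC i).
  have mAC i : measurable [set om | C i (N om (A i))].
    rewrite -[X in measurable X]setTI.
    exact: (measurable_prm (mA i)).
  transitivity (Pr [set om | forall i, C i (N om (A i))]).
    have mI : measurable [set om | forall i, C i (N om (A i))].
      rewrite (_ : [set _ | _] = \bigcap_(i in setT) [set om | C i (N om (A i))]).
        by apply: fin_bigcap_measurable.
      by apply/seteqP; split => om h' i //=; exact: h'.
    rewrite -[X in _ = Pr X]setIT -(integral_indic Pr measurableT mI).
    apply: eq_integral => om _; congr EFin; rewrite indicE.
    under eq_bigr do rewrite (proj2 (hC _)) indicE.
    case: (boolP (om \in _)) => [/set_mem/= hom|/negP hom].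
      by rewrite big1// => i _; rewrite mem_set.
    have /existsNP[i hi] : ~ forall i, C i (N om (A i)).
      by move=> hom'; apply: hom; exact/mem_set.
    by rewrite (bigD1 i)//= memNset// mul0r.
  rewrite ind//; apply: eq_bigr => i _.
  rewrite -[in LHS](setIT [set om | _]) -integral_indic//.
  by apply: eq_integral => om _; case: (hC i) => _ ->; rewrite !indicE.
have [kn|nk] := ltnP k n; last first.
  by apply: IH => // i ki; have := ltn_ord i; rewrite ltnNge (leq_trans nk ki).
pose j := Ordinal kn.
pose W om := (\prod_(i < n | i != j) h i (N om (A i)))%R.
pose C := \prod_(i < n | i != j) \int[Pr]_om (h i (N om (A i)))%:E.
(* With the other factors frozen, both sides are additive, homogeneous and continuous along
   increasing sequences in [f], so that [f] reduces to an indicator, where the induction hypothesis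
   applies. *)
suff H (f : \bar R -> \bar R) : (forall y, 0 <= f y) -> measurable_fun setT f ->
    \int[Pr]_om (f (N om (A j)) * (W om)%:E) = \int[Pr]_om f (N om (A j)) * C.
  have := H (EFin \o h j) _ _; rewrite (bigD1 j)//= => <-.
  - by apply: eq_integral => om _; rewrite (bigD1 j)//=.
  - by move=> y; rewrite lee_fin.
  - exact/measurable_EFinP.
have mX i : measurable_fun setT (fun om => N om (A i)) by exact: measurable_prm.
have mhX i : measurable_fun setT (fun om => h i (N om (A i))).
  exact: (measurableT_comp (mh i) (mX i)).
have mW : measurable_fun setT W.
  rewrite /W; under eq_fun do rewrite -big_filter.
  by apply: measurable_prod => i _.
have W0 om : (0 <= W om)%R by apply: prodr_ge0.
have Cfin : C \is a fin_num.
  apply: prode_fin_num => i _; rewrite ge0_fin_numE; last first.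
    by apply: integral_ge0 => om _; rewrite lee_fin.
  apply: (@le_lt_trans _ _ (\int[Pr]_om (cst 1 om))).
    apply: ge0_le_integral => //.
    - by move=> om _; rewrite lee_fin.
    - exact/measurable_EFinP.
    - by move=> om _; rewrite lee_fin h1.
  by rewrite integral_cst// mul1e (le_lt_trans (probability_le1 Pr measurableT))// ltry.
have C0 : 0 <= C by apply: prode_ge0 => i _; apply: integral_ge0 => om _; rewrite lee_fin.
have mfX (g : \bar R -> \bar R) : measurable_fun setT g ->
    measurable_fun setT (fun om => g (N om (A j))).
  by move=> mg; exact: (measurableT_comp mg (mX j)).
have mfXW (g : \bar R -> \bar R) : measurable_fun setT g ->
    measurable_fun setT (fun om => g (N om (A j)) * (W om)%:E).
  by move=> mg; apply: emeasurable_funM; [exact: mfX|exact/measurable_EFinP].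
move: f; apply: ge0_measurable_ind.
- move=> B mB; pose h' i := if i == j then \1_B else h i.
  have h'j : h' j = \1_B by rewrite /h' eqxx.
  have h'N i : i != j -> h' i = h i by rewrite /h' => /negPf ->.
  have : \int[Pr]_om (\prod_(i < n) h' i (N om (A i)))%R%:E =
      \prod_(i < n) \int[Pr]_om (h' i (N om (A i)))%:E.
    apply: IH.
    + move=> i; rewrite /h'; case: ifPn => _; last exact: mh.
      exact: measurable_indic.
    + by move=> i y; rewrite /h'; case: ifPn => _; [rewrite indicE|exact: h0].
    + move=> i y y0; rewrite /h'; case: ifPn => _; last exact: h1.
      by rewrite indicE; case: (_ \in _).
    + move=> i ki; rewrite /h'; case: eqP => [_|/eqP ij]; first by exists B.
      by apply: hk; rewrite ltn_neqAle ki andbT; apply: contra ij => /eqP ik; apply/eqP/val_inj.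
  rewrite (bigD1 j)//= h'j.
  rewrite [X in _ = _ * X](_ : _ = C); last first.
    by apply: eq_bigr => i ij; apply: eq_integral => om _; rewrite h'N.
  move=> <-; apply: eq_integral => om _.
  rewrite (bigD1 j)//= h'j EFinM; congr (_ * (_)%:E).
  by apply: eq_bigr => i ij; rewrite h'N.
- move=> c f c0 mf f0 H; under eq_integral do rewrite -muleA.
  rewrite (ge0_integralZl Pr measurableT (mfXW _ mf))//; last first.
    by move=> om _; rewrite mule_ge0// lee_fin.
  rewrite H (ge0_integralZl Pr measurableT (mfX _ mf))//.
  by rewrite muleA.
- move=> f g mf f0 mg g0 Hf Hg.
  under eq_integral do rewrite ge0_muleDl//.
  rewrite (ge0_integralD Pr measurableT)//; try exact: mfXW; last 2 first.
  + by move=> om _; rewrite mule_ge0// lee_fin.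
  + by move=> om _; rewrite mule_ge0// lee_fin.
  rewrite Hf Hg (ge0_integralD Pr measurableT)//; try exact: mfX.
  by rewrite [RHS]ge0_muleDl// integral_ge0.
- move=> f mf f0 ndf Hf.
  have cf y : cvgn (f ^~ y) by apply: ereal_nondecreasing_is_cvgn; exact: ndf.
  under eq_integral do rewrite -limeMr//.
  rewrite monotone_convergence//; last 3 first.
  + by move=> m; exact: mfXW.
  + by move=> m om _; rewrite mule_ge0// lee_fin.
  + by move=> om _ m1 m2 m12; rewrite lee_wpmul2r ?lee_fin//; exact: ndf.
  rewrite (monotone_convergence Pr measurableT (fun m => mfX _ (mf m))
    (fun m om _ => f0 m _) (fun om _ => ndf _)).
  rewrite -limeMr//; last first.
    apply: ereal_nondecreasing_is_cvgn => m1 m2 m12; apply: ge0_le_integral => //.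
    * exact: mfX.
    * exact: mfX.
    * by move=> om _; exact: ndf.
  by congr (limn _); apply/funext => m; exact: Hf.
Qed.

Import HBNNSimple.

Let nnsfun_levels (g : {nnsfun E >-> R}) : exists n, exists r : 'I_n -> R,
  [/\ forall i, (0 < r i)%R, injective r &
      forall x, g x != 0%R -> exists i, g x = r i].
Proof.
pose s := [seq t <- (fset_set (range g) : seq R) | (0 < t)%R].
have us : uniq s by rewrite filter_uniq// fset_uniq.
exists (size s), (fun i => nth 0%R s i); split.
- move=> i; have := mem_nth 0%R (ltn_ord i).
  by rewrite mem_filter => /andP[].
- by move=> i j /eqP; rewrite nth_uniq// => /eqP/val_inj.
- move=> x gx0; have xs : g x \in s.
    rewrite mem_filter lt_def gx0 fun_ge0/=.
    by rewrite in_fset_set//; apply/mem_set; exists x.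
  have lts : (index (g x) s < size s)%N by rewrite index_mem.
  by exists (Ordinal lts); rewrite /= nth_index.
Qed.

(** The level 0 is left out: its preimage may have infinite measure, and it does not contribute
    since [phi] vanishes at 0. *)
Let integral_levels (M : {measure set E -> \bar R}) (g : {nnsfun E >-> R}) n
    (r : 'I_n -> R) (phi : R -> R) :
  (forall i, (0 < r i)%R) -> injective r ->
  (forall x, g x != 0%R -> exists i, g x = r i) ->
  phi 0%R = 0%R -> (forall i, (0 <= phi (r i))%R) ->
  \int[M]_x (phi (g x))%:E =
  \sum_(i < n) (phi (r i))%:E * M (g @^-1` [set r i]).
Proof.
move=> r0 ri gr phi0 phir.
transitivity (\int[M]_x \sum_(i < n)
    ((phi (r i))%:E * (\1_(g @^-1` [set r i]) x)%:E)).
  apply: eq_integral => x _.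
  have [gx0|/gr[i gxi]] := eqVneq (g x) 0%R.
    rewrite gx0 phi0 big1// => i _; rewrite indicE memNset ?mule0//= gx0 => ri0.
    by have := r0 i; rewrite -ri0 ltxx.
  rewrite (bigD1 i)//= indicE mem_set//= mule1 big1 ?adde0 ?gxi// => j ji.
  rewrite indicE memNset ?mule0//= gxi => /ri ij; by rewrite ij eqxx in ji.
rewrite ge0_integral_sum//; last 2 first.
- by move=> i; apply: measurable_funeM; exact/measurable_EFinP/measurable_indic.
- by move=> i x _; apply: mule_ge0; rewrite lee_fin.
apply: eq_bigr => i _; rewrite ge0_integralZl//; last 2 first.
- exact/measurable_EFinP/measurable_indic.
- by rewrite lee_fin.
by rewrite integral_indic// setIT.
Qed.

(** The positive levels of [g] are disjoint sets, so their counts are independent and the transform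
    factorises into Poisson transforms. *)
Let campbell_nnsfun (g : {nnsfun E >-> R}) :
  (forall r : R, (0 < r)%R -> mu (g @^-1` [set r]) < +oo) ->
  \int[Pr]_om expeR (- \int[N om]_x (g x)%:E) =
  expeR (- \int[mu]_x (1 - expR (- g x))%:E).
Proof.
move=> gfin; have [n [r [r0 ri gr]]] := nnsfun_levels g.
pose A i := g @^-1` [set r i].
have mA i : measurable (A i) by exact: measurable_funPTI.
have muA i : mu (A i) < +oo by exact: gfin.
have tA : trivIset setT A.
  apply/trivIsetP => i j _ _ ij; apply/seteqP; split => // x [/= gi gj].
  by move: ij; rewrite (ri i j) ?eqxx//; exact: (etrans (esym gi) gj).
pose h i (y : \bar R) := fine (expeR (- ((r i)%:E * y))).
have hE i y : 0 <= y -> expeR (- ((r i)%:E * y)) = (h i y)%:E.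
  by move=> y0; rewrite fineK// expeRN_fin_num// mule_ge0// lee_fin ltW.
rewrite (integral_levels mu (phi := fun t => (1 - expR (- t))%R) r0 ri gr); last 2 first.
- by rewrite oppr0 expR0 subrr.
- by move=> i; rewrite subr_ge0 expR_le1 oppr_le0 ltW.
transitivity (\int[Pr]_om (\prod_(i < n) h i (N om (A i)))%R%:E).
  apply: eq_integral => om _.
  rewrite (integral_levels (N om) (phi := id) r0 ri gr)//; last first.
    by move=> i; exact: ltW.
  rewrite expeRN_sum; last by move=> i; rewrite mule_ge0// lee_fin ltW.
  by rewrite -prodEFin; apply: eq_bigr => i _; rewrite hE.
rewrite prm_prod_expectation//; last 3 first.
- move=> i; apply: measurable_fineT.
  apply: (measurableT_comp measurable_expeR).
  by apply: measurableT_comp => //; exact: measurable_funeM.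
- by move=> i y; rewrite fine_ge0// expeR_ge0.
- move=> i y y0; rewrite -lee_fin -hE// expeRN_le1// mule_ge0// lee_fin.
  exact: ltW.
rewrite expeRN_sum; last first.
  by move=> i; rewrite mule_ge0// lee_fin subr_ge0 expR_le1 oppr_le0 ltW.
apply: eq_bigr => i _; rewrite -poisson_laplace//; [|exact: gfin|exact: ltW].
by apply: eq_integral => om _; rewrite hE.
Qed.

Lemma measurable_prm_integral (F : E -> \bar R) :
  (forall x, 0 <= F x) -> measurable_fun setT F ->
  measurable_fun setT (fun om => \int[N om]_x F x).
Proof.
move=> F0 mF; apply: measurable_fun_integral_kernel => //.
exact: measurable_prm.
Qed.

(** Approximation by simple functions: monotone convergence in the exponents, and dominated
    convergence under [Pr], the exponentials being at most 1. *)
Theorem campbell (F : E -> R) :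
  (forall x, (0 <= F x)%R) -> measurable_fun setT F ->
  \int[Pr]_om expeR (- \int[N om]_x (F x)%:E) =
  expeR (- \int[mu]_x (1 - expR (- F x))%:E).
Proof.
move=> F0 mF.
have [S [ST ndS mS]] : exists S : (set E)^nat, [/\ setT = \bigcup_i S i,
    nondecreasing_seq S & forall i, measurable (S i) /\ mu (S i) < +oo].
  exact/sigma_finiteP/sigma_finiteT.
have mEF : measurable_fun setT (EFin \o F) by exact/measurable_EFinP.
pose f := nnsfun_approx measurableT mEF.
(* The simple functions are cut off to sets of finite intensity, since the Poisson law is only
   specified there. *)
pose g n := proj_nnsfun (f n) (proj1 (mS n)).
have gE n x : g n x = (f n x * \1_(S n) x)%R by [].
have fx x : (f n x)%:E @[n --> \oo] --> (F x)%:E.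
  by apply: (cvg_nnsfun_approx measurableT mEF) => // y _; rewrite lee_fin.
have ndf x m n : (m <= n)%N -> (f m x <= f n x)%R.
  by move=> mn; exact/lefP/nd_nnsfun_approx.
have ndg x m n : (m <= n)%N -> (g m x <= g n x)%R.
  move=> mn; rewrite !gE ler_pM// ?ndf// !indicE ler_nat.
  case: (boolP (x \in S m)) => // /set_mem xSm.
  by rewrite mem_set//; have /subsetPset := ndS _ _ mn; exact.
have gx x : g n x @[n --> \oo] --> F x.
  have [N0 _ xN0] : (\bigcup_i S i) x by rewrite -ST.
  have /fine_cvgP[_] := fx x; apply: cvg_trans; apply: near_eq_cvg.
  near=> n; rewrite gE indicE mem_set ?mulr1//.
  have N0n : (N0 <= n)%N by near: n; exact: nbhs_infty_ge.
  by have /subsetPset := ndS _ _ N0n; exact.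
have gfin n (r : R) : (0 < r)%R -> mu (g n @^-1` [set r]) < +oo.
  move=> r0; apply: le_lt_trans (proj2 (mS n)); apply: le_measure.
  - by apply/mem_set; exact: measurable_funPTI.
  - by apply/mem_set; exact: (mS n).1.
  - move=> x gxr; have := gE n x; rewrite (gxr : g n x = r) indicE.
    case: (boolP (x \in S n)) => [/set_mem//|_].
    by rewrite mulr0 => r0'; move: r0; rewrite r0' ltxx.
(* Serves both sides: with [id] under [N om] and with $1-e^{-t}$ under [mu]. *)
have mcv (M : {measure set E -> \bar R}) (phi : R -> R) :
    continuous phi -> (forall t, (0 <= t)%R -> (0 <= phi t)%R) ->
    {homo phi : s t / (s <= t)%R} -> measurable_fun setT phi ->
    \int[M]_x (phi (g n x))%:E @[n --> \oo] --> \int[M]_x (phi (F x))%:E.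
  move=> cphi phi0 ndphi mphi.
  rewrite [X in _ --> X](_ : _ = \int[M]_x limn (fun n => (phi (g n x))%:E)).
    apply: cvg_monotone_convergence => //.
    - by move=> n; apply/measurable_EFinP; exact: measurableT_comp.
    - by move=> n x _; rewrite lee_fin phi0.
    - by move=> x _ m n mn; rewrite lee_fin ndphi// ndg.
  apply: eq_integral => x _; apply/esym/cvg_lim => //.
  apply/fine_cvgP; split; first exact: nearW.
  by apply: (cvg_comp _ _ (gx x)); exact: cphi.
have cR : expeR (- \int[mu]_x (1 - expR (- g n x))%:E) @[n --> \oo] -->
    expeR (- \int[mu]_x (1 - expR (- F x))%:E).
  apply: cvg_expeRN.
    by apply: integral_ge0 => x _; rewrite lee_fin subr_ge0 expR_le1 oppr_le0.
  apply: (mcv mu (fun t => 1 - expR (- t))%R).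
  - move=> t; apply: cvgB; first exact: cvg_cst.
    by apply: continuous_comp; [exact: opp_continuous|exact: continuous_expR].
  - by move=> t t0; rewrite subr_ge0 expR_le1 oppr_le0.
  - by move=> s t st; rewrite lerD2l lerN2 ler_expR lerN2.
  - by apply: measurable_funB => //; apply: measurableT_comp.
have cL : \int[Pr]_om expeR (- \int[N om]_x (g n x)%:E) @[n --> \oo] -->
    \int[Pr]_om expeR (- \int[N om]_x (F x)%:E).
  have mexp (G : E -> R) : (forall x, (0 <= G x)%R) -> measurable_fun setT G ->
      measurable_fun setT (fun om => expeR (- \int[N om]_x (G x)%:E)).
    move=> G0 mG; apply: (measurableT_comp measurable_expeR).
    apply: measurableT_comp => //; apply: measurable_prm_integral.
      by move=> x; rewrite lee_fin.
    exact/measurable_EFinP.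
  have := @dominated_convergence _ _ _ Pr setT measurableT
    (fun n om => expeR (- \int[N om]_x (g n x)%:E))
    (fun om => expeR (- \int[N om]_x (F x)%:E)) (cst 1).
  case.
  - by move=> n; exact: mexp.
  - exact: mexp.
  - apply: aeW => om _; apply: cvg_expeRN.
      by apply: integral_ge0 => x _; rewrite lee_fin.
    by apply: (mcv (N om) id) => // t; exact: cvg_id.
  - exact: finite_measure_integrable_cst.
  - apply: aeW => om n _; rewrite gee0_abs ?expeR_ge0//.
    by apply: expeRN_le1; apply: integral_ge0 => x _; rewrite lee_fin.
  - by move=> _ _.
apply: (cvg_unique _ cL) => //.
have -> : (fun n => \int[Pr]_om expeR (- \int[N om]_x (g n x)%:E)) =
    (fun n => expeR (- \int[mu]_x (1 - expR (- g n x))%:E)).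
  by apply/funext => n; exact: (campbell_nnsfun (gfin n)).
exact: cR.
Unshelve. all: by end_near. Qed.

End campbell.

(** * Evaluation of càdlàg paths *)

(** Countable gluing. Only the trace of each preimage on its own cell has to be measurable; in
    [measurable_past_grid] this trace is what the past rectangles describe. *)
Lemma measurable_fun_selector d d' (T : measurableType d) (T' : measurableType d')
    (k : T -> nat) (X : nat -> T -> T') :
  (forall n B, measurable B -> measurable ((k @^-1` [set n]) `&` X n @^-1` B)) ->
  measurable_fun setT (fun x => X (k x) x).
Proof.
move=> mkX _ B mB; rewrite setTI.
rewrite [X in measurable X](_ : _ = \bigcup_n ((k @^-1` [set n]) `&` X n @^-1` B)).
  by apply: bigcupT_measurable => n; exact: mkX.
apply/seteqP; split => [x Bx|x [n _ [/= <-]]]//.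
by exists (k x).
Qed.

(** Unlike in the sequential criterion for left limits, the sequence may take the value [u]
    itself. *)
Lemma cvg_left_continuous (R : realType) (f : R -> R) (u_ : R^nat) (u : R) :
  f x @[x --> u^'-] --> f u -> (forall n, u_ n <= u) -> u_ @ \oo --> u ->
  f (u_ n) @[n --> \oo] --> f u.
Proof.
move=> /cvgrPdist_lt fu uu cu; apply/cvgrPdist_lt => e e0.
have : \forall x \near u, x <= u -> `|f u - f x| < e.
  have : \forall x \near u, x < u -> `|f u - f x| < e by exact: (fu e e0).
  apply: filterS => x xu; rewrite le_eqVlt => /predU1P[->|//].
  by rewrite subrr normr0.
move=> H; have : \forall n \near \oo, u_ n <= u -> `|f u - f (u_ n)| < e by exact: (cu _ H).
by apply: filterS => n Hn; exact: Hn (uu n).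
Qed.

Section grid.
Context {R : realType}.
Implicit Types x s t : R.

(** Meant for positive [x], where the absolute value changes nothing. *)
Definition nceil x : nat := `|Num.ceil x|%N.

Lemma nceil_itv x : 0 < x -> (nceil x)%:R - 1 < x <= (nceil x)%:R.
Proof.
move=> x0; have E : ((nceil x)%:R : R) = (Num.ceil x)%:~R.
  by rewrite /nceil natr_absz ger0_norm// ceil_ge0 (lt_trans _ x0).
by have := ceil_itv x; rewrite E intrB.
Qed.

(** For positive [s], the first multiple of $1/(n+1)$ not before [s], possibly [s] itself; it makes
    $t$ minus the grid point approach $t-s$ from the left. *)
Definition ugrid n s := (nceil (n.+1%:R * s))%:R / n.+1%:R : R.

Lemma ugrid_ge n s : 0 < s -> s <= ugrid n s.
Proof.
move=> s0; rewrite /ugrid ler_pdivlMr// mulrC.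
by have /andP[] := @nceil_itv (n.+1%:R * s) (mulr_gt0 (ltr0Sn _ n) s0).
Qed.

Lemma ugrid_lt n s : 0 < s -> ugrid n s < s + n.+1%:R^-1.
Proof.
move=> s0; rewrite /ugrid ltr_pdivrMr// mulrDl mulVf// (mulrC s) -ltrBlDr.
by have /andP[] := @nceil_itv (n.+1%:R * s) (mulr_gt0 (ltr0Sn _ n) s0).
Qed.

Lemma cvg_invS : (n.+1%:R^-1 : R) @[n --> \oo] --> (0 : R).
Proof. exact: cvg_harmonic. Qed.

Lemma cvg_ugrid s : 0 < s -> ugrid n s @[n --> \oo] --> s.
Proof.
move=> s0; apply: (@squeeze_cvgr _ _ _ _ (fun=> s) (fun n => s + n.+1%:R^-1)).
- by apply: nearW => n; rewrite ugrid_ge// ltW// ugrid_lt.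
- exact: cvg_cst.
- by rewrite -[X in _ --> X]addr0; apply: cvgD; [exact: cvg_cst|exact: cvg_invS].
Qed.

(** Strictly after [s], as the sequential form of right continuity at [s] demands. *)
Definition rgrid n s := (Num.truncn (n.+1%:R * s)).+1%:R / n.+1%:R : R.

Lemma rgrid_gt n s : s < rgrid n s.
Proof. by rewrite /rgrid ltr_pdivlMr// mulrC truncnS_gt. Qed.

Lemma rgrid_le n s : 0 <= s -> rgrid n s <= s + n.+1%:R^-1.
Proof.
move=> s0; rewrite /rgrid ler_pdivrMr// mulrDl mulVf// -natr1 lerD2r mulrC.
by rewrite truncn_le mulr_ge0.
Qed.

Lemma cvg_rgrid s : 0 <= s -> rgrid n s @[n --> \oo] --> s.
Proof.
move=> s0; apply: (@squeeze_cvgr _ _ _ _ (fun=> s) (fun n => s + n.+1%:R^-1)).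
- by apply: nearW => n; rewrite rgrid_le// andbT ltW// rgrid_gt.
- exact: cvg_cst.
- by rewrite -[X in _ --> X]addr0; apply: cvgD; [exact: cvg_cst|exact: cvg_invS].
Qed.

End grid.

Section cadlag_measurability.
Context {R : realType}.
Implicit Types (w : cadlag R) (t : R).

Lemma coordinate_sigmaS (I J : set R) : I `<=` J ->
  @coordinate_sigma R I `<=` coordinate_sigma J.
Proof.
move=> IJ; apply: sub_sigma_algebra2 => A [s [B [Is mB ->]]].
by exists s, B; split => //; exact: IJ.
Qed.

Lemma coordinate_sigma_measurable (I : set R) : I `<=` `[0, +oo[ ->
  @coordinate_sigma R I `<=` measurable.
Proof. by move=> I0 A /(coordinate_sigmaS I0). Qed.

Lemma measurable_coordinate t : measurable_fun setT (fun w => w t).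
Proof.
move=> _ B mB; rewrite setTI; have [t0|t0] := ltP t 0.
  have [B0|B0] := pselect (B 0).
    rewrite (_ : _ @^-1` _ = setT)//; apply/seteqP.
    by split => // w _ /=; rewrite path_lt0.
  rewrite (_ : _ @^-1` _ = set0)//; apply/seteqP.
  by split => // w /=; rewrite path_lt0.
apply: sub_sigma_algebra; exists t, B; split => //.
by rewrite /= in_itv/= t0.
Qed.

(** By right continuity, evaluation is the limit of evaluations at grid times, and each of these is
    a countable gluing of coordinate maps. *)
Lemma measurable_eval : measurable_fun setT (fun p : R * cadlag R => p.2 p.1).
Proof.
pose f n (p : R * cadlag R) := if p.1 < 0 then 0 else p.2 (rgrid n p.1).
apply: (@measurable_fun_cvg _ _ _ _ f).
- move=> n; apply: measurable_fun_ifT => //.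
    by apply: measurable_fun_ltr => //; exact: measurable_fst.
  apply: (@measurable_fun_selector _ _ _ _
    (fun p : R * cadlag R => Num.truncn (n.+1%:R * p.1))
    (fun k (p : R * cadlag R) => p.2 (k.+1%:R / n.+1%:R))) => k B mB.
  apply: measurableI.
    rewrite (_ : _ @^-1` _ =
        (fun p : R * cadlag R => n.+1%:R * p.1) @^-1` (Num.truncn @^-1` [set k]))//.
    rewrite -[X in measurable X]setTI.
    have mk : measurable (Num.truncn @^-1` [set k] : set R).
      case: k => [|k].
        rewrite (_ : _ @^-1` _ = `]-oo, 1[%classic)//; apply/seteqP.
        split => x /=; rewrite in_itv/= ltNge -(truncn_gt_nat x 0).
          by move=> ->.
        by rewrite -eqn0Ngt => /eqP.
      rewrite (_ : _ @^-1` _ = `[k.+1%:R, k.+2%:R[%classic)//; apply/seteqP.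
      split => x /=; rewrite in_itv/= ltNge -!truncn_gt_nat -leqNgt.
        by move=> ->; rewrite !leqnn.
      by move=> xk; apply/eqP; rewrite eqn_leq andbC.
    by apply: (measurable_funM (measurable_cst _) measurable_fst).
  rewrite -[X in measurable X]setTI.
  by apply: (measurableT_comp (measurable_coordinate _) measurable_snd).
- move=> [q w] _ /=; rewrite /f/=; case: ltP => q0.
    by rewrite path_lt0//; exact: cvg_cst.
  have /cvg_at_rightP := @path_right R w q q0; apply; split.
    by move=> n; exact: rgrid_gt.
  exact: cvg_rgrid.
Qed.

End cadlag_measurability.

(** * Cumulants and the Markov property of the CB-process *)

Section cumulant.
Context {R : realType}.
Variables (phi : R -> R) (v : R -> R -> R) (Q : R -> R.-pker R ~> R).
Hypothesis hv : is_cumulant_flow phi v.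
Hypothesis hQ : is_CB_semigroup v Q.

Lemma cumulant_ge0 t lambda : 0 <= t -> 0 <= lambda -> 0 <= v t lambda.
Proof. by move=> t0 l0; have [] := hv l0 t0. Qed.

Lemma cumulant0 lambda : 0 <= lambda -> v 0 lambda = lambda.
Proof.
move=> l0; have [_ _ ->] := hv l0 (lexx 0).
by rewrite set_itv1 Rintegral_set1 subr0.
Qed.

(** The integral equation bounds $v_t(\lambda)$ by $\lambda+\int_0^T|\phi(v_s(\lambda))|\,ds$. *)
Lemma cumulant_bounded T lambda : 0 <= T -> 0 <= lambda ->
  exists2 C, 0 <= C & forall t, 0 <= t <= T -> v t lambda <= C.
Proof.
move=> T0 l0; have [_ intT _] := hv l0 T0.
pose I t := (\int[@lebesgue_measure R]_(s in `[0, t]) `|phi (v s lambda)|).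
have I0 t : 0 <= I t by apply: Rintegral_ge0.
exists (lambda + I T); first by rewrite addr_ge0.
move=> t /andP[t0 tT]; have [_ intt ->] := hv l0 t0.
rewrite lerD2l lerNl; apply: (@le_trans _ _ (- I t)).
  rewrite lerN2.
  have intTn : (@lebesgue_measure R).-integrable `[0, T]
      (EFin \o (fun s => `|phi (v s lambda)|)) by exact: integrable_norm.
  have mn : measurable_fun `[0, T] (EFin \o (fun s => `|phi (v s lambda)|)).
    exact: measurable_int intTn.
  rewrite /I /Rintegral fine_le//.
  - apply: integrable_fin_num => //; exact: integrable_norm.
  - exact: integrable_fin_num.
  - apply: ge0_subset_integral => //.
    by apply: subset_itvl; rewrite bnd_simp.
rewrite lerNl; apply: le_trans (le_normr_Rintegral _ intt); last exact: measurable_itv.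
by rewrite -normrN ler_norm.
Qed.

(** The integral of an integrable function over a shrinking interval tends to 0. *)
Lemma cvg_cumulant lambda : 0 <= lambda ->
  v n.+1%:R^-1 lambda @[n --> \oo] --> lambda.
Proof.
move=> l0; have [_ int1 _] := hv l0 ler01.
have := parameterized_integral_cvg_left (@ltr01 R) int1.
move=> h.
have -> : (fun n => v n.+1%:R^-1 lambda) = (fun n => lambda -
    parameterized_integral lebesgue_measure 0 n.+1%:R^-1
      (fun s => phi (v s lambda))).
  apply/funext => n; have t0 : 0 <= n.+1%:R^-1 :> R by [].
  by have [_ _ ->] := hv l0 t0.
rewrite -[X in _ --> X]subr0; apply: cvgB; first exact: cvg_cst.
exact: (cvg_comp _ _ cvg_invS h).
Qed.

Lemma laplaceE (mu : {measure set R -> \bar R}) lambda :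
  laplace mu lambda =
  (\int[mu]_y ((fun y => (expR (- (lambda * y)))%:E) \_ `[0%R, +oo[) y)%E.
Proof. by rewrite /laplace integral_mkcond. Qed.

Lemma measurable_laplace_integrand lambda : measurable_fun setT
  ((fun y : R => (expR (- (lambda * y)))%:E) \_ `[0%R, +oo[).
Proof.
apply/(measurable_restrictT _ _).1 => //.
apply/measurable_EFinP; apply: measurable_funTS.
apply: measurableT_comp => //; apply: measurableT_comp => //.
Qed.

Lemma laplace_integrand_ge0 lambda y :
  (0 <= ((fun y : R => (expR (- (lambda * y)))%:E) \_ `[0%R, +oo[) y)%E.
Proof. by rewrite patchE; case: ifPn => // _; rewrite lee_fin expR_ge0. Qed.

Lemma CB_laplace t x lambda : 0 <= t -> 0 <= x -> 0 <= lambda ->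
  laplace (Q t x) lambda = (expR (- (x * v t lambda)))%:E.
Proof. by case: hQ => _; exact. Qed.

(** Read off from the semigroup rather than from the integral equation: Chapman-Kolmogorov from the
    starting point 1, then injectivity of the exponential. *)
Lemma cumulant_flow s t lambda : 0 <= s -> 0 <= t -> 0 <= lambda ->
  v (s + t) lambda = v s (v t lambda).
Proof.
move=> s0 t0 l0; have [[_ _ CK] _] := hQ.
pose mix := @mixture _ _ _ _ _ (Q s 1) `[0%R, +oo[%classic (Q t)
  (measurable_itv _) (measurable_kernel (Q t)).
have E : laplace (Q (s + t) 1) lambda = laplace (Q s 1) (v t lambda).
  transitivity (laplace mix lambda).
    apply: eq_measure_integral => A mA _.
    have := CK 0 s (s + t) 1 A (lexx 0) s0 _ ler01 mA.
    by rewrite !subr0 addrAC subrr add0r; apply; rewrite lerDl.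
  rewrite laplaceE integral_mixture//.
  - apply: eq_integral => y /set_mem/=; rewrite in_itv/= andbT => y0.
    by rewrite -laplaceE CB_laplace// mulrC.
  - exact: laplace_integrand_ge0.
  - exact: measurable_laplace_integrand.
move: E; rewrite !CB_laplace ?addr_ge0// ?cumulant_ge0// => -[] /expR_inj.
by rewrite !mul1r => /oppr_inj.
Qed.

End cumulant.

(** * Densities and weighted integrals *)

Section density.
Local Open Scope ereal_scope.
Context d (T : measurableType d) (R : realType).
Variables (M : {measure set T -> \bar R}) (f : T -> R).
Hypothesis f0 : forall x, (0 <= f x)%R.
Hypothesis mf : measurable_fun setT f.

Let wdirac x : {measure set T -> \bar R} := mscale (NngNum (f0 x)) (\d_x)%R.

Let mwdirac U : measurable U -> measurable_fun setT (wdirac ^~ U).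
Proof.
move=> mU; rewrite (_ : wdirac ^~ U = fun x => (f x)%:E * (\1_U x)%:E)//.
by apply: emeasurable_funM; apply/measurable_EFinP => //; exact: measurable_indic.
Qed.

(** A mixture of weighted Dirac masses, so that [integral_mixture] computes its integrals. *)
Definition density : {measure set T -> \bar R} :=
  mixture M (k := wdirac) measurableT mwdirac.

Lemma integral_density (h : T -> \bar R) :
  (forall x, 0 <= h x) -> measurable_fun setT h ->
  \int[density]_x h x = \int[M]_x ((f x)%:E * h x).
Proof.
move=> h0 mh; rewrite integral_mixture//.
apply: eq_integral => x _; rewrite ge0_integral_mscale//.
by rewrite integral_dirac// diracT mul1e.
Qed.

Lemma densityE A : measurable A -> density A = \int[M]_(x in A) (f x)%:E.
Proof.
move=> mA; rewrite -[in LHS](setIT A) -(integral_indic density measurableT mA).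
rewrite integral_density//; last by exact/measurable_EFinP/measurable_indic.
rewrite [RHS]integral_mkcond; apply: eq_integral => x _.
by rewrite patchE indicE; case: ifPn => _; rewrite ?mule1 ?mule0.
Qed.

End density.

(** The hypothesis says that the measures of densities [f1] and [f2] have the same image under [xi],
    and both sides integrate the identity against this image. *)
Lemma eq_weighted_integral d (T : measurableType d) (R : realType)
    (M : {measure set T -> \bar R}) (f1 f2 : T -> R) (xi : T -> \bar R) :
  (forall x, 0 <= f1 x) -> (forall x, 0 <= f2 x) ->
  measurable_fun setT f1 -> measurable_fun setT f2 ->
  (forall x, 0 <= xi x)%E -> measurable_fun setT xi ->
  (forall B, measurable B -> \int[M]_(x in xi @^-1` B) (f1 x)%:E =
                             \int[M]_(x in xi @^-1` B) (f2 x)%:E)%E ->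
  (\int[M]_x ((f1 x)%:E * xi x) = \int[M]_x ((f2 x)%:E * xi x))%E.
Proof.
move=> f10 f20 mf1 mf2 xi0 mxi H.
rewrite -(integral_density M f10 mf1 xi0 mxi) -(integral_density M f20 mf2 xi0 mxi).
have mpre B : measurable B -> measurable (xi @^-1` B).
  by move=> mB; rewrite -[X in measurable X]setTI; exact: mxi.
(* The maximum with 0 makes the integrand nonnegative on all the extended reals, for the change of
   variables. *)
have push (mu : {measure set T -> \bar R}) :
    (\int[mu]_x xi x = \int[pushforward mu xi]_y (maxe y 0))%E.
  rewrite [RHS](ge0_integral_pushforward mxi)//.
  - by rewrite preimage_setT; apply: eq_integral => x _ /=; rewrite max_l.
  - exact: measurable_maxe.
  - by move=> y _; rewrite le_max lexx orbT.
rewrite !push; apply: eq_measure_integral => B mB _.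
by rewrite /pushforward/= [LHS]densityE ?[RHS]densityE ?H//; exact: mpre.
Qed.

Section adapted.
Context {R : realType}.

(** The sub-sigma-algebra is carried by the type of the source, so that the usual closure lemmas for
    measurable functions apply. *)
Definition adapted (I : set R) {d} {T : measurableType d} (xi : cadlag R -> T) :=
  measurable_fun setT (xi : g_sigma_algebraType (@coordinate_events R I) -> T).

Lemma adaptedP (I : set R) d (T : measurableType d) (xi : cadlag R -> T) :
  adapted I xi <-> forall B, measurable B -> coordinate_sigma I (xi @^-1` B).
Proof.
split=> [h B mB|h _ B mB]; last by rewrite setTI; exact: h.
by rewrite -[X in coordinate_sigma _ X]setTI; exact: h.
Qed.

Lemma adaptedS (I J : set R) d (T : measurableType d) (xi : cadlag R -> T) :
  I `<=` J -> adapted I xi -> adapted J xi.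
Proof.
by move=> IJ /adaptedP h; apply/adaptedP => B /h; exact: coordinate_sigmaS.
Qed.

Lemma adapted_measurable (I : set R) d (T : measurableType d) (xi : cadlag R -> T) :
  I `<=` `[0, +oo[ -> adapted I xi -> measurable_fun setT xi.
Proof.
move=> I0 /adaptedP h _ B mB; rewrite setTI.
by apply: (coordinate_sigma_measurable I0); exact: h.
Qed.

Lemma adapted_coordinate (I : set R) t : I t ->
  adapted I (fun w : cadlag R => w t).
Proof.
by move=> It; apply/adaptedP => B mB; apply: sub_sigma_algebra; exists t, B.
Qed.

(** The Markov property at time [q], tested on exponentials. The form $1-e^{-\lambda w}$ vanishes on
    dead paths and stays integrable when [M] is an infinite excursion law. *)
Definition markov_laplace (v : R -> R -> R) (M : {measure set (cadlag R) -> \bar R})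
    (q : R) := forall p lambda A, q <= p -> 0 <= lambda -> coordinate_sigma `[0, q] A ->
  (\int[M]_(w in A) (1 - expR (- (lambda * w p)))%:E =
   \int[M]_(w in A) (1 - expR (- (v (p - q) lambda * w q)))%:E)%E.

Lemma onem_expRN_ge0 (x : R) : 0 <= x -> 0 <= 1 - expR (- x).
Proof. by move=> x0; rewrite subr_ge0 expR_le1 oppr_le0. Qed.

Lemma measurable_expRNZ d (T : measurableType d) (a : R) (f : T -> R) :
  measurable_fun setT f -> measurable_fun setT (fun x => expR (- (a * f x))).
Proof.
move=> mf; apply: measurableT_comp => //; apply: measurableT_comp => //.
exact: measurable_funM.
Qed.

Lemma measurable_onem_expRNZ d (T : measurableType d) (a : R) (f : T -> R) :
  measurable_fun setT f -> measurable_fun setT (fun x => 1 - expR (- (a * f x))).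
Proof. by move=> mf; apply: measurable_funB => //; exact: measurable_expRNZ. Qed.

Lemma subset_itv0 (q : R) : `[0, q] `<=` `[0, +oo[.
Proof. by apply: subset_itvl; rewrite bnd_simp. Qed.

Lemma markov_laplace_weight (v : R -> R -> R) (M : {measure set (cadlag R) -> \bar R})
    (p q lambda : R) (xi : cadlag R -> \bar R) :
  markov_laplace v M q -> q <= p -> 0 <= lambda -> 0 <= v (p - q) lambda ->
  (forall w, 0 <= xi w)%E -> adapted `[0, q] xi ->
  (\int[M]_w ((1 - expR (- (lambda * w p)))%:E * xi w) =
   \int[M]_w ((1 - expR (- (v (p - q) lambda * w q)))%:E * xi w))%E.
Proof.
move=> hM qp l0 vl0 xi0 axi.
apply: eq_weighted_integral.
- by move=> w; rewrite onem_expRN_ge0// mulr_ge0// path_ge0.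
- by move=> w; rewrite onem_expRN_ge0// mulr_ge0// path_ge0.
- exact: measurable_onem_expRNZ (measurable_coordinate p).
- exact: measurable_onem_expRNZ (measurable_coordinate q).
- exact: xi0.
- by apply: adapted_measurable axi; exact: subset_itv0.
- by move=> B mB; apply: hM => //; move/adaptedP : axi; exact.
Qed.

End adapted.

Lemma measureTC d (T : measurableType d) (R : realType)
    (M : {measure set T -> \bar R}) A : measurable A ->
  (M setT = M A + M (~` A))%E.
Proof.
move=> mA; rewrite -measureU ?setUv//; first exact: measurableC.
by rewrite setICr.
Qed.

(** * Laplace form of the Markov property of the CB-process *)

Section CB_markov.
Context {R : realType}.
Variables (phi : R -> R) (v : R -> R -> R) (Q : R -> R.-pker R ~> R).
Variable (QQ : R.-pker R ~> cadlag R).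
Hypothesis hv : is_cumulant_flow phi v.
Hypothesis hQ : is_CB_semigroup v Q.
Hypothesis hQQ : is_CB_law Q QQ.

Lemma CB_integral_onem t x lambda : 0 <= t -> 0 <= x -> 0 <= lambda ->
  (\int[Q t x]_(y in `[0%R, +oo[) (1 - expR (- (lambda * y)))%:E =
   (1 - expR (- (v t lambda * x)))%:E)%E.
Proof.
move=> t0 x0 l0.
have Q0 : Q t x `]-oo, 0[%classic = 0%E.
  by have [[+ _ _] _] := hQ => /(_ 0 t x (lexx 0) t0 x0); rewrite subr0.
have Q1 : Q t x `[0, +oo[%classic = 1%E.
  have := measureTC (Q t x) (measurable_itv `]-oo, 0[).
  by rewrite setCitvl Q0 add0e prob_kernel => <-.
have mE : measurable_fun (`[0%R, +oo[%classic : set R) (fun y : R => (expR (- (lambda * y)))%:E).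
  by apply/measurable_EFinP; apply: measurable_funTS; exact: measurable_expRNZ.
have H : (\int[Q t x]_(y in `[0%R, +oo[) (1 - expR (- (lambda * y)))%:E +
    laplace (Q t x) lambda = 1)%E.
  rewrite /laplace -ge0_integralD//.
  - under eq_integral do rewrite -EFinD subrK.
    by rewrite integral_cst// mul1e Q1.
  - move=> y /=; rewrite in_itv/= andbT => y0.
    by rewrite lee_fin onem_expRN_ge0// mulr_ge0.
  - by apply/measurable_EFinP; apply: measurable_funTS; exact: measurable_onem_expRNZ.
move: H; rewrite (CB_laplace hQ)// => H.
have := congr1 (fun z => z - (expR (- (x * v t lambda)))%:E)%E H.
by rewrite addeK// mulrC => ->.
Qed.

Lemma CB_law_markov x q : 0 <= x -> 0 <= q -> markov_laplace v (QQ x) q.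
Proof.
move=> x0 q0 p lambda A qp l0 FA.
have p0 := le_trans q0 qp.
have [_ [_ _ _]] := hQQ x0.
(* Test functions must be bounded on all of [R]; the absolute value achieves this and changes
   nothing on nonnegative values. *)
move=> /(_ q p (fun y => 1 - expR (- (lambda * `|y|)))).
case.
- by rewrite /= in_itv/= q0.
- by rewrite /= in_itv/= p0.
- by [].
- by apply: measurable_onem_expRNZ; exact: normr_measurable.
- exists 1 => y; have h : 0 <= lambda * `|y| by rewrite mulr_ge0.
  by rewrite ger0_norm ?onem_expRN_ge0// gerBl expR_ge0.
move=> _ _ /(_ A FA) => H.
transitivity (\int[QQ x]_(w in A) (1 - expR (- (lambda * `|w p|)))%:E)%E.
  by apply: eq_integral => w _; rewrite ger0_norm// path_ge0.
rewrite -H; apply: eq_integral => w _; congr (_%:E).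
rewrite /Rintegral; transitivity (fine (\int[Q (p - q) (w q)]_(y in `[0%R, +oo[)
    (1 - expR (- (lambda * y)))%:E)%E).
  congr fine; apply: eq_integral => y /set_mem/=; rewrite in_itv/= andbT => y0.
  by rewrite ger0_norm.
by rewrite CB_integral_onem ?subr_ge0// path_ge0.
Qed.

(** The Markov property at time 0 with the full event, since [w 0 = x] almost surely. *)
Lemma CB_law_onem x t lambda : 0 <= x -> 0 <= t -> 0 <= lambda ->
  (\int[QQ x]_w (1 - expR (- (lambda * w t)))%:E =
   (1 - expR (- (v t lambda * x)))%:E)%E.
Proof.
move=> x0 t0 l0; have := CB_law_markov x0 (lexx 0) t0 l0.
move=> /(_ setT); rewrite subr0 => ->; last first.
  exact: (@measurableT _ (g_sigma_algebraType _)).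
have [QQ0 _] := hQQ x0.
have mX0 : measurable [set w : cadlag R | w 0 = x].
  rewrite (_ : [set _ | _] = setT `&` (fun w : cadlag R => w 0) @^-1` [set x]).
    exact: measurable_coordinate.
  by rewrite setTI.
rewrite (ge0_negligible_integral (measurableC mX0))//; last 3 first.
- by apply/measurable_EFinP; exact: measurable_onem_expRNZ (measurable_coordinate 0).
- by move=> w _; rewrite lee_fin onem_expRN_ge0// mulr_ge0 ?(cumulant_ge0 hv)// path_ge0.
- have := measureTC (QQ x) mX0; rewrite QQ0 prob_kernel addeC.
  by move=> /(congr1 (fun z => z - 1)%E); rewrite addeK// subee.
rewrite setTD setCK.
rewrite (eq_integral (cst (1 - expR (- (v t lambda * x)))%:E)); last first.
  by move=> w /set_mem/= ->.
by rewrite integral_cst// QQ0 mule1.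
Qed.

End CB_markov.

(** * The excursion law *)

Section transitions_functional.
Context {R : realType}.
Local Open Scope ereal_scope.
Variable Q : R -> R.-pker R ~> R.
Variables (t : nat -> R) (B : nat -> set R).
Hypothesis mB : forall i, measurable (B i).

(* [transitions] with a terminal function [H] instead of the constant 1. *)
Fixpoint trans_int (H : R -> \bar R) (i k : nat) (x : R) : \bar R :=
  if k is k'.+1 then
    \int[Q (t i.+1 - t i)%R x]_(y in B i.+1) trans_int H i.+1 k' y
  else H x.

Lemma trans_int_ge0 H i k x : (forall y, 0 <= H y) -> 0 <= trans_int H i k x.
Proof.
move=> H0; elim: k i x => [|k IH] i x //=.
by apply: integral_ge0 => y _; exact: IH.
Qed.

Lemma measurable_integral_kernel_in (k : R.-pker R ~> R) (D : set R) (f : R -> \bar R) :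
  measurable D -> (forall x, 0 <= f x) -> measurable_fun setT f ->
  measurable_fun setT (fun x => \int[k x]_(y in D) f y).
Proof.
move=> mD f0 mf; under eq_fun do rewrite integral_mkcond.
apply: measurable_fun_integral_kernel.
- exact: measurable_kernel.
- by move=> y; rewrite patchE; case: ifPn.
- by apply/(measurable_restrictT _ _).1 => //; exact: measurable_funTS.
Qed.

Lemma measurable_trans_int H i k : (forall y, 0 <= H y) ->
  measurable_fun setT H -> measurable_fun setT (trans_int H i k).
Proof.
move=> H0 mH; elim: k i => [|k IH] i //=.
apply: measurable_integral_kernel_in => // y; exact: trans_int_ge0.
Qed.

Lemma trans_intZ H c i k x : (0 <= c)%R -> (forall y, 0 <= H y) ->
  measurable_fun setT H ->
  trans_int (fun y => c%:E * H y) i k x = c%:E * trans_int H i k x.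
Proof.
move=> c0 H0 mH; elim: k i x => [|k IH] i x //=.
under eq_integral do rewrite IH.
rewrite ge0_integralZl//.
- by apply: measurable_funTS; exact: measurable_trans_int.
- by move=> y _; exact: trans_int_ge0.
Qed.

Lemma trans_intD H1 H2 i k x : (forall y, 0 <= H1 y) -> (forall y, 0 <= H2 y) ->
  measurable_fun setT H1 -> measurable_fun setT H2 ->
  trans_int (fun y => H1 y + H2 y) i k x = trans_int H1 i k x + trans_int H2 i k x.
Proof.
move=> H10 H20 mH1 mH2; elim: k i x => [|k IH] i x //=.
under eq_integral do rewrite IH.
rewrite ge0_integralD//.
- by move=> y _; exact: trans_int_ge0.
- by apply: measurable_funTS; exact: measurable_trans_int.
- by move=> y _; exact: trans_int_ge0.
- by apply: measurable_funTS; exact: measurable_trans_int.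
Qed.

Lemma le_trans_int H1 H2 i k x : (forall y, 0 <= H1 y) -> (forall y, H1 y <= H2 y) ->
  measurable_fun setT H1 -> measurable_fun setT H2 ->
  trans_int H1 i k x <= trans_int H2 i k x.
Proof.
move=> H10 H12 mH1 mH2; elim: k i x => [|k IH] i x //=.
have H20 y : 0 <= H2 y by exact: le_trans (H12 y).
apply: ge0_le_integral => //.
- by move=> y _; exact: trans_int_ge0.
- by apply: measurable_funTS; exact: measurable_trans_int.
- by apply: measurable_funTS; exact: measurable_trans_int.
Qed.

Lemma trans_int_lim (f : (R -> \bar R)^nat) i k x :
  (forall n, measurable_fun setT (f n)) -> (forall n y, 0 <= f n y) ->
  (forall y, nondecreasing_seq (f ^~ y)) ->
  trans_int (fun y => limn (f ^~ y)) i k x = limn (fun n => trans_int (f n) i k x).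
Proof.
move=> mf f0 ndf; elim: k i x => [|k IH] i x //=.
under eq_integral do rewrite IH.
rewrite monotone_convergence//.
- by move=> n; apply: measurable_funTS; exact: measurable_trans_int.
- by move=> n y _; exact: trans_int_ge0.
- by move=> y _ m n mn; apply: le_trans_int => // z; exact: ndf.
Qed.

Lemma eq_trans_int (m : {measure set R -> \bar R}) H1 H2 n i k : (i + k = n)%N ->
  (forall y, B n y -> H1 y = H2 y) ->
  \int[m]_(y in B i) trans_int H1 i k y = \int[m]_(y in B i) trans_int H2 i k y.
Proof.
move=> ikn H12; elim: k i m ikn => [|k IH] i m.
  by rewrite addn0 => ->; apply: eq_integral => y /set_mem; exact: H12.
by rewrite addnS -addSn => ikn; apply: eq_integral => y _ /=; exact: IH.
Qed.

(** The recursion unfolds from the first time, while the Markov property concerns the last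
    transition; this absorbs the last kernel into the terminal function. *)
Lemma trans_int_rcons H n i k x : (i + k = n)%N ->
  trans_int H i k.+1 x =
  trans_int (fun y => \int[Q (t n.+1 - t n)%R y]_(z in B n.+1) H z) i k x.
Proof.
elim: k i x => [|k IH] i x; first by rewrite addn0 => ->.
rewrite addnS -addSn => ikn.
by rewrite [LHS]/= [RHS]/=; apply: eq_integral => y _; rewrite -IH.
Qed.

(** A terminal indicator amounts to shrinking the last set, so the finite-dimensional laws, stated
    for product sets, cover terminal indicators. *)
Lemma transitions_indic (m : {measure set R -> \bar R}) (C : set R) n i k :
  measurable C -> (i + k = n)%N ->
  let B' j := if j == n then B n `&` C else B j in
  \int[m]_(y in B' i) transitions Q t B' i k y =
  \int[m]_(y in B i) trans_int (EFin \o \1_C) i k y.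
Proof.
move=> mC ikn B'; elim: k i m ikn => [|k IH] i m.
  rewrite addn0 => ->; rewrite /B' eqxx /= integral_indic// integral_cst//.
    by rewrite mul1e setIC.
  exact: measurableI.
rewrite addnS -addSn => ikn.
have B'i : B' i = B i by rewrite /B' ltn_eqF// -ikn ltn_addr.
by rewrite B'i; apply: eq_integral => y _ /=; exact: IH.
Qed.

End transitions_functional.

Section excursion_fdd.
Context {R : realType}.
Local Open Scope ereal_scope.
Variable Q : R -> R.-pker R ~> R.
Variable l : R -> {sigma_finite_measure set R -> \bar R}.
Variable N0 : {measure set (cadlag R) -> \bar R}.
Hypothesis hN0 : is_excursion_law Q l N0.

Definition cylinder (t : nat -> R) (B : nat -> set R) n : set (cadlag R) :=
  [set w | forall i, (i <= n)%N -> B i (w (t i))].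

Lemma measurable_cylinder t (B : nat -> set R) n : (forall i, measurable (B i)) ->
  measurable (cylinder t B n).
Proof.
move=> mB; rewrite (_ : cylinder t B n = \bigcap_(i in [set i | (i <= n)%N])
    ((fun w : cadlag R => w (t i)) @^-1` (B i))).
  apply: bigcap_measurable; first by exists 0%N.
  move=> i _; rewrite -[X in measurable X]setTI.
  by apply: measurable_coordinate.
by apply/seteqP; split => w h i /= => [|?]; apply: h.
Qed.

(** Induction on [H] from indicators, given by the finite-dimensional laws through
    [transitions_indic]. *)
Lemma excursion_integral n t (B : nat -> set R) (H : R -> \bar R) :
  (0 < t 0%N)%R -> (forall i, (i < n)%N -> (t i < t i.+1)%R) ->
  (forall i, measurable (B i)) -> (forall i, B i `<=` `]0%R, +oo[) ->
  (forall y, 0 <= H y) -> measurable_fun setT H ->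
  \int[N0]_(w in cylinder t B n) H (w (t n)) =
  \int[l (t 0%N)]_(x in B 0%N) trans_int Q t B H 0 n x.
Proof.
move=> t0 tn mB B0; have [_ fdd] := hN0.
have mcyl : measurable (cylinder t B n) by exact: measurable_cylinder.
have mHt (f : R -> \bar R) : measurable_fun setT f ->
    measurable_fun (cylinder t B n) (fun w : cadlag R => f (w (t n))).
  by move=> mf; apply: measurable_funTS; exact: (measurableT_comp mf (measurable_coordinate _)).
have mti f : (forall y, 0 <= f y) -> measurable_fun setT f ->
    measurable_fun (B 0%N) (trans_int Q t B f 0 n).
  by move=> f0 mf; apply: measurable_funTS; exact: measurable_trans_int.
move: H; apply: ge0_measurable_ind.
- move=> C mC.
  rewrite -(transitions_indic Q t mB (l (t 0%N)) mC (add0n n)).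
  set B' := fun j => if j == n then B n `&` C else B j.
  have B'B j : B' j `<=` B j.
    by move=> y; rewrite /B'; case: eqP => [-> []|].
  rewrite -fdd//; last first.
    move=> i _; split; last exact: subset_trans (B'B i) (B0 i).
    by rewrite /B'; case: ifP => // _; exact: measurableI.
  have mC' : measurable ((fun w : cadlag R => w (t n)) @^-1` C).
    by rewrite -[X in measurable X]setTI; exact: measurable_coordinate.
  transitivity (\int[N0]_(w in cylinder t B n)
      (\1_((fun w : cadlag R => w (t n)) @^-1` C) w)%:E).
    by apply: eq_integral => w _ /=; rewrite !indicE.
  rewrite integral_indic//; congr (N0 _); apply/seteqP; split => w /=.
    move=> [Cw h] i ilen; rewrite /B'; case: eqP => [->|_]; last exact: h.
    by split => //; exact: h.
  move=> h; split; first by have := h n (leqnn n); rewrite /B' eqxx => -[].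
  by move=> i ilen; apply: B'B; exact: h.
- move=> c f c0 mf f0 IH; rewrite ge0_integralZl//; last exact: mHt.
  under [RHS]eq_integral do rewrite trans_intZ//.
  rewrite ge0_integralZl//; last 2 first.
  + exact: mti.
  + by move=> y _; exact: trans_int_ge0.
  by rewrite IH.
- move=> f g mf f0 mg g0 IHf IHg; rewrite ge0_integralD//; [|exact: mHt..].
  under [RHS]eq_integral do rewrite trans_intD//.
  rewrite ge0_integralD//; first by rewrite IHf IHg.
  + by move=> y _; exact: trans_int_ge0.
  + exact: mti.
  + by move=> y _; exact: trans_int_ge0.
  + exact: mti.
- move=> f mf f0 ndf IH; rewrite monotone_convergence//; last first.
    by move=> m; exact: mHt.
  under [RHS]eq_integral do rewrite trans_int_lim//.
  rewrite monotone_convergence//.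
  + by congr (limn _); apply/funext => m; exact: IH.
  + by move=> m; exact: mti.
  + by move=> m y _; exact: trans_int_ge0.
  + by move=> y _ m1 m2 m12; apply: le_trans_int => // z; exact: ndf.
Qed.

End excursion_fdd.

Section finite_coordinate_events.
Context {R : realType}.
Implicit Types (L : seq (R * set R)) (q : R).

(** The times in [L] may be unordered, repeated or zero, so that intersecting two such events is
    concatenating the lists; [cylinder] is the ordered form that the finite-dimensional laws
    require. *)
Definition coordinate_cylinder L : set (cadlag R) :=
  [set w | forall c, c \in L -> c.2 (w c.1)].

Definition timed_in (I : set R) L := forall c, c \in L -> I c.1 /\ measurable c.2.

Lemma coordinate_cylinder_setI (I : set R) : setI_closed
  [set A | exists2 L, timed_in I L & A = coordinate_cylinder L].
Proof.
move=> _ _ [L1 hL1 ->] [L2 hL2 ->]; exists (L1 ++ L2).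
  by move=> c; rewrite mem_cat => /orP[/hL1|/hL2].
apply/seteqP; split => [w [h1 h2] c|w h]; first by rewrite mem_cat => /orP[/h1|/h2].
by split => c cL; apply: h; rewrite mem_cat cL ?orbT.
Qed.

Lemma coordinate_sigma_cylinder (I : set R) A : coordinate_sigma I A ->
  <<s [set A | exists2 L, timed_in I L & A = coordinate_cylinder L] >> A.
Proof.
apply: sub_sigma_algebra2 => _ [s [B [Is mB ->]]]; exists [:: (s, B)].
  by move=> c; rewrite mem_seq1 => /eqP ->.
apply/seteqP; split => [w Bw c|w h].
  by rewrite mem_seq1 => /eqP ->.
by apply: (h (s, B)); rewrite mem_seq1.
Qed.

Lemma measurable_coordinate_cylinder (I : set R) L : timed_in I L ->
  measurable (coordinate_cylinder L).
Proof.
move=> hL; rewrite (_ : coordinate_cylinder L =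
    \bigcap_(c in [set` L]) ((fun w : cadlag R => w c.1) @^-1` c.2)).
  apply: fin_bigcap_measurable; first exact: finite_seq.
  move=> c /= /hL[_ mc]; rewrite -[X in measurable X]setTI.
  exact: measurable_coordinate.
by apply/seteqP; split => w h c /= => [|cL]; apply: h.
Qed.

(** Time 0 is dropped because the finite-dimensional laws of excursions start at a positive time;
    [q] is added so that survival up to [q] can be expressed. *)
Definition positive_times q L :=
  sort <=%R (undup (q :: [seq x <- map fst L | 0 < x])).

Lemma mem_positive_times q L x : x \in positive_times q L =
  (x == q) || (0 < x) && (x \in map fst L).
Proof. by rewrite mem_sort mem_undup in_cons mem_filter. Qed.

Lemma sorted_positive_times q L : sorted <%R (positive_times q L).
Proof.
rewrite lt_sorted_uniq_le sort_uniq undup_uniq/=.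
exact: (sort_sorted (@le_total _ R)).
Qed.

End finite_coordinate_events.

Section excursion_markov.
Context {R : realType}.
Variables (phi : R -> R) (v : R -> R -> R) (Q : R -> R.-pker R ~> R).
Variable l : R -> {sigma_finite_measure set R -> \bar R}.
Variable N0 : {measure set (cadlag R) -> \bar R}.
Hypothesis hv : is_cumulant_flow phi v.
Hypothesis hQ : is_CB_semigroup v Q.
Hypothesis hl : is_entrance_family v l.
Hypothesis hN0 : is_excursion_law Q l N0.

(** A zero at [s > 0] forces [tau0 w] to be at most [s]. *)
Lemma D1_absorbing (w : cadlag R) s u : D1 w -> 0 < s -> s <= u -> w s = 0 -> w u = 0.
Proof.
move=> [_ wD] s0 su ws; apply: wD; first exact: le_trans su (ltW s0) || lra.
apply: (@le_trans _ _ s%:E); last by rewrite lee_fin.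
by apply: ereal_inf_lbound; exists s.
Qed.

Lemma excursion_D1 : {ae N0, forall w, D1 w}.
Proof.
have [+ _] := hN0; apply: negligibleS => w /= nD [D _]; exact: nD.
Qed.

Let onem_abs_ge0 a (y : R) : 0 <= a -> (0 <= (1 - expR (- (a * `|y|)))%:E)%E.
Proof. by move=> a0; rewrite lee_fin onem_expRN_ge0// mulr_ge0. Qed.

Let measurable_onem_abs a :
  measurable_fun setT (fun y : R => (1 - expR (- (a * `|y|)))%:E).
Proof.
apply/measurable_EFinP; apply: measurable_onem_expRNZ.
exact: normr_measurable.
Qed.

Lemma excursion_onem t lambda : 0 < t -> 0 <= lambda ->
  (\int[N0]_w (1 - expR (- (lambda * w t)))%:E = (v t lambda)%:E)%E.
Proof.
move=> t0 l0; have [_ ->//] := hl t0.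
(* Paths with [w t = 0] contribute nothing, so the marginal on $(0,\infty)$ suffices. The absolute
   value makes the integrand a nonnegative function on [R]. *)
transitivity (\int[N0]_(w in cylinder (fun=> t) (fun=> `]0%R, +oo[%classic) 0)
    (1 - expR (- (lambda * `|w t|)))%:E)%E.
  rewrite [RHS]integral_mkcond; apply: eq_integral => w _.
  rewrite patchE (ger0_norm (path_ge0 w t)); case: ifPn => // /negP wt.
  suff -> : w t = 0 by rewrite mulr0 oppr0 expR0 subrr.
  apply/eqP/negPn/negP => wt0; apply: wt; apply/mem_set => i _ /=.
  by rewrite in_itv/= andbT lt_def wt0 path_ge0.
have lt00 i : (i < 0)%N -> t < t by [].
rewrite (excursion_integral hN0 t0 lt00 (fun=> measurable_itv _)
  (fun=> @subset_refl _ _) (fun y => onem_abs_ge0 y l0) (measurable_onem_abs lambda)).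
apply: eq_integral => x /set_mem/=; rewrite in_itv/= andbT => x0.
by rewrite gtr0_norm.
Qed.

(* The times of [L] are completed by [q].  Where [w q = 0] both integrands
   vanish, since excursions are absorbed at [0]; elsewhere [w] is positive at all
   the times, as required by the finite-dimensional laws. *)
Lemma excursion_cylinder_markov p q lambda L : 0 < q -> q < p -> 0 <= lambda ->
  timed_in `[0, q] L ->
  (\int[N0]_(w in coordinate_cylinder L) (1 - expR (- (lambda * w p)))%:E =
   \int[N0]_(w in coordinate_cylinder L) (1 - expR (- (v (p - q) lambda * w q)))%:E)%E.
Proof.
move=> q0 qp l0 hL.
have pq0 : 0 <= p - q by rewrite subr_ge0 ltW.
have vl0 : 0 <= v (p - q) lambda by exact: (cumulant_ge0 hv).
have mcL : measurable (coordinate_cylinder L) by exact: measurable_coordinate_cylinder hL.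
have mf a u : measurable_fun setT (fun w : cadlag R => (1 - expR (- (a * w u)))%:E).
  by apply/measurable_EFinP; exact: measurable_onem_expRNZ (measurable_coordinate u).
have f0 a u (w : cadlag R) : 0 <= a -> (0 <= (1 - expR (- (a * w u)))%:E)%E.
  by move=> a0; rewrite lee_fin onem_expRN_ge0// mulr_ge0// path_ge0.
have mrestr (D : set (cadlag R)) a u : measurable D ->
    measurable_fun setT ((fun w : cadlag R => (1 - expR (- (a * w u)))%:E) \_ D).
  by move=> mD; apply/(measurable_restrictT _ _).1 => //; exact: measurable_funTS.
have restr0 (D : set (cadlag R)) a u w : 0 <= a ->
    (0 <= ((fun w : cadlag R => (1 - expR (- (a * w u)))%:E) \_ D) w)%E.
  by move=> a0; rewrite patchE; case: ifPn => // _; exact: f0.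
(* Excursions satisfy [w 0 = 0]: a constraint at time 0 that excludes 0 makes both integrals vanish,
   and otherwise it can be ignored. *)
have [cons0|] := pselect (forall c, c \in L -> c.1 = 0 -> c.2 0); last first.
  move=> /existsNP[c /not_implyP[cL /not_implyP[c10 nc0]]].
  have H a u : 0 <= a ->
      (\int[N0]_(w in coordinate_cylinder L) (1 - expR (- (a * w u)))%:E = 0)%E.
    move=> a0; rewrite integral_mkcond -[RHS](integral0 N0 setT).
    apply: ge0_ae_eq_integral => //.
    - exact: mrestr.
    - by move=> w _; exact: restr0.
    apply: filterS excursion_D1 => w [w0 _] _; rewrite patchE ifF//.
    apply/negP => /set_mem/(_ c cL); rewrite c10 w0; exact: nc0.
  by rewrite !H.
pose T := positive_times q L.
have qT : q \in T by rewrite mem_positive_times eqxx.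
have Tq x : x \in T -> 0 < x <= q.
  rewrite mem_positive_times => /predU1P[->|/andP[x0 /mapP[c cL xc]]].
    by rewrite q0 lexx.
  by rewrite x0/=; have [+ _] := hL c cL; rewrite -xc /= in_itv/= => /andP[].
have sT : sorted <%R T := sorted_positive_times q L.
have T0 : (0 < size T)%N by case: (T) qT.
pose n := (size T).-1.
have nT : n.+1 = size T by rewrite prednK.
(* The time [p] is appended at index [n.+1], so that one sequence serves both the cylinder up to [q]
   and its extension to [p]. *)
pose t i := if (i <= n)%N then nth q T i else p.
have tT i : (i <= n)%N -> t i = nth q T i by rewrite /t => ->.
have tn1 : t n.+1 = p by rewrite /t ltnn.
have tmem i : (i <= n)%N -> t i \in T.
  by move=> ilen; rewrite tT// mem_nth// -nT ltnS.
have tlt i : (i < n)%N -> t i < t i.+1.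
  move=> iltn; rewrite !tT ?(ltnW iltn)//.
  by apply: (sorted_ltn_nth lt_trans) => //; rewrite inE -nT ltnS// ltnW.
have tn : t n = q.
  apply/eqP; rewrite eq_le; have /andP[_ ->] := Tq _ (tmem n (leqnn n)).
  rewrite tT// -{1}(nth_index q qT); have := qT; rewrite -index_mem -nT ltnS => iq.
  apply: (sorted_leq_nth (@le_trans _ R) (@lexx _ R)) => //.
  - by apply: sub_sorted sT => x y; exact: ltW.
  - by rewrite inE -nT ltnS.
  - by rewrite inE -nT ltnS.
have tlt' i : (i < n.+1)%N -> t i < t i.+1.
  by rewrite ltnS leq_eqVlt => /predU1P[->|/tlt//]; rewrite tn tn1.
have t00 : 0 < t 0%N by have /andP[] := Tq _ (tmem 0%N (leq0n n)).
(* Positive values meeting every constraint of [L] at the time [t i]; beyond index [n] only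
   positivity is imposed. *)
pose B i : set R := `]0, +oo[%classic `&`
  \bigcap_(c in [set` L]) (if (i <= n)%N && (c.1 == t i) then c.2 else setT).
have mB i : measurable (B i).
  apply: measurableI => //; apply: fin_bigcap_measurable; first exact: finite_seq.
  by move=> c /= /hL[_ mc]; case: ifP.
have B0 i : B i `<=` `]0%R, +oo[ by move=> y [].
pose cyl := cylinder t B n.
have mcyl : measurable cyl by exact: measurable_cylinder.
have cylE (w : cadlag R) : D1 w -> w q != 0 -> coordinate_cylinder L w <-> cyl w.
  move=> wD wq; split.
    move=> h i ilen; have /andP[ti0 tiq] := Tq _ (tmem i ilen).
    split.
      rewrite /= in_itv/= andbT lt_def path_ge0 andbT.
      by apply: contra wq => /eqP wti; rewrite (D1_absorbing wD ti0 tiq wti).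
    by move=> c /= cL; rewrite ilen/=; case: eqP => [<-|//]; exact: h.
  move=> h c cL; have [/= + _] := hL c cL; rewrite in_itv/= => /andP[c0 cq].
  move: c0; rewrite le_eqVlt => /predU1P[c0|c0].
    by rewrite -c0; have [-> _] := wD; exact: cons0.
  have cT : c.1 \in T by rewrite mem_positive_times c0 (map_f fst cL) orbT.
  have ilen : (index c.1 T <= n)%N by rewrite -ltnS nT index_mem.
  have tc : t (index c.1 T) = c.1 by rewrite tT// nth_index.
  have [_ /(_ c cL)] := h _ ilen.
  by rewrite /= ilen tc eqxx.
have toCyl a u : 0 <= a -> q <= u ->
    (\int[N0]_(w in coordinate_cylinder L) (1 - expR (- (a * w u)))%:E =
     \int[N0]_(w in cyl) (1 - expR (- (a * w u)))%:E)%E.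
  move=> a0 qu; rewrite [LHS]integral_mkcond [RHS]integral_mkcond.
  apply: ge0_ae_eq_integral => //.
  - exact: mrestr.
  - exact: mrestr.
  - by move=> w _; exact: restr0.
  - by move=> w _; exact: restr0.
  apply: filterS excursion_D1 => w wD _; rewrite !patchE.
  have [wq|wq] := eqVneq (w q) 0.
    rewrite (D1_absorbing wD q0 qu wq) mulr0 oppr0 expR0 subrr.
    by case: ifP => _; case: ifP.
  have E := cylE w wD wq; congr (if _ then _ else _).
  by apply/idP/idP => /set_mem/E/mem_set.
rewrite (toCyl lambda p l0 (ltW qp)) (toCyl _ q vl0 (lexx q)).
transitivity (\int[N0]_(w in cylinder t B n.+1) (1 - expR (- (lambda * `|w (t n.+1)|)))%:E)%E.
  rewrite [LHS]integral_mkcond [RHS]integral_mkcond; apply: eq_integral => w _.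
  rewrite !patchE tn1 (ger0_norm (path_ge0 w p)).
  have [wp|wp] := eqVneq (w p) 0.
    by rewrite wp mulr0 oppr0 expR0 subrr; case: ifP => _; case: ifP.
  congr (if _ then _ else _); apply/idP/idP => /set_mem h; apply/mem_set; last first.
    by move=> i ilen; apply: h; exact: leqW.
  move=> i; rewrite leq_eqVlt => /predU1P[->|]; last exact: h.
  rewrite tn1; split; first by rewrite /= in_itv/= andbT lt_def wp path_ge0.
  by move=> c _; rewrite ltnn.
rewrite (excursion_integral hN0 t00 tlt' mB B0 (fun y => onem_abs_ge0 y l0)
  (measurable_onem_abs lambda)).
transitivity (\int[N0]_(w in cyl) (1 - expR (- (v (p - q) lambda * `|w (t n)|)))%:E)%E; last first.
  by apply: eq_integral => w _; rewrite tn ger0_norm// path_ge0.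
rewrite (excursion_integral hN0 t00 tlt mB B0 (fun y => onem_abs_ge0 y vl0)
  (measurable_onem_abs (v (p - q) lambda))).
(* The transition from [q] to [p] becomes the terminal function of the shorter chain and is then
   evaluated by [CB_integral_onem]. *)
under eq_integral do rewrite (@trans_int_rcons _ Q t B _ n 0 n _ (add0n n)).
apply: (@eq_trans_int _ Q t B _ _ _ n 0 n (add0n n)) => y /B0/=; rewrite in_itv/= andbT => y0.
rewrite tn tn1 (gtr0_norm y0) -(CB_integral_onem hQ pq0 (ltW y0) l0).
rewrite [LHS]integral_mkcond [RHS]integral_mkcond; apply: eq_integral => z _.
rewrite !patchE.
(* [B n.+1] is $(0,\infty)$ while [CB_integral_onem] integrates over $[0,\infty)$; the integrand
   vanishes at 0. *)
have -> : (z \in B n.+1) = (0 < z).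
  apply/idP/idP => [/set_mem/B0/=|z0]; first by rewrite in_itv/= andbT.
  apply/mem_set; split; first by rewrite /= in_itv/= andbT.
  by move=> c _; rewrite ltnn.
have -> : (z \in (`[0, +oo[%classic : set R)) = (0 <= z).
  by apply/idP/idP => [/set_mem/=|z0]; [|apply/mem_set]; rewrite /= in_itv/= andbT.
case: ltgtP => // [z0|<-]; first by rewrite gtr0_norm.
by rewrite mulr0 oppr0 expR0 subrr.
Qed.

(** Uniqueness of measures from cylinders to the whole past: [N0] may be infinite, but the densities
    $1-e^{-\lambda w(p)}$ and $1-e^{-v_{p-q}(\lambda)w(q)}$ turn it into finite measures, the first
    having mass $v_p(\lambda)$. *)
Lemma excursion_markov q : 0 < q -> markov_laplace v N0 q.
Proof.
move=> q0 p lambda A qp l0 FA; move: qp; rewrite le_eqVlt => /predU1P[<-|qp].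
  by rewrite subrr (cumulant0 hv).
have p0 := lt_trans q0 qp.
have vl0 : 0 <= v (p - q) lambda by rewrite (cumulant_ge0 hv)// subr_ge0 ltW.
have f10 (w : cadlag R) : 0 <= 1 - expR (- (lambda * w p)).
  by rewrite onem_expRN_ge0// mulr_ge0// path_ge0.
have f20 (w : cadlag R) : 0 <= 1 - expR (- (v (p - q) lambda * w q)).
  by rewrite onem_expRN_ge0// mulr_ge0// path_ge0.
have mf1 := measurable_onem_expRNZ lambda (@measurable_coordinate R p).
have mf2 := measurable_onem_expRNZ (v (p - q) lambda) (@measurable_coordinate R q).
have mA : measurable A by apply: coordinate_sigma_measurable FA; exact: subset_itv0.
rewrite -(densityE N0 f10 mf1 mA) -(densityE N0 f20 mf2 mA).
pose G := [set A | exists2 L, timed_in `[0, q] L & A = coordinate_cylinder L] : set (set (cadlag R)).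
apply: (g_sigma_algebra_measure_unique G _ (fun=> setT)).
- by move=> _ [L hL ->]; exact: measurable_coordinate_cylinder hL.
- by move=> _; exists [::] => //; apply/seteqP; split.
- by rewrite bigcup_const.
- exact: coordinate_cylinder_setI.
- move=> _ [L hL ->]; have mL := measurable_coordinate_cylinder hL.
  rewrite (densityE N0 f10 mf1 mL) (densityE N0 f20 mf2 mL).
  exact: (excursion_cylinder_markov q0 qp l0 hL).
- by move=> _; rewrite (densityE N0 f10 mf1 measurableT) excursion_onem// ltry.
- exact: coordinate_sigma_cylinder.
Qed.

End excursion_markov.

(** * Absence of fixed jumps *)

Section jump_gap.
Context {R : realType}.
Implicit Types (w : cadlag R) (u : R).

Lemma left_limit w u : 0 < u -> exists L : R,
  w s @[s --> u^'-] --> L /\ w (u - n.+1%:R^-1) @[n --> \oo] --> L.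
Proof.
move=> u0; have /cvg_ex[L wL] := @path_left R w u u0.
exists L; split => //; have /cvg_at_leftP := wL; apply; split.
  by move=> n; rewrite gtrBl.
by rewrite -[X in _ --> X]subr0; apply: cvgB; [exact: cvg_cst|exact: cvg_invS].
Qed.

(* Vanishes at [u > 0] exactly when [w] has no jump at [u]; the exponentials
   make it bounded. *)
Definition jump_gap u w : \bar R := limn_esup (fun n =>
  ((expR (- w (u - n.+1%:R^-1)) - expR (- w u)) ^+ 2)%:E).

Lemma cvg_expRN (x_ : R^nat) (x : R) : x_ @ \oo --> x ->
  expR (- x_ n) @[n --> \oo] --> expR (- x).
Proof.
move=> xx; have cNx : - x_ n @[n --> \oo] --> - x by exact: (cvgN xx).
exact: (cvg_comp _ _ cNx (@continuous_expR R (- x))).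
Qed.

Lemma jump_gapE u w (L : R) : w (u - n.+1%:R^-1) @[n --> \oo] --> L ->
  jump_gap u w = ((expR (- L) - expR (- w u)) ^+ 2)%:E.
Proof.
move=> wL; have c : ((expR (- w (u - n.+1%:R^-1)) - expR (- w u)) ^+ 2)%:E
    @[n --> \oo] --> ((expR (- L) - expR (- w u)) ^+ 2)%:E.
  apply/fine_cvgP; split; first exact: nearW.
  have wL' := cvg_expRN wL.
  have wL'' : expR (- w (u - n.+1%:R^-1)) - expR (- w u) @[n --> \oo] -->
      expR (- L) - expR (- w u) by apply: cvgB => //; exact: cvg_cst.
  exact: (cvgM wL'' wL'').
by rewrite /jump_gap is_cvg_limn_esupE; [exact/cvg_lim|apply/cvg_ex; eexists; exact: c].
Qed.

Lemma jump_gap_ge0 u w : (0 <= jump_gap u w)%E.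
Proof.
rewrite /jump_gap limn_esup_lim; apply: lime_ge; first exact: is_cvg_esups.
apply: nearW => n; apply: (@le_trans _ _ (((expR (- w (u - n.+1%:R^-1)) - expR (- w u)) ^+ 2)%:E)).
  by rewrite lee_fin sqr_ge0.
by apply: ereal_sup_ubound; exists n => /=.
Qed.

Lemma jump_gap0_cvg u w : 0 < u -> jump_gap u w = 0%E ->
  w s @[s --> u^'-] --> w u.
Proof.
move=> u0; have [L [wL wLn]] := left_limit w u0.
rewrite (jump_gapE wLn) => -[] /eqP; rewrite sqrf_eq0 subr_eq0 => /eqP/expR_inj/oppr_inj E.
by rewrite -E.
Qed.

Lemma measurable_jump_gap d (T : measurableType d) (f : T -> R) (g : T -> cadlag R) :
  measurable_fun setT f -> measurable_fun setT g ->
  measurable_fun setT (fun x => jump_gap (f x) (g x)).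
Proof.
move=> mf mg; apply: measurable_fun_limn_esup => n.
have mev (h : T -> R) : measurable_fun setT h ->
    measurable_fun setT (fun x => expR (- g x (h x))).
  move=> mh; apply: measurableT_comp => //; apply: measurableT_comp => //.
  exact: (measurableT_comp measurable_eval (measurable_fun_pair mh mg)).
apply/measurable_EFinP; apply: measurable_funX; apply: measurable_funB; apply: mev => //.
exact: measurable_funB.
Qed.

End jump_gap.

Lemma fin_addeI (R : realType) (a x y : \bar R) : a \is a fin_num ->
  (a + x = a + y)%E -> x = y.
Proof. by move=> afin /(congr1 (fun z => z - a)%E); rewrite ![(a + _)%E]addeC !addeK. Qed.

Section no_fixed_jump.
Context {R : realType}.
Variables (phi : R -> R) (v : R -> R -> R).
Hypothesis hv : is_cumulant_flow phi v.
Variables (M : {measure set (cadlag R) -> \bar R}) (u' u : R).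
Variable g : cadlag R -> R.
Hypotheses (u'0 : 0 <= u') (u'u : u' < u).
Hypothesis g0 : forall w, 0 <= g w.
Hypothesis ag : adapted `[0, u'] g.
Hypothesis gfin : (\int[M]_w (g w)%:E < +oo)%E.
Hypothesis hM : forall q, u' <= q -> q <= u -> markov_laplace v M q.

Implicit Type w : cadlag R.

(** Shifts the sequence so that every [q n] stays at or above [u'], where the Markov property and
    the adaptedness of [g] are available. *)
Let n0 := Num.truncn (u - u')^-1.
Let q n := u - (n + n0).+1%:R^-1.
Let X n (w : cadlag R) := expR (- w (q n)).
Let Y (w : cadlag R) := expR (- w u).
Let Z (w : cadlag R) := expR (- limn (fun n => w (q n))).
Let E (f : cadlag R -> R) := (\int[M]_w (g w * f w)%:E)%E.

Let u0 : 0 < u. Proof. exact: le_lt_trans u'u. Qed.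

Let q_itv n : u' <= q n <= u.
Proof.
rewrite /q gerBl// invr_ge0 ler0n andbT lerBrDl -lerBrDr.
rewrite invf_ple ?posrE// ?subr_gt0//.
apply: le_trans (_ : n0.+1%:R <= _); first exact/ltW/truncnS_gt.
by rewrite ler_nat ltnS leq_addl.
Qed.

Let q0 n : 0 <= q n.
Proof. by have /andP[h _] := q_itv n; exact: le_trans h. Qed.

Let mg : measurable_fun setT g.
Proof. by apply: adapted_measurable ag; exact: subset_itv0. Qed.

Let cvg_shift (f : R^nat) (a : R) : f @ \oo --> a -> f (n + n0)%N @[n --> \oo] --> a.
Proof. by move=> fa; rewrite (cvg_shiftn n0 f). Qed.

Let cvgq w : exists L : R, [/\ w s @[s --> u^'-] --> L,
  w (u - n.+1%:R^-1) @[n --> \oo] --> L & w (q n) @[n --> \oo] --> L].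
Proof.
have [L [wL wLn]] := left_limit w u0; exists L; split => //.
exact: (cvg_shift wLn).
Qed.

Let mX n : measurable_fun setT (X n).
Proof. by apply: measurableT_comp => //; apply: measurableT_comp => //; exact: measurable_coordinate. Qed.

Let mY : measurable_fun setT Y.
Proof. by apply: measurableT_comp => //; apply: measurableT_comp => //; exact: measurable_coordinate. Qed.

Let cvgX w : X n w @[n --> \oo] --> Z w.
Proof.
have [L [_ _ wL]] := cvgq w; rewrite /Z (cvg_lim _ wL)//; exact: cvg_expRN.
Qed.

Let mZ : measurable_fun setT Z.
Proof. by apply: (measurable_fun_cvg mX) => w _; exact: cvgX. Qed.

Let E_cvg (f_ : nat -> cadlag R -> R) f :
  (forall n, measurable_fun setT (f_ n)) -> (forall n (w : cadlag R), 0 <= f_ n w <= 1) ->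
  (forall w, f_ n w @[n --> \oo] --> f w) -> (E (f_ n) @[n --> \oo] --> E f)%E.
Proof.
move=> mf f01 ff.
have := @dominated_convergence _ _ _ M setT measurableT
  (fun n w => (g w * f_ n w)%:E) (fun w => (g w * f w)%:E) (fun w => (g w)%:E).
case.
- by move=> n; apply/measurable_EFinP; exact: measurable_funM.
- apply/measurable_EFinP; apply: measurable_funM => //.
  by apply: (measurable_fun_cvg mf) => w _; exact: ff.
- apply: aeW => w _; apply/fine_cvgP; split; first exact: nearW.
  by apply: cvgM; [exact: cvg_cst|exact: ff].
- apply/integrableP; split; first exact/measurable_EFinP.
  by under eq_integral do rewrite gee0_abs ?lee_fin//.
- apply: aeW => w n _; rewrite lee_fin; have /andP[h0 h1] := f01 n w.
  by rewrite ger0_norm ?mulr_ge0// ler_piMr.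
- by move=> _ _.
Qed.

Let split (xi : cadlag R -> R) (a s : R) : (forall w, 0 <= xi w <= 1) ->
  measurable_fun setT xi -> 0 <= a ->
  (\int[M]_w ((1 - expR (- (a * w s)))%:E * (xi w * g w)%:E) +
    E (fun w => (xi w * expR (- (a * w s)))%R) = E xi)%E /\
  (\int[M]_w ((1 - expR (- (a * w s)))%:E * (xi w * g w)%:E))%E \is a fin_num.
Proof.
move=> xi01 mxi a0.
have xi0 w : 0 <= xi w by case/andP : (xi01 w).
have p1 w : 0 <= (1 - expR (- (a * w s))) * (xi w * g w).
  by rewrite mulr_ge0 ?mulr_ge0 ?onem_expRN_ge0 ?mulr_ge0 ?path_ge0.
have m1 : measurable_fun setT (fun w : cadlag R => (1 - expR (- (a * w s))) * (xi w * g w)).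
  apply: measurable_funM; last exact: measurable_funM.
  exact: measurable_onem_expRNZ (measurable_coordinate s).
split.
  rewrite /E -(ge0_integralD M measurableT).
  - by apply: eq_integral => w _; rewrite -EFinM -EFinD; congr EFin; ring.
  - by move=> w _; rewrite -EFinM lee_fin.
  - exact/measurable_EFinP.
  - by move=> w _; rewrite lee_fin !mulr_ge0 ?expR_ge0.
  - apply/measurable_EFinP; apply: measurable_funM => //; apply: measurable_funM => //.
    exact: measurable_expRNZ (measurable_coordinate s).
rewrite ge0_fin_numE; last by apply: integral_ge0 => w _; rewrite -EFinM lee_fin.
apply: le_lt_trans gfin; apply: (ge0_le_integral M measurableT).
- by move=> w _; rewrite -EFinM lee_fin.
- exact/measurable_EFinP.
- exact/measurable_EFinP.
- move=> w _; rewrite -EFinM lee_fin mulrA ler_piMl//.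
  have /andP[x0 x1] := xi01 w.
  have h0 := onem_expRN_ge0 (mulr_ge0 a0 (path_ge0 w s)).
  by rewrite mulr_ile1// gerBl expR_ge0.
Qed.

(** The Markov identity for $1-e^{-\lambda w}$ is subtracted from the total [E xi]; the subtracted
    term is finite because [g] is integrable. *)
Let E_markov n (xi : cadlag R -> R) (lambda : R) : 0 <= lambda ->
  (forall w, 0 <= xi w <= 1) -> adapted `[0, q n] xi ->
  E (fun w => (xi w * expR (- (lambda * w u)))%R) =
  E (fun w => (xi w * expR (- (v (u - q n) lambda * w (q n))))%R).
Proof.
move=> l0 xi01 axi; have /andP[u'q qu] := q_itv n.
have vl0 : 0 <= v (u - q n) lambda by rewrite (cumulant_ge0 hv)// subr_ge0.
have axg : adapted `[0, q n] (fun w => (xi w * g w)%:E).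
  apply/measurable_EFinP; apply: measurable_funM => //.
  by apply: adaptedS ag; apply: subset_itvl; rewrite bnd_simp.
have xg0 w : (0 <= (xi w * g w)%:E)%E.
  by rewrite lee_fin mulr_ge0//; case/andP : (xi01 w).
have mxi : measurable_fun setT xi.
  by apply: adapted_measurable axi; exact: subset_itv0.
have [s1 _] := @split xi lambda u xi01 mxi l0.
have [s2 fin2] := @split xi _ (q n) xi01 mxi vl0.
have H := markov_laplace_weight (hM u'q qu) qu l0 vl0 xg0 axg.
exact: (fin_addeI fin2 (etrans (etrans (congr1 (fun z => z + _)%E (esym H)) s1) (esym s2))).
Qed.

Let expRN_01 (a : R) : 0 <= a -> 0 <= expR (- a) <= 1.
Proof. by move=> a0; rewrite expR_ge0/= expR_le1 oppr_le0. Qed.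

Let cvgv lambda : 0 <= lambda -> v (u - q n) lambda @[n --> \oo] --> lambda.
Proof.
move=> l0; have := cvg_shift (cvg_cumulant hv l0).
by under [in X in _ -> X]eq_fun do rewrite /q opprB addrC subrK.
Qed.

Let cvg_expRNM (c_ : R^nat) (c : R) w : c_ @ \oo --> c ->
  expR (- (c_ n * w (q n))) @[n --> \oo] --> expR (- (c * limn (fun n => w (q n)))).
Proof.
move=> cc; have [L [_ _ wL]] := cvgq w; rewrite (cvg_lim _ wL)//.
by apply: cvg_expRN; apply: cvgM.
Qed.

(** The Markov property at [q n] replaces [X n * Y] by the exponential of
    $-(1+v_{u-q_n}(1))\,w(q_n)$, whose exponent tends to $-2w(u-)$. *)
Lemma integral_cross_left_limit : E (fun w => (Z w * Y w)%R) = E (fun w => (Z w * Z w)%R).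
Proof.
have c1 : (E (fun w => (X n w * Y w)%R) @[n --> \oo] --> E (fun w => (Z w * Y w)%R))%E.
  apply: E_cvg.
  - by move=> n; exact: measurable_funM.
  - move=> n w; have /andP[a0 a1] := expRN_01 (path_ge0 w (q n)).
    have /andP[b0 b1] := expRN_01 (path_ge0 w u).
    by rewrite mulr_ge0//= mulr_ile1.
  - by move=> w; apply: cvgM; [exact: cvgX|exact: cvg_cst].
have c2 : (E (fun w => (X n w * Y w)%R) @[n --> \oo] --> E (fun w => (Z w * Z w)%R))%E.
  have -> : (fun n => E (fun w => (X n w * Y w)%R)) =
      (fun n => E (fun w => (expR (- ((1 + v (u - q n) 1) * w (q n))))%R)).
    apply/funext => n; transitivity (E (fun w => (X n w * expR (- (1 * w u)))%R)).
      by rewrite /E; apply: eq_integral => w _; rewrite mul1r.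
    have aX : adapted `[0, q n] (X n).
      apply: measurableT_comp => //; apply: measurableT_comp => //.
      by apply: adapted_coordinate; rewrite /= in_itv/= q0 lexx.
    apply: etrans (E_markov ler01 (fun w => expRN_01 (path_ge0 w (q n))) aX) _.
    rewrite /E; apply: eq_integral => w _; rewrite /X -expRD; congr (_ * expR _)%:E.
    by ring.
  apply: E_cvg.
  - by move=> n; exact: measurable_expRNZ (measurable_coordinate _).
  - move=> n w; apply: expRN_01; rewrite mulr_ge0 ?path_ge0// addr_ge0//.
    by rewrite (cumulant_ge0 hv)// subr_ge0; case/andP : (q_itv n).
  - move=> w; rewrite /Z -expRD.
    have -> : - limn (fun n => w (q n)) - limn (fun n => w (q n)) =
      - ((1 + 1) * limn (fun n => w (q n))) by ring.
    by apply: cvg_expRNM; apply: cvgD; [exact: cvg_cst|exact: cvgv].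
exact: (cvg_unique _ c1 c2).
Qed.

(** Here $Y^2=e^{-2w(u)}$ does not involve [n], and the Markov property with $\lambda=2$ and weight
    1 makes it a constant sequence converging to the right side. *)
Lemma integral_square_left_limit : E (fun w => (Y w * Y w)%R) = E (fun w => (Z w * Z w)%R).
Proof.
have c2 : (E (fun w => (Y w * Y w)%R) @[n --> \oo] --> E (fun w => (Z w * Z w)%R))%E.
  have -> : (fun n : nat => E (fun w => (Y w * Y w)%R)) =
      (fun n => E (fun w => (expR (- (v (u - q n) 2 * w (q n))))%R)).
    apply/funext => n; transitivity (E (fun w => (1 * expR (- (2 * w u)))%R)).
      rewrite /E; apply: eq_integral => w _; rewrite /Y -expRD mul1r.
      by congr (_ * expR _)%:E; ring.
    have c01 w : 0 <= (1 : R) <= 1 by rewrite ler01 lexx.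
    have ac : adapted `[0, q n] (fun w : cadlag R => 1 : R) by exact: measurable_cst.
    apply: etrans (E_markov (ler0n _ 2) c01 ac) _.
    by rewrite /E; apply: eq_integral => w _; rewrite mul1r.
  apply: E_cvg.
  - by move=> n; exact: measurable_expRNZ (measurable_coordinate _).
  - move=> n w; apply: expRN_01; rewrite mulr_ge0 ?path_ge0//.
    by rewrite (cumulant_ge0 hv)// subr_ge0; case/andP : (q_itv n).
  - move=> w; rewrite /Z -expRD.
    have -> : - limn (fun n => w (q n)) - limn (fun n => w (q n)) =
      - (2 * limn (fun n => w (q n))) by ring.
    by apply: cvg_expRNM; exact: cvgv.
have c1 : (E (fun w => (Y w * Y w)%R) @[_ --> \oo] --> E (fun w => (Y w * Y w)%R))%E.
  exact: cvg_cst.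
exact: (cvg_unique _ c1 c2).
Qed.

(* Since [v_h(lambda)] tends to [lambda] as [h] tends to [0], the Markov property
   at the times [q n] gives [E (Z Y) = E (Z Z) = E (Y Y)] for [Y = e^{-w(u)}] and
   [Z = e^{-w(u-)}]. *)
Lemma integral_jump_gap0 : (\int[M]_w ((g w)%:E * jump_gap u w) = 0)%E.
Proof.
have gapE w : ((g w)%:E * jump_gap u w = (g w * (Z w - Y w) ^+ 2)%:E)%E.
  have [L [_ wLn wL]] := cvgq w.
  by rewrite (jump_gapE wLn) /Z (cvg_lim _ wL).
under eq_integral do rewrite gapE.
(* The square is expanded as $(Z-Y)^2+2ZY=Z^2+Y^2$, with nonnegative terms only, since the integrals
   are extended reals. *)
have H : (E (fun w => ((Z w - Y w) ^+ 2)%R) + (E (fun w => (Z w * Y w)%R) + E (fun w => (Z w * Y w)%R)) =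
    E (fun w => (Z w * Z w)%R) + E (fun w => (Y w * Y w)%R))%E.
  have m2 (f h : cadlag R -> R) : measurable_fun setT f -> measurable_fun setT h ->
      measurable_fun setT (fun w => (g w * (f w * h w))%:E).
    by move=> mf mh; apply/measurable_EFinP; apply: measurable_funM => //; exact: measurable_funM.
  have p2 (f h : cadlag R -> R) : (forall w, 0 <= f w) -> (forall w, 0 <= h w) ->
      forall w, setT w -> (0 <= (g w * (f w * h w))%:E)%E.
    by move=> f0 h0 w _; rewrite lee_fin mulr_ge0// mulr_ge0.
  have Z0 w : 0 <= Z w by exact: expR_ge0.
  have Y0 w : 0 <= Y w by exact: expR_ge0.
  rewrite /E -(ge0_integralD M measurableT (p2 _ _ Z0 Y0) (m2 _ _ mZ mY) (p2 _ _ Z0 Y0) (m2 _ _ mZ mY)).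
  rewrite -(ge0_integralD M measurableT (p2 _ _ Z0 Z0) (m2 _ _ mZ mZ) (p2 _ _ Y0 Y0) (m2 _ _ mY mY)).
  rewrite -(ge0_integralD M measurableT).
  - by apply: eq_integral => w _; rewrite -!EFinD; congr EFin; ring.
  - by move=> w _; rewrite lee_fin mulr_ge0// sqr_ge0.
  - apply/measurable_EFinP; apply: measurable_funM => //; apply: measurable_funX.
    exact: measurable_funB.
  - by move=> w _; rewrite adde_ge0// p2.
  - by apply: emeasurable_funD; exact: m2.
move: H; rewrite integral_cross_left_limit integral_square_left_limit; set I := E (fun w => (Z w * Z w)%R).
have Ifin : I \is a fin_num.
  have p w : 0 <= g w * (Z w * Z w) by rewrite !mulr_ge0 ?expR_ge0.
  rewrite ge0_fin_numE; last by apply: integral_ge0 => w _; rewrite lee_fin.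
  apply: le_lt_trans gfin; apply: (ge0_le_integral M measurableT).
  - by move=> w _; rewrite lee_fin.
  - by apply/measurable_EFinP; apply: measurable_funM => //; exact: measurable_funM.
  - exact/measurable_EFinP.
  - move=> w _; rewrite lee_fin ler_piMr// /Z -expRD expR_le1.
    have [L [_ _ wL]] := cvgq w; rewrite (cvg_lim _ wL)//.
    have L0 : 0 <= L.
      rewrite -(cvg_lim _ wL)//; apply: limr_ge; first by apply/cvg_ex; exists L.
      by apply: nearW => n; exact: path_ge0.
    by rewrite -opprD oppr_le0 addr_ge0.
move=> H; have IIfin : (I + I)%E \is a fin_num by rewrite fin_numD Ifin.
apply: (fin_addeI IIfin); rewrite [LHS]addeC [RHS]adde0; exact: H.
Qed.

End no_fixed_jump.

(** * The immigration measure *)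

Section immigration.
Context {R : realType}.
Variables (phi : R -> R) (v : R -> R -> R) (Q : R -> R.-pker R ~> R).
Variable QQ : R.-pker R ~> cadlag R.
Hypothesis hv : is_cumulant_flow phi v.
Hypothesis hQ : is_CB_semigroup v Q.
Hypothesis hQQ : is_CB_law Q QQ.
Variables (beta : R) (nu : {sigma_finite_measure set R -> \bar R}).
Variable l : R -> {sigma_finite_measure set R -> \bar R}.
Variable N0 : {sigma_finite_measure set (cadlag R) -> \bar R}.
Hypothesis hbeta : 0 <= beta.
Hypothesis hnu1 : (\int[nu]_(u in `]0%R, +oo[) u%:E < +oo)%E.
Hypothesis hl : 0 < beta -> is_entrance_family v l.
Hypothesis hN0 : 0 < beta -> is_excursion_law Q l N0.
Implicit Types (w : cadlag R) (z t q : R).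

Let mpos : measurable (`]0%R, +oo[ : set R) := measurable_itv _.

Definition immigration_sum : {measure set (cadlag R) -> \bar R} :=
  measure_add (mscale (NngNum hbeta) N0)
              (mixture nu (k := QQ) mpos (measurable_kernel QQ)).

Definition immigration_measure : set (cadlag R) -> \bar R := immigration_sum.

HB.instance Definition _ := Measure.copy immigration_measure immigration_sum.

Lemma immigration_measureE : immigration_measure = immigration_law beta N0 nu QQ.
Proof. by apply/funext => A; exact: (measure_addE (mscale (NngNum hbeta) N0) _ A). Qed.

Lemma integral_immigration_measure (f : cadlag R -> \bar R) :
  (forall w, 0 <= f w)%E -> measurable_fun setT f ->
  (\int[immigration_measure]_w f w = beta%:E * \int[N0]_w f w +
     \int[nu]_(x in `]0%R, +oo[) \int[QQ x]_w f w)%E.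
Proof.
move=> f0 mf; rewrite (ge0_integral_measure_add (mscale (NngNum hbeta) N0) (mixture nu (k := QQ) mpos (measurable_kernel QQ)) measurableT)//.
by rewrite ge0_integral_mscale// integral_mixture.
Qed.

Lemma excursion_w0 : 0 < beta -> N0 [set w | w 0 != 0] = 0%E.
Proof.
move=> b0; have mw0 : measurable [set w : cadlag R | w 0 != 0].
  rewrite (_ : [set _ | _] = setT `&` (fun w : cadlag R => w 0) @^-1` (~` [set 0])).
    by apply: measurable_coordinate => //; exact: measurableC.
  by rewrite setTI; apply/seteqP; split => w /= /eqP.
apply/(negligibleP _ mw0).1; have := excursion_D1 (hN0 b0); apply: negligibleS.
by move=> w /= /eqP w0 [].
Qed.

Lemma measurable_w0 (B : set R) : measurable B -> measurable [set w : cadlag R | B (w 0)].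
Proof. by move=> mB; rewrite -[X in measurable X]setTI; exact: measurable_coordinate. Qed.

Lemma CB_law_w0 x (A : set (cadlag R)) : 0 <= x -> measurable A ->
  A `<=` [set w | w 0 != x] -> QQ x A = 0%E.
Proof.
move=> x0 mA Ax; have [QQ0 _] := hQQ x0.
have mx : measurable [set w : cadlag R | w 0 = x] by exact: (measurable_w0 (measurable_set1 x)).
have := measureTC (QQ x) mx; rewrite QQ0 prob_kernel -[LHS]adde0 => /fin_addeI h.
apply: (subset_measure0 mA (measurableC mx)); first by move=> w /Ax/eqP.
exact: esym (h isT).
Qed.

(** The two parts are separated by the starting point: [N0] lives on [w 0 = 0] and [QQ x] on
    [w 0 = x] with [x > 0]. Covers for [N0] and for [nu] are combined accordingly. *)
Lemma sigma_finite_immigration_measure : sigma_finite setT immigration_measure.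
Proof.
have [E ET mE] := sigma_finiteT N0.
have [A AT mA] := sigma_finiteT nu.
exists (fun n => (E n `&` [set w | w 0 = 0]) `|` ([set w | (A n `\ 0) (w 0)])).
  apply/seteqP; split => // w _; have [w0|w0] := eqVneq (w 0) 0.
    have [n _ En] : (\bigcup_n E n) w by rewrite -ET.
    by exists n => //; left.
  have [n _ An] : (\bigcup_n A n) (w 0) by rewrite -AT.
  by exists n => //; right; split => //; exact/eqP.
move=> n; have [mEn finE] := mE n; have [mAn finA] := mA n.
have m1 : measurable (E n `&` [set w | w 0 = 0]).
  by apply: measurableI => //; exact: (measurable_w0 (measurable_set1 0)).
have mA0 : measurable (A n `\ 0) by apply: measurableD => //; exact: measurable_set1.
have m2 : measurable [set w : cadlag R | (A n `\ 0) (w 0)] by exact: measurable_w0.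
split; first exact: measurableU.
set F := _ `|` _; have mF : measurable F by exact: measurableU.
rewrite immigration_measureE /immigration_law lte_add_pinfty//.
  have [b0|] := ltP 0 beta; last first.
    by move=> b0; have -> : beta = 0 by [apply/eqP; rewrite eq_le b0]; rewrite mul0e ltry.
  apply: lte_mul_pinfty => //.
  have N2 : N0 [set w : cadlag R | (A n `\ 0) (w 0)] = 0%E.
    have mw0 : measurable [set w : cadlag R | w 0 != 0].
      rewrite (_ : [set _ | _] = [set w : cadlag R | (~` [set 0]) (w 0)]).
        by apply: measurable_w0; exact: measurableC.
      by apply/seteqP; split => w /= /eqP.
    apply: (subset_measure0 m2 mw0); first by move=> w [_ /eqP].
    exact: excursion_w0.
  apply: le_lt_trans finE; rewrite /F measureU0//.
  apply: le_measure; [exact/mem_set|exact/mem_set|exact: subIsetl].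
apply: le_lt_trans finA; rewrite -[leRHS]mul1e -integral_cst//.
rewrite [leLHS]integral_mkcond [leRHS]integral_mkcond.
apply: (ge0_le_integral nu measurableT).
- by move=> x _; rewrite patchE; case: ifP.
- apply/(measurable_restrictT _ _).1 => //; apply: measurable_funTS.
  exact: measurable_kernel.
- by apply/(measurable_restrictT _ _).1 => //; exact: measurable_cst.
- move=> x _; rewrite !patchE; case: ifPn => [/set_mem/=|]; last by case: ifP.
  rewrite in_itv/= andbT => x0; case: ifPn => [_|/negP nAx].
    rewrite -(@prob_kernel _ _ _ _ _ QQ x).
    by apply: le_measure => //; exact/mem_set.
  rewrite le_eqVlt; apply/orP; left; apply/eqP; apply: CB_law_w0 => //; first exact: ltW.
  move=> w; rewrite /F => -[[_ /= ->]|[Aw _]]; first by rewrite lt_eqF.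
  by apply/eqP => w0x; apply: nAx; apply/mem_set; rewrite -w0x.
Qed.

(** From $1-e^{-zu}\le zu$ and the first moment of [nu]. *)
Lemma integral_nu_fin z : 0 <= z ->
  (\int[nu]_(u in `]0%R, +oo[) (1 - expR (- (z * u)))%:E)%E \is a fin_num /\
  (\int[nu]_(u in `]0%R, +oo[) (1 - expR (- (z * u)))%:E <=
   z%:E * \int[nu]_(u in `]0%R, +oo[) u%:E)%E.
Proof.
move=> z0.
have u0 (u : R) : (`]0%R, +oo[%classic : set R) u -> 0 <= u.
  by rewrite /= in_itv/= andbT => /ltW.
have le1 : (\int[nu]_(u in `]0%R, +oo[) (1 - expR (- (z * u)))%:E <=
    z%:E * \int[nu]_(u in `]0%R, +oo[) u%:E)%E.
  have <- : (\int[nu]_(u in `]0%R, +oo[) (z%:E * u%:E) =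
      z%:E * \int[nu]_(u in `]0%R, +oo[) u%:E)%E.
    by apply: ge0_integralZl => // u /u0; rewrite lee_fin.
  apply: (ge0_le_integral nu mpos).
  - by move=> u /u0 h; rewrite lee_fin onem_expRN_ge0// mulr_ge0.
  - apply/measurable_EFinP; apply: measurable_funTS.
    exact: measurable_onem_expRNZ.
  - by apply/measurable_EFinP; exact: measurable_funM.
  - move=> u /u0 h; rewrite -EFinM lee_fin lerBlDr -lerBlDl.
    by have := expR_ge1Dx (- (z * u)).
split => //; rewrite ge0_fin_numE; last first.
  by apply: integral_ge0 => u /u0 h; rewrite lee_fin onem_expRN_ge0// mulr_ge0.
by apply: le_lt_trans le1 _; rewrite lte_mul_pinfty.
Qed.

Local Notation psi := (immigration_mechanism beta nu).

Lemma immigration_mechanismE z : 0 <= z ->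
  (psi z)%:E = ((beta * z)%:E +
    \int[nu]_(u in `]0%R, +oo[) (1 - expR (- (z * u)))%:E)%E.
Proof.
move=> z0; have [fin _] := integral_nu_fin z0.
by rewrite /immigration_mechanism /Rintegral EFinD fineK.
Qed.

Lemma immigration_mechanism_le : exists2 C, 0 <= C & forall z, 0 <= z -> psi z <= C * z.
Proof.
have I0 : (0 <= \int[nu]_(u in `]0%R, +oo[) u%:E)%E.
  by apply: integral_ge0 => u /=; rewrite in_itv/= andbT => u0; rewrite lee_fin ltW.
pose K := fine (\int[nu]_(u in `]0%R, +oo[) u%:E)%E.
have KE : (\int[nu]_(u in `]0%R, +oo[) u%:E)%E = K%:E by rewrite fineK// ge0_fin_numE.
exists (beta + K); first by rewrite addr_ge0// fine_ge0.
move=> z z0; rewrite -lee_fin immigration_mechanismE// mulrDl EFinD leeD//.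
by have [_] := integral_nu_fin z0; rewrite KE -EFinM mulrC.
Qed.

Let f0 a t w : 0 <= a -> (0 <= (1 - expR (- (a * w t)))%:E)%E.
Proof. by move=> a0; rewrite lee_fin onem_expRN_ge0// mulr_ge0// path_ge0. Qed.

Let mf a t : measurable_fun setT (fun w : cadlag R => (1 - expR (- (a * w t)))%:E).
Proof. by apply/measurable_EFinP; exact: measurable_onem_expRNZ (measurable_coordinate t). Qed.

Let in_pos (x : R) : x \in (`]0%R, +oo[%classic : set R) -> 0 < x.
Proof. by move=> /set_mem/=; rewrite in_itv/= andbT. Qed.

(** At time 0 the excursions are all at 0 and the linear term of [psi] is lost, hence the
    restriction on [t]; [immigration_onem0] gives the value there. *)
Lemma immigration_onem t lambda : 0 <= t -> (0 < t \/ beta = 0) -> 0 <= lambda ->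
  (\int[immigration_measure]_w (1 - expR (- (lambda * w t)))%:E =
   (psi (v t lambda))%:E)%E.
Proof.
move=> t0 ht l0; have vl0 := cumulant_ge0 hv t0 l0.
rewrite (integral_immigration_measure (fun w => f0 t w l0) (mf lambda t)).
rewrite immigration_mechanismE//; congr (_ + _)%E; last first.
  apply: eq_integral => x /in_pos x0.
  by rewrite (CB_law_onem hv hQ hQQ (ltW x0) t0 l0).
have [b0|] := ltP 0 beta; last first.
  by move=> b0; have -> : beta = 0 by [apply/eqP; rewrite eq_le b0]; rewrite mul0e mul0r.
have {}t0 : 0 < t by case: ht => // b1; move: b0; rewrite b1 ltxx.
by rewrite (excursion_onem (hl b0) (hN0 b0) t0 l0) EFinM.
Qed.

Lemma immigration_onem0 lambda : 0 <= lambda ->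
  (\int[immigration_measure]_w (1 - expR (- (lambda * w 0)))%:E =
   (psi lambda - beta * lambda)%:E)%E.
Proof.
move=> l0; have vl0 := cumulant_ge0 hv (lexx 0) l0.
rewrite (integral_immigration_measure (fun w => f0 0 w l0) (mf lambda 0)).
have -> : (beta%:E * \int[N0]_w (1 - expR (- (lambda * w 0)))%:E = 0)%E.
  have [b0|] := ltP 0 beta; last first.
    by move=> b0; have -> : beta = 0 by [apply/eqP; rewrite eq_le b0]; rewrite mul0e.
  rewrite -[RHS](mule0 beta%:E); congr (_ * _)%E.
  rewrite -[RHS](integral0 N0 setT); apply: ge0_ae_eq_integral => //.
    by move=> w _; exact: f0.
  apply: filterS (excursion_D1 (hN0 b0)) => w [w0 _] _.
  by rewrite w0 mulr0 oppr0 expR0 subrr.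
rewrite add0e EFinB immigration_mechanismE//.
rewrite addeC addeA -EFinN -EFinD addNr add0e.
apply: eq_integral => x /in_pos x0.
by rewrite (CB_law_onem hv hQ hQQ (ltW x0) (lexx 0) l0) (cumulant0 hv l0).
Qed.

(** The restriction on [q] comes from the excursions: at time 0 the right side would vanish on them,
    although they do leave 0. *)
Lemma immigration_markov p q lambda (xi : cadlag R -> \bar R) :
  0 <= q -> (0 < q \/ beta = 0) -> q <= p -> 0 <= lambda ->
  (forall w, 0 <= xi w)%E -> adapted `[0, q] xi ->
  (\int[immigration_measure]_w ((1 - expR (- (lambda * w p)))%:E * xi w) =
   \int[immigration_measure]_w ((1 - expR (- (v (p - q) lambda * w q)))%:E * xi w))%E.
Proof.
move=> q0 hq qp l0 xi0 axi.
have vl0 : 0 <= v (p - q) lambda by rewrite (cumulant_ge0 hv)// subr_ge0.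
have mxi : measurable_fun setT xi by apply: adapted_measurable axi; exact: subset_itv0.
have g0 a s w : 0 <= a -> (0 <= (1 - expR (- (a * w s)))%:E * xi w)%E.
  by move=> a0; rewrite mule_ge0// f0.
have mgx a s : measurable_fun setT (fun w => (1 - expR (- (a * w s)))%:E * xi w)%E.
  by apply: emeasurable_funM => //; exact: mf.
rewrite (integral_immigration_measure (fun w => g0 lambda p w l0) (mgx lambda p)).
rewrite (integral_immigration_measure (fun w => g0 _ q w vl0) (mgx _ q)).
have hq0 : 0 < beta -> 0 < q by case: hq => // ->; rewrite ltxx.
have E2 : (\int[nu]_(x in `]0%R, +oo[)
      \int[QQ x]_w ((1 - expR (- (lambda * w p)))%:E * xi w) =
    \int[nu]_(x in `]0%R, +oo[)
      \int[QQ x]_w ((1 - expR (- (v (p - q) lambda * w q)))%:E * xi w))%E.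
  apply: eq_integral => x /in_pos x0.
  exact: (markov_laplace_weight (CB_law_markov hQ hQQ (ltW x0) q0) qp l0 vl0 xi0 axi).
have [b0|] := ltP 0 beta; last first.
  move=> b0; have -> : beta = 0 by [apply/eqP; rewrite eq_le b0].
  exact: (congr2 adde (etrans (mul0e _) (esym (mul0e _))) E2).
have E1 := markov_laplace_weight (excursion_markov hv hQ (hl b0) (hN0 b0) (hq0 b0)) qp l0 vl0 xi0 axi.
exact: (congr2 adde (congr1 (mule beta%:E) E1) E2).
Qed.

Lemma measurable_jump_gap_path u : measurable_fun setT (fun w : cadlag R => jump_gap u w).
Proof. exact: (measurable_jump_gap (measurable_cst u) (@measurable_id _ _ setT)). Qed.

(** The law is finite, so the weight 1 is integrable and the starting time 0 is allowed. *)
Lemma CB_law_jump_gap x u : 0 <= x -> 0 < u -> (\int[QQ x]_w jump_gap u w = 0)%E.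
Proof.
move=> x0 u0.
have fin1 : (\int[QQ x]_w (1 : R)%:E < +oo)%E.
  by rewrite integral_cst// mul1e prob_kernel ltry.
have hM q : 0 <= q -> q <= u -> markov_laplace v (QQ x) q.
  by move=> q0 _; exact: (CB_law_markov hQ hQQ x0 q0).
have := @integral_jump_gap0 _ phi v hv (QQ x) 0 u (fun=> 1) (lexx 0) u0
  (fun=> ler01) (measurable_cst _) fin1 hM.
by move=> h; rewrite -[RHS]h; apply: eq_integral => w _; rewrite mul1e.
Qed.

(** The weight $1-e^{-w(u/2)}$ has the finite integral $v_{u/2}(1)$. Where it vanishes the path has
    died by time $u/2$, hence has no jump at [u]. *)
Lemma excursion_jump_gap u : 0 < beta -> 0 < u -> (\int[N0]_w jump_gap u w = 0)%E.
Proof.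
move=> b0 u0; have u20 : 0 < u / 2 by rewrite divr_gt0.
have u2u : u / 2 < u by lra.
pose g w := 1 - expR (- (1 * w (u / 2))).
have g0 w : 0 <= g w by rewrite onem_expRN_ge0// mul1r path_ge0.
have ag : adapted `[0, u / 2] g.
  apply: measurable_funB => //; apply: measurableT_comp => //; apply: measurableT_comp => //.
  apply: measurable_funM => //; apply: adapted_coordinate.
  by rewrite /= in_itv/= lexx ltW.
have gfin : (\int[N0]_w (g w)%:E < +oo)%E.
  by rewrite (excursion_onem (hl b0) (hN0 b0) u20 ler01) ltry.
have hM q : u / 2 <= q -> q <= u -> markov_laplace v N0 q.
  by move=> uq _; apply: (excursion_markov hv hQ (hl b0) (hN0 b0)); exact: lt_le_trans uq.
have H := integral_jump_gap0 hv (ltW u20) u2u g0 ag gfin hM.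
have mg : measurable_fun setT g by apply: adapted_measurable ag; exact: subset_itv0.
have mgg : measurable_fun setT (fun w => (g w)%:E * jump_gap u w)%E.
  by apply: emeasurable_funM; [exact/measurable_EFinP|exact: measurable_jump_gap_path].
have gg0 w : (0 <= (g w)%:E * jump_gap u w)%E by rewrite mule_ge0// ?lee_fin// jump_gap_ge0.
have ae0 : {ae N0, forall w, setT w -> ((g w)%:E * jump_gap u w)%E = cst 0%E w}.
  apply/(ae_eq_integral_abs N0 measurableT mgg).
  by rewrite -[RHS]H; apply: eq_integral => w _; rewrite gee0_abs.
rewrite -[RHS](integral0 N0 setT); apply: ge0_ae_eq_integral => //.
- exact: measurable_jump_gap_path.
- by move=> w _; exact: jump_gap_ge0.
apply: filterS2 ae0 (excursion_D1 (hN0 b0)) => w /(_ I) /eqP + wD _.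
rewrite mule_eq0 eqe => /orP[|/eqP//].
rewrite /g mul1r subr_eq0 eq_sym -[X in _ == X]expR0 => /eqP/expR_inj/eqP.
rewrite oppr_eq0 => /eqP w2.
have wn0 s : u / 2 <= s -> w s = 0 by move=> us; exact: (D1_absorbing wD u20 us w2).
rewrite (@jump_gapE _ u w 0); first by rewrite (wn0 u (ltW u2u)) subrr expr0n.
apply: cvg_near_cst; near=> n; apply/eqP; rewrite wn0//.
have : n.+1%:R^-1 < u / 2.
  by near: n; exact: (cvgr_lt 0 cvg_invS).
by move=> h; rewrite lerBrDr [leRHS]splitr lerD2l ltW.
Unshelve. all: by end_near. Qed.

Lemma immigration_jump_gap u : 0 < u ->
  (\int[immigration_measure]_w jump_gap u w = 0)%E.
Proof.
move=> u0; rewrite integral_immigration_measure; [|exact: jump_gap_ge0|exact: measurable_jump_gap_path].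
rewrite [X in (_ + X)%E](_ : _ = 0%E); last first.
  rewrite -[RHS](integral0 nu (`]0%R, +oo[ : set R)); apply: eq_integral => x /in_pos x0.
  by rewrite CB_law_jump_gap// ltW.
rewrite adde0; have [b0|] := ltP 0 beta; last first.
  by move=> b0; have -> : beta = 0 by [apply/eqP; rewrite eq_le b0]; rewrite mul0e.
by rewrite excursion_jump_gap// mule0.
Qed.

End immigration.

(** * Uniqueness of joint Laplace transforms *)

(* A finite measure on the sigma-algebra generated by a family of nonnegative
   functions [X] is determined by the integrals of [e^{-S}], [S] ranging over the
   nonnegative combinations of the [X]: in a finite combination the factors
   [e^{-aX}] are replaced one at a time by indicators of [X @^-1` C]. *)
Section sigma_laplace_uniqueness.
Local Open Scope ereal_scope.
Context d (T : measurableType d) (R : realType).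
Variables (M1 M2 : {measure set T -> \bar R}).
Hypothesis fin1 : M1 setT < +oo.
Hypothesis fin2 : M2 setT < +oo.
Variables (G H : set (T -> \bar R)) (Z : set (set T)).
Hypothesis mG : forall X, G X -> measurable_fun setT X.
Hypothesis mH : forall S, H S -> measurable_fun setT S.
Hypothesis G0 : forall X x, G X -> 0 <= X x.
Hypothesis H0 : forall S x, H S -> 0 <= S x.
Hypothesis HG : forall S X (a : R), H S -> G X -> (0 <= a)%R ->
  H (fun x => S x + a%:E * X x).
Hypothesis Hcst : H (fun=> 0).
Hypothesis lapM : forall S, H S ->
  \int[M1]_x expeR (- S x) = \int[M2]_x expeR (- S x).
Hypothesis mZ : forall A, Z A -> measurable A.
Hypothesis Z1 : forall A, Z A -> M1 A = 0.
Hypothesis Z2 : forall A, Z A -> M2 A = 0.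

Let cylinders := seq ((T -> \bar R) * set (\bar R)).

Let cyl (l : cylinders) : set T :=
  foldr (fun XC A => XC.1 @^-1` XC.2 `&` A) setT l.

Let ok (l : cylinders) : Prop :=
  foldr (fun XC P => [/\ G XC.1, measurable XC.2 & P]) True l.

Let cyl_cat l1 l2 : cyl (l1 ++ l2) = cyl l1 `&` cyl l2.
Proof. by elim: l1 => [|XC l1 IH]; rewrite /= ?setTI// IH setIA. Qed.

Let ok_cat l1 l2 : ok l1 -> ok l2 -> ok (l1 ++ l2).
Proof. by elim: l1 => [//|XC l1 IH] /= [GX mC /IH h] /h. Qed.

Let mpre X C : G X -> measurable C -> measurable (X @^-1` C).
Proof. by move=> GX mC; rewrite -[X in measurable X]setTI; exact: mG. Qed.

Let mcyl l : ok l -> measurable (cyl l).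
Proof.
elim: l => [_|XC l IH]; first exact: measurableT.
by move=> /= [GX mC /IH]; apply: measurableI; exact: mpre.
Qed.

Let me S : H S -> measurable_fun setT (fun x => expeR (- S x)).
Proof.
move=> HS; apply: (measurableT_comp measurable_expeR).
by apply: measurableT_comp => //; exact: mH.
Qed.

Let fe S x : H S -> expeR (- S x) = (fine (expeR (- S x)))%:E.
Proof. by move=> HS; rewrite fineK// expeRN_fin_num// H0. Qed.

Section step.
Variables (l : cylinders) (S : T -> \bar R).
Hypothesis okl : ok l.
Hypothesis HS : H S.

Let f x := (fine (expeR (- S x)) * \1_(cyl l) x)%R.

Let f0 x : (0 <= f x)%R.
Proof. by rewrite mulr_ge0// fine_ge0// expeR_ge0. Qed.

Let mf : measurable_fun setT f.
Proof.
apply: measurable_funM; last exact/measurable_indic/mcyl.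
exact: measurable_fineT (me HS).
Qed.

Let dens (M : {measure set T -> \bar R}) := density M f0 mf.

Let densT (M : {measure set T -> \bar R}) : M setT < +oo -> dens M setT < +oo.
Proof.
move=> MT; apply: le_lt_trans MT.
rewrite /dens (densityE M f0 mf measurableT) -[leRHS]mul1e -(integral_cst M measurableT).
apply: (ge0_le_integral M measurableT).
- by move=> x _; rewrite lee_fin.
- exact/measurable_EFinP.
- exact: measurable_cst.
- move=> x _; rewrite lee_fin /f indicE.
  have h1 : (fine (expeR (- S x)) <= 1)%R.
    by rewrite -lee_fin -fe// expeRN_le1// H0.
  by case: (_ \in _); rewrite ?mulr1// mulr0.
Qed.

Let dens_lap (M : {measure set T -> \bar R}) X (a : R) : G X -> (0 <= a)%R ->
  \int[dens M]_x expeR (- (a%:E * X x)) =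
  \int[M]_(x in cyl l) expeR (- (S x + a%:E * X x)).
Proof.
move=> GX a0; rewrite integral_density; last 2 first.
- by move=> x; exact: expeR_ge0.
- apply: (measurableT_comp measurable_expeR); apply: measurableT_comp => //.
  by apply: measurable_funeM; exact: mG.
rewrite [RHS]integral_mkcond; apply: eq_integral => x _.
rewrite patchE /f indicE; case: ifPn => _; last by rewrite mulr0 mul0e.
rewrite mulr1 -fe// -expeRD oppeD//.
by rewrite ge0_adde_def// inE ?H0// mule_ge0// G0.
Qed.

(** One-variable uniqueness for [X], under the measures of density $e^{-S}1_{\mathrm{cyl}(l)}$:
    their transforms in [X] involve $S+aX$, which stays in [H]. *)
Lemma sigma_laplace_step X C : G X -> measurable C ->
  (forall S', H S' -> \int[M1]_(x in cyl l) expeR (- S' x) =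
                      \int[M2]_(x in cyl l) expeR (- S' x)) ->
  \int[M1]_(x in X @^-1` C `&` cyl l) expeR (- S x) =
  \int[M2]_(x in X @^-1` C `&` cyl l) expeR (- S x).
Proof.
move=> GX mC IH; have h (M : {measure set T -> \bar R}) :
    \int[M]_(x in X @^-1` C `&` cyl l) expeR (- S x) = dens M (X @^-1` C).
  rewrite /dens (densityE M f0 mf (mpre GX mC)) [LHS]integral_mkcond [RHS]integral_mkcond.
  apply: eq_integral => x _; rewrite !patchE /f indicE in_setI fe//.
  by case: (_ \in _) => //=; case: (_ \in _); rewrite ?mulr1 ?mulr0.
rewrite !h; apply: (laplace_unique (mG GX)) => //.
- by move=> x; exact: G0.
- exact: densT.
- exact: densT.
by move=> a a0; rewrite !dens_lap//; apply: IH; exact: HG.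
Qed.

End step.

Let cyl_eq l : ok l -> forall S, H S -> \int[M1]_(x in cyl l) expeR (- S x) =
                      \int[M2]_(x in cyl l) expeR (- S x).
Proof.
elim: l => [_|[X C] l IH]; first exact: lapM.
by move=> [/= GX mC okl] S HS; apply: sigma_laplace_step => //; exact: IH.
Qed.

Lemma sigma_laplace_unique A :
  <<s [set B | exists2 X, G X & exists2 C, measurable C & B = X @^-1` C] `|` Z >> A ->
  M1 A = M2 A.
Proof.
move=> FA; pose Pi := [set B | exists2 l, ok l & B = cyl l] `|`
  [set B | measurable B /\ M1 B = 0 /\ M2 B = 0].
have PiT : Pi setT by left; exists [::].
have mPi : Pi `<=` measurable by move=> B [[l okl ->]|[]//]; exact: mcyl.
apply: (@g_sigma_algebra_measure_unique _ _ _ Pi mPi (fun=> setT) (fun=> PiT)).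
- by rewrite bigcup_const//; exists 0%N.
- have nl B C : Pi C -> measurable B /\ M1 B = 0 /\ M2 B = 0 -> Pi (C `&` B).
    move=> PC [mB [B1 B2]]; right; have mCB := measurableI _ _ (mPi _ PC) mB.
    by split => //; split; apply: (subset_measure0 mCB mB) => //; exact: subIsetr.
  move=> B C [[l1 ok1 ->]|Bn] PC; last by rewrite setIC; exact: nl.
  case: (PC) => [[l2 ok2 ->]|Cn]; last by apply: nl => //; left; exists l1.
  by left; exists (l1 ++ l2); [exact: ok_cat|rewrite cyl_cat].
- move=> B [[l okl ->]|[_ [-> ->]]]//.
  have := cyl_eq okl Hcst; rewrite oppe0 expeR0.
  by rewrite !integral_cst ?mul1e//; exact: mcyl.
- by [].
apply: sub_sigma_algebra2 FA => B [[X GX [C mC ->]]|ZB]; last first.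
  by right; split; [exact: mZ|split; [exact: Z1|exact: Z2]].
by left; exists [:: (X, C)] => //=; rewrite setIT.
Qed.

End sigma_laplace_uniqueness.

Lemma integral_null_neg (R : realType) (m : {measure set R -> \bar R}) (f : R -> \bar R) :
  m `]-oo, 0[%classic = 0%E -> (forall y, 0 <= f y)%E -> measurable_fun setT f ->
  (\int[m]_y f y = \int[m]_(y in `[0%R, +oo[) f y)%E.
Proof.
move=> m0 f0 mf; have mneg : measurable (`]-oo, 0%R[%classic : set R) by [].
by rewrite (ge0_negligible_integral mneg)// setTD setCitvl.
Qed.

(** Taking [X] to be the positive part makes the integrands those of [laplace] on $[0,\infty)$,
    where both measures live, and the preimage of the image of [A] agrees with [A] there. *)
Lemma laplace_unique_pos (R : realType) (m1 m2 : {measure set R -> \bar R}) :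
  (m1 setT < +oo)%E -> (m2 setT < +oo)%E ->
  m1 `]-oo, 0[%classic = 0%E -> m2 `]-oo, 0[%classic = 0%E ->
  (forall lambda, 0 <= lambda -> laplace m1 lambda = laplace m2 lambda) ->
  forall A, measurable A -> m1 A = m2 A.
Proof.
move=> f1 f2 n1 n2 lap A mA.
pose X (y : R) : \bar R := (Num.max y 0)%:E.
have mX : measurable_fun setT X.
  by apply/measurable_EFinP; exact: measurable_maxr.
have h := @integral_null_neg R.
have eqX (m : {measure set R -> \bar R}) : m `]-oo, 0[%classic = 0%E ->
    m A = m (X @^-1` (EFin @` A)).
  move=> m0; have mXA : measurable (X @^-1` (EFin @` A)).
    by rewrite -[X in measurable X]setTI; apply: mX => //; exact: measurable_image_EFin.
  rewrite -[A in LHS]setIT -[X in _ = m X]setIT -!(integral_indic m measurableT)//.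
  rewrite h//; [|exact/measurable_EFinP/measurable_indic].
  rewrite [RHS]h//; [|exact/measurable_EFinP/measurable_indic].
  apply: eq_integral => y /set_mem/=; rewrite in_itv/= andbT => y0.
  congr (_%:E); rewrite !indicE; congr (_%:R); congr nat_of_bool.
  apply/idP/idP => /set_mem yA; apply/mem_set.
    by exists y => //; rewrite /X max_l.
  by move: yA => [z Az]; rewrite /X max_l// => -[<-].
rewrite (eqX m1 n1) (eqX m2 n2); apply: laplace_unique => //.
- by move=> y; rewrite lee_fin le_max lexx orbT.
- move=> a a0; have mex : measurable_fun setT (fun y => expeR (- (a%:E * X y))).
    apply: (measurableT_comp measurable_expeR); apply: measurableT_comp => //.
    exact: measurable_funeM.
  rewrite h//; last by move=> y; exact: expeR_ge0.
  rewrite [RHS]h//; last by move=> y; exact: expeR_ge0.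
  have lE (m : {measure set R -> \bar R}) :
      (\int[m]_(y in `[0%R, +oo[) expeR (- (a%:E * X y)) = laplace m a)%E.
    apply: eq_integral => y /set_mem/=; rewrite in_itv/= andbT => y0.
    by rewrite /X max_l.
  by rewrite !lE lap.
- exact: measurable_image_EFin.
Qed.

(** * Laplace functionals of the immigrants *)

Section immigrants.
Context {R : realType}.
Local Notation E := (R * cadlag R)%type.

Definition immigrants (r t : R) (p : E) : R :=
  if r < p.1 <= t then p.2 (t - p.1) else 0.

Lemma immigrants_ge0 r t p : 0 <= immigrants r t p.
Proof. by rewrite /immigrants; case: ifP => // _; exact: path_ge0. Qed.

Lemma measurable_immigrants r t : measurable_fun setT (immigrants r t).
Proof.
apply: measurable_fun_ifT.
- apply: measurable_and; first exact: measurable_fun_ltr.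
  exact: measurable_fun_ler.
- apply: (measurableT_comp measurable_eval (measurable_fun_pair _ _)) => //.
  exact: measurable_funB.
- exact: measurable_cst.
Qed.

Definition past_rectangle (r : R) (B : set E) : Prop :=
  exists u A, [/\ 0 <= u <= r, coordinate_sigma `[0, r - u] A &
    B = `]0%R, u] `*` A].

(* Functionals of the part of the immigrants' paths lived before time [r]. *)
Definition past_functional (r : R) (S : E -> R) : Prop :=
  [/\ measurable_fun setT S, forall p, 0 <= S p,
      forall p, ~~ (0 < p.1 <= r) -> S p = 0 &
      forall s, 0 < s -> s <= r -> adapted `[0, r - s] (fun w => S (s, w))].

Lemma measurable_past_rectangle r B : past_rectangle r B -> measurable B.
Proof.
move=> [u [A [_ FA ->]]]; apply: measurableX => //.
by apply: coordinate_sigma_measurable FA; exact: subset_itv0.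
Qed.

Lemma past_functional0 r : past_functional r (fun=> 0).
Proof. by split => // s _ _; exact: measurable_cst. Qed.

(** On the rectangle []0, u] * A] an immigrant of time $s\le u$ is tested on its path up to $r-u\le
    r-s$, hence within what it has lived by [r]; after [u] the indicator vanishes. *)
Lemma past_functionalD r S a B : past_functional r S -> past_rectangle r B ->
  0 <= a -> past_functional r (fun p => S p + a * \1_B p).
Proof.
move=> [mS S0 Sout Sad] pB a0; have mB := measurable_past_rectangle pB.
have [u [A [/andP[u0 ur] FA BE]]] := pB; split.
- by apply: measurable_funD => //; exact: measurable_funM.
- by move=> p; rewrite addr_ge0// mulr_ge0.
- move=> p pr; rewrite Sout// indicE memNset ?mulr0 ?addr0//.
  rewrite BE => -[/= + _]; rewrite in_itv/= => /andP[h1 h2].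
  by move: pr; rewrite h1 (le_trans h2 ur).
move=> s s0 sr; apply: measurable_funD; first exact: Sad.
apply: measurable_funM => //; have [su|us] := leP s u; last first.
  rewrite (_ : (fun _ => _) = cst 0)//; apply/funext => w.
  by rewrite indicE memNset// BE => -[/=]; rewrite in_itv/= leNgt us andbF.
rewrite (_ : (fun _ => _) = \1_A).
  apply: (@measurable_indic _ (g_sigma_algebraType (@coordinate_events R `[0, r - s])) R setT A).
  apply: coordinate_sigmaS FA.
  by apply: subset_itvl; rewrite bnd_simp lerB.
apply/funext => w; rewrite !indicE; congr (_%:R); congr nat_of_bool.
apply/idP/idP => /set_mem h; apply/mem_set; first by move: h; rewrite BE => -[].
by rewrite BE; split => //=; rewrite in_itv/= s0.
Qed.

End immigrants.

Section poisson_immigration.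
Context {R : realType}.
Local Notation E := (R * cadlag R)%type.
Variables (rho : {measure set R -> \bar R}).
Variable L : {sigma_finite_measure set (cadlag R) -> \bar R}.
Variable mu : {sigma_finite_measure set E -> \bar R}.
Hypothesis hmu : forall f : E -> \bar R, (forall p, 0 <= f p)%E ->
  measurable_fun setT f -> (\int[mu]_p f p = \int[rho]_s \int[L]_w f (s, w))%E.
Variables (v n : R -> R -> R) (good : R -> Prop).
Hypothesis v0 : forall t lambda, 0 <= t -> 0 <= lambda -> 0 <= v t lambda.
Hypothesis hn : forall q lambda, 0 <= q -> 0 <= lambda ->
  (\int[L]_w (1 - expR (- (lambda * w q)))%:E = (n q lambda)%:E)%E.
Hypothesis hmarkov : forall p q lambda (xi : cadlag R -> \bar R),
  0 <= q -> good q -> q <= p -> 0 <= lambda ->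
  (forall w, 0 <= xi w)%E -> adapted `[0, q] xi ->
  (\int[L]_w ((1 - expR (- (lambda * w p)))%:E * xi w) =
   \int[L]_w ((1 - expR (- (v (p - q) lambda * w q)))%:E * xi w))%E.

Let onem (F : E -> R) p : \bar R := (1 - expR (- F p))%:E.

Let onem_ge0 F p : (forall p, 0 <= F p) -> (0 <= onem F p)%E.
Proof. by move=> F0; rewrite lee_fin onem_expRN_ge0. Qed.

Let monem F : measurable_fun setT F -> measurable_fun setT (onem F).
Proof.
move=> mF; apply/measurable_EFinP; apply: measurable_funB => //.
by apply: measurableT_comp => //; exact: measurableT_comp.
Qed.

Let mfib (f : E -> \bar R) : (forall p, 0 <= f p)%E -> measurable_fun setT f ->
  measurable_fun setT (fun s => \int[L]_w f (s, w))%E.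
Proof. by move=> f0 mf; exact: (measurable_fun_fubini_tonelli_F f mf f0). Qed.

Let window_fibre r t lambda s : 0 <= r -> 0 <= lambda ->
  (\int[L]_w onem (fun p => lambda * immigrants r t p)%R (s, w) =
   if (r < s <= t)%R then (n (t - s) lambda)%:E else 0)%E.
Proof.
move=> r0 l0; rewrite /onem /immigrants/=; case: ifPn => [/andP[rs st]|_].
  by rewrite hn// subr_ge0.
by rewrite integral0_eq// => w _; rewrite mulr0 oppr0 expR0 subrr.
Qed.

Lemma integral_window r t lambda : 0 <= r -> 0 <= lambda ->
  (\int[mu]_p onem (fun p => lambda * immigrants r t p)%R p =
   \int[rho]_(s in `]r, t]) (n (t - s) lambda)%:E)%E.
Proof.
move=> r0 l0; rewrite hmu; last 2 first.
- by move=> p; apply: onem_ge0 => q; rewrite mulr_ge0// immigrants_ge0.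
- by apply: monem; apply: measurable_funM => //; exact: measurable_immigrants.
rewrite [RHS]integral_mkcond; apply: eq_integral => s _.
rewrite window_fibre// patchE; case: ifPn => [h|h].
  by rewrite mem_set//= in_itv.
by rewrite memNset//= in_itv/=; exact/negP.
Qed.

Lemma measurable_window r t lambda : 0 <= r -> 0 <= lambda ->
  measurable_fun (`]r, t]%classic : set R) (fun s => (n (t - s) lambda)%:E).
Proof.
move=> r0 l0; apply/(measurable_restrictT _ _).2 => //.
have := @mfib (onem (fun p => lambda * immigrants r t p)%R).
move=> /(_ (fun p => onem_ge0 _ (fun p => mulr_ge0 l0 (immigrants_ge0 r t p)))).
have mi : measurable_fun setT (fun p : E => lambda * immigrants r t p).
  by apply: measurable_funM => //; exact: measurable_immigrants.
move=> /(_ (monem mi)); congr measurable_fun; apply/funext => s.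
rewrite window_fibre// patchE; case: ifPn => [h|h].
  by rewrite mem_set//= in_itv.
by rewrite memNset//= in_itv/=; exact/negP.
Qed.

(** For $s\le r$, the decomposition $1-e^{-(a+S)}=(1-e^{-a})e^{-S}+(1-e^{-S})$ isolates a term to
    which the Markov property at age $r-s$ applies with weight $e^{-S}$. For $s>r$ the functional
    [S] vanishes. *)
Let past_fibre r t lambda S s : 0 <= r -> r <= t -> 0 <= lambda ->
  past_functional r S -> (0 < s -> s <= r -> good (r - s)) ->
  (\int[L]_w onem (fun p => lambda * immigrants 0 t p + S p)%R (s, w) =
   \int[L]_w onem (fun p => v (t - r) lambda * immigrants 0 r p + S p)%R (s, w) +
   if (r < s <= t)%R then (n (t - s) lambda)%:E else 0)%E.
Proof.
move=> r0 rt l0 [mS S0 Sout Sad] gs; rewrite /onem /immigrants/=.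
have [rs|sr] := ltP r s.
  rewrite (le_lt_trans r0 rs)/=; under eq_integral do rewrite Sout ?addr0/= ?leNgt ?rs ?andbF//.
  rewrite [X in (_ = X + _)%E]integral0_eq ?add0e; last first.
    by move=> w _; rewrite Sout/= ?leNgt ?rs ?andbF// mulr0 addr0 oppr0 expR0 subrr.
  have [st|_] := leP s t; first by apply: hn l0; rewrite subr_ge0.
  by rewrite integral0_eq// => w _; rewrite mulr0 oppr0 expR0 subrr.
rewrite /= adde0; have -> : s <= t by exact: le_trans sr rt.
have [s0|s0] := ltP 0 s; last first.
  by apply: eq_integral => w _; rewrite !mulr0.
rewrite /=.
have vl0 : 0 <= v (t - r) lambda by rewrite v0// subr_ge0.
pose xi (w : cadlag R) : \bar R := (expR (- S (s, w)))%:E.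
have axi : adapted `[0, r - s] xi.
  apply/measurable_EFinP; apply: measurableT_comp => //; apply: measurableT_comp => //.
  exact: Sad.
have mxi : measurable_fun setT xi by apply: adapted_measurable axi; exact: subset_itv0.
have xi0 w : (0 <= xi w)%E by rewrite lee_fin expR_ge0.
have mg a q : measurable_fun setT (fun w : cadlag R => ((1 - expR (- (a * w q)))%:E * xi w)%E).
  apply: emeasurable_funM => //; apply/measurable_EFinP.
  exact: measurable_onem_expRNZ (measurable_coordinate q).
have g0 a q (w : cadlag R) : 0 <= a -> (0 <= (1 - expR (- (a * w q)))%:E * xi w)%E.
  by move=> a0; rewrite mule_ge0// lee_fin onem_expRN_ge0// mulr_ge0// path_ge0.
have msx : measurable_fun setT (fun w : cadlag R => (1 - expR (- S (s, w)))%:E).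
  apply/measurable_EFinP; apply: measurable_funB => //.
  by apply/measurable_EFinP; exact: mxi.
have sx0 w : (0 <= (1 - expR (- S (s, w)))%:E)%E by rewrite lee_fin onem_expRN_ge0.
have e : t - s - (r - s) = t - r by ring.
have rs0 : 0 <= r - s by rewrite subr_ge0.
have ts : r - s <= t - s by rewrite lerD2r.
have hm := hmarkov rs0 (gs s0 sr) ts l0 xi0 axi; rewrite {}e in hm.
have split a q : 0 <= a ->
    (\int[L]_w (1 - expR (- (a * w q + S (s, w))))%:E =
     \int[L]_w ((1 - expR (- (a * w q)))%:E * xi w) +
     \int[L]_w (1 - expR (- S (s, w)))%:E)%E.
  move=> a0; rewrite -(ge0_integralD L measurableT (fun w _ => g0 a q w a0) (mg a q)
    (fun w _ => sx0 w) msx).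
  apply: eq_integral => w _; rewrite -EFinM -EFinD opprD expRD; congr (_%:E).
  by ring.
exact: etrans (split lambda (t - s) l0)
  (etrans (congr1 (fun z => z + _)%E hm) (esym (split _ (r - s) vl0))).
Qed.

(** The fibre identity is integrated in [s]. It is only needed for almost every [s], so an uncharged
    time $s=r$, where the age is 0, does no harm. *)
Lemma integral_past r t lambda S : 0 <= r -> r <= t -> 0 <= lambda ->
  past_functional r S -> {ae rho, forall s, 0 < s -> s <= r -> good (r - s)} ->
  (\int[mu]_p onem (fun p => lambda * immigrants 0 t p + S p)%R p =
   \int[mu]_p onem (fun p => v (t - r) lambda * immigrants 0 r p + S p)%R p +
   \int[rho]_(s in `]r, t]) (n (t - s) lambda)%:E)%E.
Proof.
move=> r0 rt l0 pS ae_good; have [mS S0 _ _] := pS.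
have vl0 : 0 <= v (t - r) lambda by rewrite v0// subr_ge0.
have F0 a u p : 0 <= a -> (0 <= onem (fun p => a * immigrants 0 u p + S p)%R p)%E.
  by move=> a0; apply: onem_ge0 => q; rewrite addr_ge0// mulr_ge0// immigrants_ge0.
have mF a u : measurable_fun setT (onem (fun p => a * immigrants 0 u p + S p)%R).
  apply: monem; apply: measurable_funD => //; apply: measurable_funM => //.
  exact: measurable_immigrants.
have W0 s : (`]r, t]%classic : set R) s -> (0 <= (n (t - s) lambda)%:E)%E.
  rewrite /= in_itv/= => /andP[_ st]; rewrite -hn ?subr_ge0//.
  by apply: integral_ge0 => w _; rewrite lee_fin onem_expRN_ge0// mulr_ge0// path_ge0.
rewrite (hmu (fun p => F0 _ t p l0) (mF _ _)) (hmu (fun p => F0 _ r p vl0) (mF _ _)).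
rewrite [X in (_ = _ + X)%E]integral_mkcond.
have mW : measurable_fun setT ((fun s => (n (t - s) lambda)%:E) \_ (`]r, t]%classic : set R)).
  by apply/(measurable_restrictT _ _).1 => //; exact: measurable_window.
have WW0 s : (0 <= ((fun s => (n (t - s) lambda)%:E) \_ (`]r, t]%classic : set R)) s)%E.
  by rewrite patchE; case: ifPn => // /set_mem /W0.
have mf1 := mfib (fun p => F0 _ r p vl0) (mF (v (t - r) lambda) r).
have f10 s : (0 <= \int[L]_w onem (fun p => v (t - r) lambda * immigrants 0 r p + S p)%R (s, w))%E.
  by apply: integral_ge0 => w _; exact: F0.
rewrite -(ge0_integralD rho measurableT (fun s _ => f10 s) mf1 (fun s _ => WW0 s) mW).
apply: (ge0_ae_eq_integral measurableT).
- exact: mfib (fun p => F0 _ t p l0) (mF _ _).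
- exact: emeasurable_funD.
- by move=> s _; apply: integral_ge0 => w _; exact: F0.
- by move=> s _; rewrite adde_ge0.
apply: filterS ae_good => s gs _; rewrite (past_fibre r0 rt l0 pS gs) patchE.
apply: congr1; case: ifPn => [h|h]; first by rewrite mem_set//= in_itv.
by rewrite memNset//= in_itv/=; exact/negP.
Qed.

Context d (Omega : measurableType d) (Pr : probability Omega R).
Variable N : Omega -> {measure set E -> \bar R}.
Hypothesis hN : is_poisson_random_measure Pr mu N.

Lemma window_laplace r t lambda : 0 <= r -> 0 <= lambda ->
  (\int[Pr]_om expeR (- (lambda%:E * \int[N om]_p (immigrants r t p)%:E)) =
   expeR (- \int[rho]_(s in `]r, t]) (n (t - s) lambda)%:E))%E.
Proof.
move=> r0 l0; rewrite -integral_window//.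
rewrite -(campbell hN (F := fun p => lambda * immigrants r t p)).
- apply: eq_integral => om _; congr (expeR (- _)%E).
  rewrite -(ge0_integralZl (N om) measurableT)//.
  + by apply/measurable_EFinP; exact: measurable_immigrants.
  + by move=> p _; rewrite lee_fin immigrants_ge0.
- by move=> p; rewrite mulr_ge0// immigrants_ge0.
- by apply: measurable_funM => //; exact: measurable_immigrants.
Qed.

Lemma past_laplace r t lambda S : 0 <= r -> r <= t -> 0 <= lambda ->
  (\int[rho]_(s in `]r, t]) (n (t - s) lambda)%:E < +oo)%E ->
  past_functional r S -> {ae rho, forall s, 0 < s -> s <= r -> good (r - s)} ->
  (\int[Pr]_om (expeR (- (lambda%:E * \int[N om]_p (immigrants 0 t p)%:E)) *
      expeR (- \int[N om]_p (S p)%:E)) =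
   expeR (- \int[rho]_(s in `]r, t]) (n (t - s) lambda)%:E) *
   \int[Pr]_om (expeR (- ((v (t - r) lambda)%:E * \int[N om]_p (immigrants 0 r p)%:E)) *
      expeR (- \int[N om]_p (S p)%:E)))%E.
Proof.
move=> r0 rt l0 Wfin pS ae_good; have [mS S0 _ _] := pS.
have vl0 : 0 <= v (t - r) lambda by rewrite v0// subr_ge0.
have mi u : measurable_fun setT (fun p : E => (immigrants 0 u p)%:E).
  by apply/measurable_EFinP; exact: measurable_immigrants.
have i0 u p : setT p -> (0 <= (immigrants 0 u p)%:E :> \bar R)%E.
  by move=> _; rewrite lee_fin immigrants_ge0.
have mSE : measurable_fun setT (fun p : E => (S p)%:E) by exact/measurable_EFinP.
have H a u : 0 <= a ->
    (\int[Pr]_om (expeR (- (a%:E * \int[N om]_p (immigrants 0 u p)%:E)) *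
      expeR (- \int[N om]_p (S p)%:E)) =
     expeR (- \int[mu]_p onem (fun p => a * immigrants 0 u p + S p)%R p))%E.
  move=> a0; rewrite -(campbell hN (F := fun p => a * immigrants 0 u p + S p)).
  - apply: eq_integral => om _.
    rewrite -(ge0_integralZl (N om) measurableT (mi u) (i0 u))// -expeRD.
    have ai0 p : setT p -> (0 <= a%:E * (immigrants 0 u p)%:E :> \bar R)%E.
      by move=> Tp; rewrite mule_ge0// i0.
    rewrite -oppeD; last first.
      by rewrite ge0_adde_def// inE integral_ge0// => p _; rewrite lee_fin.
    congr (expeR (- _)%E).
    rewrite -(ge0_integralD (N om) measurableT ai0 _ _ mSE)//.
    + exact: measurable_funeM.
    + by move=> p _; rewrite lee_fin.
  - by move=> p; rewrite addr_ge0// mulr_ge0// immigrants_ge0.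
  - apply: measurable_funD => //; apply: measurable_funM => //.
    exact: measurable_immigrants.
rewrite (H _ t l0) (H _ r vl0) (integral_past r0 rt l0 pS ae_good) -expeRD -oppeD; last first.
  rewrite ge0_adde_def// inE integral_ge0// => [s|p _].
    rewrite /= in_itv/= => /andP[_ st]; rewrite -hn ?subr_ge0//.
    by apply: integral_ge0 => w _; rewrite lee_fin onem_expRN_ge0// mulr_ge0// path_ge0.
  by apply: onem_ge0 => q; rewrite addr_ge0// mulr_ge0// immigrants_ge0.
by rewrite addeC.
Qed.

End poisson_immigration.

(** * Measurability of the immigration process *)

(** For $a>0$, Campbell's formula bounds $\exp(-\mu(1-e^{-aF}))$ by the probability that $N(F)$ is
    finite; as $a$ tends to 0 the left side tends to 1 by domination with $1-e^{-F}$. *)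
Lemma prm_integral_lty d d' (R : realType) (Omega : measurableType d)
    (E : measurableType d') (Pr : probability Omega R)
    (mu : {sigma_finite_measure set E -> \bar R}) (N : Omega -> {measure set E -> \bar R})
    (F : E -> R) :
  is_poisson_random_measure Pr mu N -> (forall x, 0 <= F x) -> measurable_fun setT F ->
  (\int[mu]_x (1 - expR (- F x))%:E < +oo)%E ->
  Pr [set om | (\int[N om]_x (F x)%:E = +oo)%E] = 0%E.
Proof.
move=> hN F0 mF Ffin.
pose a k : R := k.+1%:R^-1.
have a01 k : 0 <= a k <= 1 by rewrite invr_ge0 ler0n/= invf_le1 ?ltr0Sn// ler1n.
pose X om := (\int[N om]_x (F x)%:E)%E.
have mEF : measurable_fun setT (fun x => (F x)%:E : \bar R) by exact/measurable_EFinP.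
have X0 om : (0 <= X om)%E by apply: integral_ge0 => x _; rewrite lee_fin.
have mX : measurable_fun setT X.
  by apply: (measurable_prm_integral hN) => // x; rewrite lee_fin.
have mS : measurable (X @^-1` [set +oo%E]).
  by rewrite -[Y in measurable Y]setTI; apply: mX => //; exact: emeasurable_set1.
have ma k : measurable_fun setT (fun x => (1 - expR (- (a k * F x)))%:E : \bar R).
  by apply/measurable_EFinP; exact: measurable_onem_expRNZ.
have c1 : (\int[mu]_x (1 - expR (- (a k * F x)))%:E)%E @[k --> \oo] --> (0 : \bar R).
  have := @dominated_convergence _ _ _ mu setT measurableT
    (fun k x => (1 - expR (- (a k * F x)))%:E) (cst 0%E) (fun x => (1 - expR (- F x))%:E).
  case.
  - exact: ma.
  - exact: measurable_cst.
  - apply: aeW => x _; apply/fine_cvgP; split; first exact: nearW.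
    rewrite /= -[X in _ --> X](subrr 1) -[X in _ --> (_ - X)]expR0 -[X in expR X]oppr0.
    apply: cvgB; first exact: cvg_cst.
    apply: cvg_expRN; rewrite -[X in _ --> X](mul0r (F x)).
    by apply: cvgM; [exact: cvg_invS|exact: cvg_cst].
  - apply/integrableP; split.
      apply/measurable_EFinP; apply: measurable_funB => //.
      by apply: measurableT_comp => //; exact: measurableT_comp.
    by under eq_integral do rewrite gee0_abs ?lee_fin ?onem_expRN_ge0//.
  - apply: aeW => x k _; have /andP[ak0 ak1] := a01 k.
    rewrite gee0_abs ?lee_fin ?onem_expRN_ge0 ?mulr_ge0// lerD2l lerN2 ler_expR lerN2.
    by rewrite ler_piMl.
  by move=> _ _ /=; rewrite integral0.
have c2 : expeR (- \int[mu]_x (1 - expR (- (a k * F x)))%:E)%E @[k --> \oo] --> (1 : \bar R)%E.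
  by rewrite -expeR0 -[X in expeR X]oppe0; apply: cvg_expeRN.
have ub k : (expeR (- \int[mu]_x (1 - expR (- (a k * F x)))%:E) <=
    Pr (~` (X @^-1` [set +oo%E])))%E.
  have /andP[ak0 ak1] := a01 k.
  rewrite -(campbell hN (F := fun x => a k * F x)); last 2 first.
  - by move=> x; rewrite mulr_ge0.
  - exact: measurable_funM.
  rewrite -[in leRHS](setIT (~` _)) -(integral_indic Pr measurableT (measurableC mS)).
  apply: (ge0_le_integral Pr measurableT).
  - by move=> om _; exact: expeR_ge0.
  - apply: (measurableT_comp measurable_expeR); apply: measurableT_comp => //.
    apply: (measurable_prm_integral hN); first by move=> x; rewrite lee_fin mulr_ge0.
    by apply/measurable_EFinP; exact: measurable_funM.
  - by apply/measurable_EFinP; apply: measurable_indic; exact: measurableC.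
  - move=> om _; have -> : (\int[N om]_x (a k * F x)%:E = (a k)%:E * X om)%E.
      by rewrite -(ge0_integralZl (N om) measurableT mEF)// => x _; rewrite lee_fin.
    rewrite indicE; case: (boolP (om \in _)) => [_|/negP h].
      by rewrite expeRN_le1// mule_ge0.
    have -> : X om = +oo%E.
      by apply: contrapT => Xom; apply: h; apply/mem_set.
    by rewrite gt0_muley// lte_fin invr_gt0.
have PC1 : Pr (~` (X @^-1` [set +oo%E])) = 1%E.
  apply/eqP; rewrite eq_le probability_le1//=; last exact: measurableC.
  by apply: (cvge_to_le c2); exact: nearW.
apply: (@fin_addeI _ 1%E) => //; rewrite adde0.
exact: (etrans (etrans (congr1 (fun z => z + _)%E (esym PC1)) (addeC _ _))
  (etrans (esym (measureTC Pr mS)) (probability_setT Pr))).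
Qed.

Section observable.
Context {R : realType} d (Omega : measurableType d) (Pr : probability Omega R).
Local Notation E := (R * cadlag R)%type.
Variable mu : {sigma_finite_measure set E -> \bar R}.
Variable N : Omega -> {measure set E -> \bar R}.
Hypothesis hN : is_poisson_random_measure Pr mu N.
Variable t : R.

Definition observable d' (T : measurableType d') (f : Omega -> T) :=
  measurable_fun setT (f : g_sigma_algebraType (immigration_filtration N t `|`
     [set A | measurable A /\ Pr A = 0%E]) -> T).

Lemma immigration_filtration_measurable : immigration_filtration N t `<=` measurable.
Proof.
apply: smallest_sub; first exact: sigma_algebra_measurable.
move=> _ [u [A [C [_ FA mC ->]]]].
have mA : measurable A by apply: coordinate_sigma_measurable FA; exact: subset_itv0.
have mB : measurable (`]0%R, u] `*` A : set E) by exact: measurableX.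
rewrite -[X in measurable X]setTI; exact: (measurable_prm hN mB).
Qed.

Lemma augmented_measurable : augmented Pr (immigration_filtration N) t `<=` measurable.
Proof.
apply: smallest_sub; first exact: sigma_algebra_measurable.
by move=> A [/immigration_filtration_measurable|[]].
Qed.

Lemma observable_measurable d' (T : measurableType d') (f : Omega -> T) :
  observable f -> measurable_fun setT f.
Proof. by move=> mf _ B mB; apply: augmented_measurable; exact: mf. Qed.

Lemma observable_ae d' (T : measurableType d') (f g : Omega -> T) (Z : set Omega) :
  observable f -> measurable_fun setT g -> measurable Z -> Pr Z = 0%E ->
  (forall om, ~ Z om -> g om = f om) -> observable g.
Proof.
move=> mf mg mZ PZ fg _ B mB; rewrite setTI.
rewrite (_ : g @^-1` B = (f @^-1` B `\` Z) `|` (g @^-1` B `&` Z)).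
  have mgB : measurable (g @^-1` B) by rewrite -[X in measurable X]setTI; exact: mg.
  apply: measurableU; first apply: measurableD.
  - by rewrite -[X in measurable X]setTI; exact: mf.
  - by apply: sub_sigma_algebra; right.
  - apply: sub_sigma_algebra; right; split; first exact: measurableI.
    by apply: (subset_measure0 (measurableI _ _ mgB mZ) mZ) PZ; exact: subIsetr.
apply/seteqP; split => om.
  move=> /= gB; have [Zom|nZ] := pselect (Z om); first by right.
  by left; split => //=; rewrite -fg.
by move=> [[/= fB nZ]|[]//]; rewrite fg.
Qed.

Lemma observable_count B : past_rectangle t B -> observable (fun om => N om B).
Proof.
move=> [u [A [ut FA ->]]] _ C mC; rewrite setTI.
by apply: sub_sigma_algebra; left; apply: sub_sigma_algebra; exists u, A, C.
Qed.

Local Notation pastT := (g_sigma_algebraType (@past_rectangle R t)).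

Lemma past_rectangleI : setI_closed (@past_rectangle R t).
Proof.
move=> _ _ [u [A [/andP[u0 ut] FA ->]]] [u' [A' [/andP[u'0 u't] FA' ->]]].
exists (Num.min u u'), (A `&` A'); split.
- by rewrite le_min u0 u'0 ge_min ut.
- have h x : Num.min u u' <= x -> coordinate_sigma `[0, t - x] `<=`
      @coordinate_sigma R `[0, t - Num.min u u'].
    by move=> ux; apply: coordinate_sigmaS; apply: subset_itvl; rewrite bnd_simp lerB.
  have [_ _ _] := @sigma_algebra_measurable _ (g_sigma_algebraType (@coordinate_events R `[0, t - Num.min u u'])).
  apply: (@measurableI _ (g_sigma_algebraType (@coordinate_events R `[0, t - Num.min u u']))).
    by apply: h FA; rewrite ge_min lexx.
  by apply: h FA'; rewrite ge_min lexx orbT.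
apply/seteqP; split => -[s w] /=.
  by rewrite !in_itv/= le_min => -[[/andP[-> ->] Aw] [/andP[_ ->] A'w]].
by rewrite !in_itv/= le_min => -[/andP[-> /andP[-> ->]] [Aw A'w]].
Qed.

Lemma past_measurable (B : set pastT) : measurable B -> @measurable _ E B.
Proof.
move: B; apply: smallest_sub; first exact: sigma_algebra_measurable.
exact: measurable_past_rectangle.
Qed.

Lemma past_measurable_fun d' (T : measurableType d') (f : E -> T) :
  measurable_fun setT (f : pastT -> T) -> measurable_fun setT f.
Proof. by move=> mf _ B mB; apply: past_measurable; exact: mf. Qed.

Section finite_rectangle.
Variable B0 : set E.
Hypothesis pB0 : past_rectangle t B0.
Hypothesis fB0 : (mu B0 < +oo)%E.

Let mB0 := measurable_past_rectangle pB0.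

Lemma count_lty : Pr [set om | N om B0 = +oo%E] = 0%E.
Proof.
have := @prm_integral_lty _ _ _ _ _ Pr mu N (\1_B0) hN (fun x => ler0n _ _)
  (measurable_indic mB0).
have -> : [set om | (\int[N om]_x (\1_B0 x)%:E)%E = +oo%E] = [set om | N om B0 = +oo%E].
  by apply/seteqP; split => om /=; rewrite integral_indic// setIT.
apply; apply: le_lt_trans fB0; rewrite -[in leRHS](setIT B0) -(integral_indic mu measurableT mB0).
apply: (ge0_le_integral mu measurableT).
- by move=> x _; rewrite lee_fin onem_expRN_ge0.
- apply/measurable_EFinP; apply: measurable_funB => //.
  by apply: measurableT_comp => //; exact: measurableT_comp.
- by apply/measurable_EFinP; exact: measurable_indic.
- move=> x _; rewrite lee_fin lerBlDr -lerBlDl.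
  by have := expR_ge1Dx (- \1_B0 x : R).
Qed.

(** A Dynkin class argument. The count of a complement is a difference of counts, which makes sense
    off the null event where [N om B0] is infinite; this null event belongs to the augmented
    sigma-algebra. *)
Lemma observable_countI (B : set E) : <<s @past_rectangle R t >> B ->
  observable (fun om => N om (B `&` B0)).
Proof.
move: B; apply: (@dynkin_induction _ pastT (@past_rectangle R t)
  (fun B => observable (fun om => N om (B `&` B0)))) => //.
- exact: past_rectangleI.
- by rewrite setTI; exact: observable_count.
- by move=> B pB; apply: observable_count; exact: (past_rectangleI pB pB0).
- move=> B /past_measurable mB oB.
  have mBC : measurable (~` B : set E) by exact: measurableC.
  have mZ : measurable [set om | N om B0 = +oo%E].
    have := measurable_prm hN mB0 measurableT (emeasurable_set1 +oo%E).
    by rewrite setTI.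
  apply: (observable_ae (f := fun om => (N om B0 - N om (B `&` B0))%E) _ _ mZ count_lty).
  - by apply: emeasurable_funB => //; exact: observable_count.
  - exact: (measurable_prm hN (measurableI _ _ mBC mB0)).
  move=> om /= Nfin; have mI := measurableI _ _ mB mB0.
  have Nf : N om (B `&` B0) \is a fin_num.
    rewrite ge0_fin_numE//; apply: (@le_lt_trans _ _ (N om B0)).
      by apply: le_measure; [exact/mem_set|exact/mem_set|exact: subIsetr].
    by rewrite ltey; apply/eqP.
  rewrite [in RHS](_ : B0 = (B `&` B0) `|` (~` B `&` B0)).
    rewrite measureU//; last 2 first.
    - exact: measurableI.
    - by rewrite setIACA setICr set0I.
    by rewrite -setIUl setUv setTI addeAC subee// add0e.
  by rewrite -setIUl setUv setTI.
- move=> B mB tB oB.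
  have mBE k : @measurable _ E (B k) by exact: past_measurable.
  rewrite (_ : (fun _ => _) = (fun om => \sum_(k <oo) N om (B k `&` B0))%E).
    by apply: ge0_emeasurable_sum => // k _; exact: oB.
  apply/funext => om; rewrite setI_bigcupl measure_semi_bigcup//.
  - by move=> k; exact: measurableI.
  - exact: trivIset_setIr.
  - by apply: bigcupT_measurable => k; exact: measurableI.
Qed.

Lemma observable_integral (G : E -> \bar R) : (forall p, 0 <= G p)%E ->
  measurable_fun setT (G : pastT -> \bar R) ->
  observable (fun om => \int[N om]_(p in B0) G p)%E.
Proof.
move: G; apply: (@ge0_measurable_ind _ pastT R
  (fun G => observable (fun om => \int[N om]_(p in B0) G p)%E)).
- move=> A mA; have mAE := past_measurable mA.
  under [X in observable X]eq_fun do rewrite integral_indic//.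
  exact: observable_countI.
- move=> k f k0 mf f0 of_.
  have mfE : measurable_fun B0 f by apply: measurable_funTS; exact: past_measurable_fun.
  rewrite (_ : (fun _ => _) = (fun om => k%:E * \int[N om]_(p in B0) f p)%E).
    exact: measurable_funeM.
  by apply/funext => om; exact: (ge0_integralZl (N om) mB0 mfE (fun p _ => f0 p)).
- move=> f g mf f0 mg g0 of_ og.
  have mfE : measurable_fun B0 f by apply: measurable_funTS; exact: past_measurable_fun.
  have mgE : measurable_fun B0 g by apply: measurable_funTS; exact: past_measurable_fun.
  rewrite (_ : (fun _ => _) = (fun om => \int[N om]_(p in B0) f p +
      \int[N om]_(p in B0) g p)%E).
    exact: emeasurable_funD.
  apply/funext => om.
  exact: (ge0_integralD (N om) mB0 (fun p _ => f0 p) mfE (fun p _ => g0 p) mgE).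
- move=> f mf f0 ndf of_.
  have mfE k : measurable_fun B0 (f k).
    by apply: measurable_funTS; exact: past_measurable_fun.
  (* The increasing limit is written as an upper limit, whose measurability needs no convergence
     hypothesis. *)
  rewrite (_ : (fun _ => _) = (fun om => limn_esup (fun k => \int[N om]_(p in B0) f k p)%E)).
    exact: measurable_fun_limn_esup.
  apply/funext => om.
  rewrite (monotone_convergence (N om) mB0 mfE (fun k p _ => f0 k p) (fun p _ => ndf p)).
  rewrite is_cvg_limn_esupE//; apply: ereal_nondecreasing_is_cvgn => k1 k2 k12.
  by apply: (ge0_le_integral (N om) mB0) => // p _; exact: ndf.
Qed.

End finite_rectangle.

(** The cover is made disjoint by [seqDU], and each piece is integrated inside the finite rectangle
    that contains it. *)
Lemma observable_integral_cover (B : (set E)^nat) (G : E -> \bar R) :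
  (forall k, past_rectangle t (B k)) -> (forall k, mu (B k) < +oo)%E ->
  (forall p, 0 <= G p)%E -> measurable_fun setT (G : pastT -> \bar R) ->
  (forall p, ~ (\bigcup_k B k) p -> G p = 0%E) ->
  observable (fun om => \int[N om]_p G p)%E.
Proof.
move=> pB fB G0 mG Gout.
have mB k := measurable_past_rectangle (pB k).
have mBp k : @measurable _ pastT (B k) by apply: sub_sigma_algebra; exact: pB.
have mDp k : @measurable _ pastT (seqDU B k) by exact: seqDU_measurable.
have mGE := past_measurable_fun mG.
have mDG k : measurable_fun setT ((G \_ (seqDU B k)) : pastT -> \bar R).
  by apply/(measurable_restrictT _ _).1 => //; exact: measurable_funTS.
have DG0 k p : (0 <= (G \_ (seqDU B k)) p)%E by rewrite patchE; case: ifP.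
rewrite (_ : (fun _ => _) = (fun om => \sum_(k <oo) \int[N om]_(p in B k) (G \_ (seqDU B k)) p)%E).
  apply: ge0_emeasurable_sum => [k om _ _|k _]; first by apply: integral_ge0 => p _.
  exact: (observable_integral (pB k) (fB k) (DG0 k) (mDG k)).
apply/funext => om; transitivity (\int[N om]_(p in \bigcup_k seqDU B k) G p)%E.
  rewrite -seqDU_bigcup_eq [RHS]integral_mkcond; apply: eq_integral => p _.
  by rewrite patchE; case: ifPn => // /negP h; apply: Gout => h'; apply: h; exact/mem_set.
rewrite ge0_integral_bigcup//.
- apply: eq_eseriesr => k _; rewrite [LHS]integral_mkcond [RHS]integral_mkcond.
  apply: eq_integral => p _; rewrite !patchE; case: ifPn => [/set_mem pD|]; last by case: ifP.
  by rewrite mem_set//; exact: subDsetl pD.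
- by move=> k; exact: past_measurable.
- exact: measurable_funTS.
Qed.

End observable.

Lemma nceil_eq (R : realType) (x : R) j : 0 < x -> (nceil x == j) = (j%:R - 1 < x <= j%:R).
Proof.
move=> x0; have /andP[c1 c2] := nceil_itv x0; apply/eqP/andP => [<-//|[j1 j2]].
have h1 : (nceil x < j.+1)%N.
  by rewrite -(ltr_nat R) -[ltRHS]natr1 -ltrBlDr; exact: lt_le_trans c1 j2.
have h2 : (j < (nceil x).+1)%N.
  by rewrite -(ltr_nat R) -[ltRHS]natr1 -ltrBlDr; exact: lt_le_trans j1 c2.
by apply/eqP; rewrite eqn_leq; apply/andP; split; rewrite -ltnS.
Qed.

(** * Reading the past of the immigrants on a grid *)

Section past_grid.
Context {R : realType}.
Local Notation E := (R * cadlag R)%type.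
Variable t : R.
Hypothesis t0 : 0 <= t.
Local Notation pastT := (g_sigma_algebraType (@past_rectangle R t)).

(* Reads the path at the end of the grid cell of [s], hence at a time not
   exceeding [t - s]. *)
Definition past_grid n (p : E) : R :=
  if 0 < p.1 <= t then p.2 (t - Num.min t (ugrid n p.1)) else 0.

Lemma past_grid_ge0 n p : 0 <= past_grid n p.
Proof. by rewrite /past_grid; case: ifP => // _; exact: path_ge0. Qed.

Lemma past_rectangle_coordinate u (B : set R) : 0 <= u <= t -> measurable B ->
  past_rectangle t (`]0, u] `*` [set w : cadlag R | B (w (t - u))]).
Proof.
move=> /andP[u0 ut] mB; exists u, [set w : cadlag R | B (w (t - u))]; split => //.
  by rewrite u0.
apply: sub_sigma_algebra; exists (t - u), B; split => //.
by rewrite /= in_itv/= lexx subr_ge0 ut.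
Qed.

Let cell n j : R := Num.min t (j%:R / n.+1%:R).

Let cell_itv n j : 0 <= cell n j <= t.
Proof. by rewrite /cell ge_min lexx/= le_min t0/= divr_ge0. Qed.

Lemma measurable_past_grid n : measurable_fun setT (past_grid n : pastT -> R).
Proof.
(* The index 0 is reserved for immigrants outside []0, t]]; inside, the ceiling is at least 1. *)
pose k (p : pastT) : nat := if 0 < p.1 <= t then nceil (n.+1%:R * p.1) else 0%N.
pose X j (p : pastT) : R := if j is j'.+1 then p.2 (t - cell n j) else 0.
have k_gt0 (p : pastT) : 0 < p.1 -> (0 < nceil (n.+1%:R * p.1))%N.
  move=> p0; have np0 : 0 < n.+1%:R * p.1 by rewrite mulr_gt0.
  by have /andP[_] := nceil_itv np0; rewrite lt0n; case: (nceil _) => // /(lt_le_trans np0); rewrite ltxx.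
rewrite (_ : past_grid n = fun p => X (k p) p); last first.
  apply/funext => p; rewrite /past_grid /k; case: ifPn => // /andP[p0 _].
  by have := k_gt0 p p0; rewrite /X /cell /ugrid; case: (nceil _).
apply: measurable_fun_selector => -[|j] B mB.
  apply: measurableI; last first.
    by rewrite -[X in measurable X]setTI; exact: (@measurable_cst _ _ pastT R setT 0).
  rewrite (_ : k @^-1` _ = ~` (`]0, t] `*` [set w : cadlag R | setT (w (t - t))])).
    apply: measurableC; apply: sub_sigma_algebra.
    by apply: past_rectangle_coordinate => //; rewrite t0 lexx.
  apply/seteqP; split => p /=; rewrite /k in_itv/=.
    case: ifPn => [/andP[p0 _]|/negP h _ [h' _]//].
    by have := k_gt0 p p0; case: (nceil _).
  by case: ifPn => // h; case.
have [[c0 ct] [c0' ct']] := (andP (cell_itv n j), andP (cell_itv n j.+1)).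
pose A := [set w : cadlag R | B (w (t - cell n j.+1))].
have ccS : cell n j <= cell n j.+1.
  rewrite /cell le_min ge_min lexx/= ge_min; apply/orP; right.
  by rewrite ler_pM2r ?invr_gt0// ler_nat.
(* On one cell the path is read at [t - cell n j.+1], so the trace is a difference of two rectangles
   over the same [A]; the smaller rectangle may use [A] because it allows longer observation. *)
rewrite (_ : _ `&` _ = (`]0, cell n j.+1] `*` A) `\` (`]0, cell n j] `*` A)).
  apply: (@measurableD _ pastT); apply: sub_sigma_algebra.
    by apply: past_rectangle_coordinate => //; rewrite c0'.
  exists (cell n j), A; split => //.
  apply: (@coordinate_sigmaS _ `[0, t - cell n j.+1]).
    by apply: subset_itvl; rewrite bnd_simp lerB.
  apply: sub_sigma_algebra; exists (t - cell n j.+1), B; split => //.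
  by rewrite /= in_itv/= lexx subr_ge0 ct'.
have kE (p : pastT) : (k p = j.+1) <-> (0 < p.1 /\ cell n j < p.1 <= cell n j.+1).
  rewrite /k /cell le_min gt_min.
  have n0 : (0 : R) < n.+1%:R by [].
  have [p0|p0]/= := ltP 0 p.1; last by split => // -[].
  have h : (nceil (n.+1%:R * p.1) == j.+1) = (j%:R / n.+1%:R < p.1 <= j.+1%:R / n.+1%:R).
    rewrite nceil_eq ?mulr_gt0// -natr1 addrK natr1.
    by rewrite ltr_pdivrMr// ler_pdivlMr// (mulrC p.1).
  have [pt|pt]/= := leP p.1 t; last by split => // -[].
  by rewrite -h; split => [/eqP ->//|[_ /eqP]].
apply/seteqP; split => -[s w] /=.
  move=> [/kE[/= s0 /andP[cs sc]] Bw]; split; first by rewrite in_itv/= s0 sc.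
  by rewrite in_itv/= s0/= leNgt cs => -[].
rewrite !in_itv/= => -[[/andP[s0 sc] Aw] h]; split => //; apply/kE; split => //=.
by rewrite sc andbT ltNge; apply/negP => sc'; apply: h; rewrite s0.
Qed.

(* A limsup inside the integral: the integrals of [past_grid n] need not
   converge. *)
Definition past_limit (p : E) : \bar R := limn_esup (fun n => (past_grid n p)%:E).

Lemma measurable_past_limit : measurable_fun setT (past_limit : pastT -> \bar R).
Proof.
apply: measurable_fun_limn_esup => n; apply/measurable_EFinP.
exact: measurable_past_grid.
Qed.

Lemma past_limitE p (x : R) : past_grid n p @[n --> \oo] --> x -> past_limit p = x%:E.
Proof.
move=> cx; have c : (past_grid n p)%:E @[n --> \oo] --> x%:E.
  by apply/fine_cvgP; split; first exact: nearW.
by rewrite /past_limit is_cvg_limn_esupE; [exact/cvg_lim|apply/cvg_ex; eexists; exact: c].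
Qed.

Lemma past_limit_ge0 p : (0 <= past_limit p)%E.
Proof.
rewrite /past_limit limn_esup_lim; apply: lime_ge; first exact: is_cvg_esups.
apply: nearW => n; apply: (@le_trans _ _ (past_grid n p)%:E).
  by rewrite lee_fin past_grid_ge0.
by apply: ereal_sup_ubound; exists n => /=.
Qed.

(* A jump of [w] at [t - s] is not seen by the grid, which looks at the path
   before [t - s]. *)
Lemma past_limit_immigrants p :
  (0 < p.1 -> p.1 < t -> jump_gap (t - p.1) p.2 = 0%E) ->
  past_limit p = (immigrants 0 t p)%:E.
Proof.
case: p => s w /= hj; apply: past_limitE; rewrite /past_grid /immigrants/=.
case: ifPn => [/andP[s0 st]|_]; last exact: cvg_cst.
have cu : Num.min t (ugrid n s) @[n --> \oo] --> s.
  rewrite -[X in _ --> X](min_r st).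
  apply: (squeeze_cvgr (f := fun=> s) (h := fun n => ugrid n s)).
  - by apply: nearW => n; rewrite le_min st ugrid_ge// ge_min lexx orbT.
  - by rewrite min_r//; exact: cvg_cst.
  - by rewrite min_r//; exact: cvg_ugrid.
move: st; rewrite le_eqVlt => /orP[/eqP ts|st].
  rewrite -ts (_ : (fun _ => _) = cst (w (s - s))); first exact: cvg_cst.
  by apply/funext => n; rewrite min_l// ugrid_ge.
apply: cvg_left_continuous.
- by apply: jump_gap0_cvg; [rewrite subr_gt0|exact: hj].
- by move=> n; rewrite lerB// le_min (ltW st) ugrid_ge.
- by apply: cvgB => //; exact: cvg_cst.
Qed.

(** Where [past_limit] is nonzero, some grid reading exceeds some $1/(k+1)$. The triple of grid
    size, cell and level is coded by one integer to get a sequence of rectangles, of finite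
    intensity by [path_level_lty]. *)
Definition past_cover (m : nat) : set E :=
  let '(n, j, k) := odflt (0, 0, 0)%N (choice.unpickle m) in
  `]0%R, cell n j] `*` [set w : cadlag R | k.+1%:R^-1 < w (t - cell n j)].

Lemma past_cover_rectangle m : exists u (e : R),
  [/\ 0 <= u <= t, 0 < e & past_cover m = `]0, u] `*` [set w : cadlag R | e < w (t - u)]].
Proof.
rewrite /past_cover; case: (odflt _ _) => [[n j] k].
by exists (cell n j), k.+1%:R^-1; split.
Qed.

Lemma past_limit_out p : ~ (\bigcup_m past_cover m) p -> past_limit p = 0%E.
Proof.
case: p => s w pB; apply: past_limitE.
rewrite (_ : (fun _ => _) = cst 0); first exact: cvg_cst.
apply/funext => n; rewrite /past_grid/=; case: ifPn => // /andP[s0 st].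
apply: contrapT => /eqP w0; apply: pB.
have {}w0 : 0 < w (t - Num.min t (ugrid n s)) by rewrite lt_def w0 path_ge0.
have [k wk] := ltr_add_invr w0; rewrite add0r in wk.
exists (choice.pickle (n, nceil (n.+1%:R * s), k)) => //.
rewrite /past_cover choice.pickleK/=; split => //=.
by rewrite in_itv/= s0/= /cell le_min st/=; exact: ugrid_ge.
Qed.

End past_grid.

Lemma measurable_neqe d (T : measurableType d) (R : realType) (f g : T -> \bar R) :
  measurable_fun setT f -> measurable_fun setT g -> measurable [set x | f x != g x].
Proof.
move=> mf mg; have mfalse : measurable [set false] by [].
have := measurable_fun_eqe mf mg measurableT mfalse; rewrite setTI.
by congr measurable; apply/seteqP; split => x /=; [move=> ->|move/negbTE].
Qed.

Lemma measurable_path_level (R : realType) (q e : R) :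
  measurable [set w : cadlag R | e < w q].
Proof.
have := measurable_coordinate q measurableT (measurable_itv `]e, +oo[); rewrite setTI.
by congr measurable; apply/seteqP; split => w /=; rewrite in_itv/= andbT.
Qed.

Section immigration_observable.
Context {R : realType}.
Local Notation E := (R * cadlag R)%type.
Variables (rho : {measure set R -> \bar R}).
Hypothesis hrho1 : forall t : R, 0 < t -> (rho `]0%R, t]%classic < +oo)%E.
Variable L : {sigma_finite_measure set (cadlag R) -> \bar R}.
Variable mu : {sigma_finite_measure set E -> \bar R}.
Hypothesis hmu : forall f : E -> \bar R, (forall p, 0 <= f p)%E ->
  measurable_fun setT f -> (\int[mu]_p f p = \int[rho]_s \int[L]_w f (s, w))%E.
Hypothesis hn : forall q, 0 <= q -> (\int[L]_w (1 - expR (- (1 * w q)))%:E < +oo)%E.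
Hypothesis hjump : forall u, 0 < u -> (\int[L]_w jump_gap u w = 0)%E.

Lemma measure_rectangle (A : set R) (B : set (cadlag R)) : measurable A -> measurable B ->
  mu (A `*` B) = (rho A * L B)%E.
Proof.
move=> mA mB; have mAB : measurable (A `*` B : set E) by exact: measurableX.
rewrite -[in LHS](setIT (A `*` B)) -(integral_indic mu measurableT mAB).
have mi : measurable_fun setT (fun p : E => (\1_(A `*` B) p)%:E : \bar R).
  by apply/measurable_EFinP; exact: measurable_indic.
rewrite (hmu (f := fun p => (\1_(A `*` B) p)%:E) _ mi); last by move=> p; rewrite lee_fin.
transitivity (\int[rho]_s ((\1_A s)%:E * L B))%E.
  apply: eq_integral => s _.
  transitivity (\int[L]_w ((\1_A s)%:E * (\1_B w)%:E))%E.
    by apply: eq_integral => w _; rewrite -EFinM !indicE in_setX/= -natrM mulnb.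
  rewrite ge0_integralZl//; last exact/measurable_EFinP/measurable_indic.
  by rewrite integral_indic// setIT.
rewrite ge0_integralZr//; last exact/measurable_EFinP/measurable_indic.
by rewrite integral_indic// setIT.
Qed.

(** Markov's inequality for $1-e^{-w(q)}$, which is at least $1-e^{-e}$ on the level set. *)
Lemma path_level_lty (q e : R) : 0 <= q -> 0 < e -> (L [set w : cadlag R | (e < w q)%R] < +oo)%E.
Proof.
move=> q0 e0; have mA := measurable_path_level q e.
have c0 : 0 < 1 - expR (- e) by rewrite subr_gt0 expR_lt1 oppr_lt0.
have h : ((1 - expR (- e))%:E * L [set w : cadlag R | (e < w q)%R] < +oo)%E.
  apply: le_lt_trans (hn q0); rewrite -(integral_cst L mA) [leLHS]integral_mkcond.
  apply: (ge0_le_integral L measurableT).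
  - by move=> w _; rewrite patchE; case: ifP => // _; rewrite lee_fin ltW.
  - by apply/(measurable_restrictT _ _).1 => //; exact: measurable_cst.
  - by apply/measurable_EFinP; exact: measurable_onem_expRNZ (measurable_coordinate q).
  - move=> w _; rewrite patchE mul1r; case: ifPn => [/set_mem/= ew|_].
      by rewrite lee_fin lerD2l lerN2 ler_expR lerN2 ltW.
    by rewrite lee_fin onem_expRN_ge0// path_ge0.
rewrite ltey; apply/eqP => Linf; by move: h; rewrite Linf gt0_muley ?lte_fin.
Qed.

Lemma past_cover_lty t m : 0 <= t -> (mu (past_cover t m) < +oo)%E.
Proof.
move=> t0; have [u [e [/andP[u0 ut] e0 ->]]] := past_cover_rectangle t0 m.
have mA := measurable_path_level (t - u) e.
rewrite measure_rectangle//; apply: lte_mul_pinfty => //; last first.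
  by apply: path_level_lty => //; rewrite subr_ge0.
rewrite ge0_fin_numE//; move: u0; rewrite le_eqVlt => /orP[/eqP <-|]; last exact: hrho1.
by rewrite set_itv_ge ?bnd_simp ?ltxx// measure0.
Qed.

(** For $0<s<t$ the two functions can differ only on paths jumping at time $t-s$, a null set for
    [L]. For other [s], in particular [s = t], they agree on every path. *)
Lemma past_limit_ae t : 0 <= t ->
  mu [set p | past_limit t p != (immigrants 0 t p)%:E] = 0%E.
Proof.
move=> t0; have mpl : measurable_fun setT (past_limit t).
  by apply: (@past_measurable_fun _ t); exact: measurable_past_limit.
have mim : measurable_fun setT (fun p : E => (immigrants 0 t p)%:E).
  by apply/measurable_EFinP; exact: measurable_immigrants.
pose M := [set p : E | past_limit t p != (immigrants 0 t p)%:E]; rewrite -/M.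
have mM : measurable M by exact: measurable_neqe.
rewrite -[in LHS](setIT M) -(integral_indic mu measurableT mM).
have mi : measurable_fun setT (fun p : E => (\1_M p)%:E : \bar R).
  by apply/measurable_EFinP; exact: measurable_indic.
rewrite (hmu (f := fun p => (\1_M p)%:E) _ mi); last by move=> p; rewrite lee_fin.
rewrite integral0_eq// => s _; have [/andP[s0 st]|nst] := boolP (0 < s < t); last first.
  rewrite integral0_eq// => w _; rewrite indicE memNset// /M/= => /eqP; apply.
  apply: past_limit_immigrants => //= s0 st.
  by move: nst; rewrite s0 st.
have mj := measurable_jump_gap (measurable_cst (t - s)) (@measurable_id _ (cadlag R) setT).
have ts0 : 0 < t - s by rewrite subr_gt0.
have H : (\int[L]_w `|jump_gap (t - s) w| = 0)%E.
  rewrite -[RHS](hjump ts0); apply: eq_integral => w _; rewrite gee0_abs//.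
  exact: jump_gap_ge0.
have ae0 := (ae_eq_integral_abs L measurableT mj).1 H.
rewrite -[RHS](integral0 L setT); apply: ge0_ae_eq_integral => //.
  by apply: (measurableT_comp mi); exact: measurable_fun_pair.
apply: filterS ae0 => w /(_ I) /= hw _; rewrite indicE memNset// /M/= => /eqP; apply.
exact: past_limit_immigrants.
Qed.

Context d (Omega : measurableType d) (Pr : probability Omega R).
Variable N : Omega -> {measure set E -> \bar R}.
Hypothesis hN : is_poisson_random_measure Pr mu N.

(** The integral of [past_limit] is observable. The set where it differs from [immigrants 0 t] has
    intensity 0, hence almost surely carries no atom: the Poisson weight at 0 is 1. *)
Lemma observable_immigrants t : 0 <= t ->
  observable Pr N t (fun om => \int[N om]_p (immigrants 0 t p)%:E)%E.
Proof.
move=> t0; set M := [set p | past_limit t p != (immigrants 0 t p)%:E].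
have mpl : measurable_fun setT (past_limit t).
  by apply: (@past_measurable_fun _ t); exact: measurable_past_limit.
have mim : measurable_fun setT (fun p : E => (immigrants 0 t p)%:E).
  by apply/measurable_EFinP; exact: measurable_immigrants.
have mM : measurable M by exact: measurable_neqe.
have muM : mu M = 0%E by exact: past_limit_ae.
have mN0 : measurable [set om | N om M = 0%E].
  have := measurable_prm hN mM measurableT (emeasurable_set1 0%E).
  by rewrite setTI.
have PN0 : Pr [set om | N om M = 0%E] = 1%E.
  have [_ + _] := hN => /(_ M 0%N mM); rewrite muM ltry => /(_ isT) ->.
  by rewrite expr0 fact0 divr1 mul1r oppr0 expR0.
have PN1 : Pr (~` [set om | N om M = 0%E]) = 0%E.
  apply: (@fin_addeI _ 1%E) => //; rewrite adde0.
  exact: (etrans (etrans (congr1 (fun z => z + _)%E (esym PN0)) (esym (measureTC Pr mN0)))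
    (probability_setT Pr)).
apply: (observable_ae _ _ (measurableC mN0) PN1).
- apply: (@observable_integral_cover _ _ _ _ _ _ hN t (past_cover t) (past_limit t)).
  + move=> m; have [u [e [ut e0 ->]]] := past_cover_rectangle t0 m.
    have := @past_rectangle_coordinate R t u `]e, +oo[ ut (measurable_itv _).
    congr (past_rectangle _ (_ `*` _)); apply/seteqP; split => w /=; by rewrite in_itv/= andbT.
  + by move=> m; exact: past_cover_lty.
  + exact: past_limit_ge0.
  + exact: measurable_past_limit.
  + exact: past_limit_out.
- apply: (measurable_prm_integral hN) => //.
  by move=> p; rewrite lee_fin immigrants_ge0.
move=> om /contrapT/= NM0; apply: ge0_ae_eq_integral => //.
- by move=> p _; rewrite lee_fin immigrants_ge0.
- by move=> p _; exact: past_limit_ge0.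
- exists M; split => // p /= h; rewrite /M/=; apply/eqP => e; apply: h => _.
  by rewrite e.
Qed.

End immigration_observable.

(** * The transition semigroup *)

Section convolution_kernel.
Context {R : realType} d (Omega : measurableType d) (Pr : probability Omega R).
Variables (k : R.-pker R ~> R) (Z : Omega -> R).
Hypothesis mZ : measurable_fun setT Z.

Let offset (y : R) om : {measure set R -> \bar R} := \d_(y + Z om).

Let measurable_offset y U : measurable U -> measurable_fun setT (offset y ^~ U).
Proof.
move=> mU; apply/measurable_EFinP; apply: (measurableT_comp (measurable_indic mU)).
exact: measurable_funD.
Qed.

Let shift (y : R) : {measure set R -> \bar R} :=
  mixture Pr (k := offset y) measurableT (measurable_offset y).

Let integral_shift y (f : R -> \bar R) : (forall z, 0 <= f z)%E -> measurable_fun setT f ->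
  (\int[shift y]_z f z = \int[Pr]_om f (y + Z om)%R)%E.
Proof.
move=> f0 mf; rewrite integral_mixture//; apply: eq_integral => om _.
by rewrite integral_dirac// diracT mul1e.
Qed.

Let measurable_shift U : measurable U -> measurable_fun setT (shift ^~ U).
Proof.
move=> mU; have mf : measurable_fun setT (fun p : R * Omega => (\1_U (p.1 + Z p.2))%:E : \bar R).
  apply/measurable_EFinP; apply: (measurableT_comp (measurable_indic mU)).
  by apply: measurable_funD => //; exact: (measurableT_comp mZ).
have f0 (p : R * Omega) : (0 <= (\1_U (p.1 + Z p.2))%:E :> \bar R)%E by rewrite lee_fin.
have := @measurable_fun_fubini_tonelli_F _ _ _ _ _ Pr _ mf f0.
by congr measurable_fun; apply/funext.
Qed.

(** The law of a [k x] variable plus an independent copy of [Z]; the kernel property comes from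
    Fubini. *)
Definition convolution : R -> {measure set R -> \bar R} :=
  fun x => mixture (k x) (k := shift) measurableT measurable_shift.

Lemma integral_convolution x (f : R -> \bar R) :
  (forall z, 0 <= f z)%E -> measurable_fun setT f ->
  (\int[convolution x]_z f z = \int[k x]_y \int[Pr]_om f (y + Z om)%R)%E.
Proof.
move=> f0 mf; rewrite integral_mixture//.
by apply: eq_integral => y _; rewrite integral_shift.
Qed.

Let measurable_convolution U : measurable U -> measurable_fun setT (convolution ^~ U).
Proof.
by move=> mU; apply: measurable_integral_kernel => //;
  [exact: measurable_kernel|exact: measurable_shift].
Qed.

HB.instance Definition _ :=
  isKernel.Build _ _ _ _ _ convolution measurable_convolution.

Let convolution_prob x : convolution x setT = 1%E.
Proof.
rewrite -(setIT (setT : set R)) -(integral_indic (convolution x) measurableT measurableT).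
rewrite integral_convolution//; last by apply/measurable_EFinP; exact: measurable_indic.
rewrite (eq_integral (cst 1%E)); first by rewrite integral_cst// mul1e prob_kernel.
move=> y _; rewrite (eq_integral (cst 1%E)); last by move=> om _; rewrite indicT.
by rewrite integral_cst// mul1e; exact: probability_setT.
Qed.

HB.instance Definition _ :=
  Kernel_isProbability.Build _ _ _ _ _ convolution convolution_prob.

End convolution_kernel.

Section convolution_laplace.
Context {R : realType} d (Omega : measurableType d) (Pr : probability Omega R).
Variables (k : R.-pker R ~> R) (Z : Omega -> R).
Hypothesis mZ : measurable_fun setT Z.
Hypothesis Z0 : forall om, 0 <= Z om.

Lemma laplace_full (m : {measure set R -> \bar R}) lambda : m `]-oo, 0[%classic = 0%E ->
  laplace m lambda = (\int[m]_y (expR (- (lambda * y)))%:E)%E.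
Proof.
move=> m0; rewrite (integral_null_neg m0)//.
by apply/measurable_EFinP; exact: measurable_expRNZ.
Qed.

Lemma convolution_null_neg x : k x `]-oo, 0[%classic = 0%E ->
  convolution Pr k mZ x `]-oo, 0[%classic = 0%E.
Proof.
move=> kx0; have mU : measurable (`]-oo, 0%R[%classic : set R) by [].
rewrite -[X in convolution _ _ _ _ X]setIT.
rewrite -(integral_indic (convolution Pr k mZ x) measurableT mU).
have mi : measurable_fun setT (fun z : R => (\1_(`]-oo, 0%R[%classic : set R) z)%:E : \bar R).
  by apply/measurable_EFinP; exact: measurable_indic.
rewrite (integral_convolution Pr k mZ _ _ mi)//.
rewrite (ge0_negligible_integral mU)//; last 2 first.
- have mf : measurable_fun setT (fun p : R * Omega =>
      (\1_(`]-oo, 0%R[%classic : set R) (p.1 + Z p.2))%:E : \bar R).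
    apply/measurable_EFinP; apply: (measurableT_comp (measurable_indic mU)).
    by apply: measurable_funD => //; exact: (measurableT_comp mZ).
  by have := @measurable_fun_fubini_tonelli_F _ _ _ _ _ Pr _ mf; apply.
- by move=> y _; apply: integral_ge0.
rewrite integral0_eq// => y [_ /=]; rewrite in_itv/= => /negP; rewrite -leNgt => y0.
rewrite integral0_eq// => om _; rewrite indicE memNset//= in_itv/=.
by apply/negP; rewrite -leNgt addr_ge0.
Qed.

Lemma convolution_laplace x lambda : k x `]-oo, 0[%classic = 0%E ->
  laplace (convolution Pr k mZ x) lambda =
  (laplace (k x) lambda * \int[Pr]_om (expR (- (lambda * Z om)))%:E)%E.
Proof.
move=> kx0; rewrite !laplace_full//; last exact: convolution_null_neg.
have mR : measurable_fun setT (fun y : R => (expR (- (lambda * y)))%:E : \bar R).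
  by apply/measurable_EFinP; exact: measurable_expRNZ.
rewrite (integral_convolution Pr k mZ x _ mR); last by move=> z; rewrite lee_fin expR_ge0.
have mE : measurable_fun setT (fun om => (expR (- (lambda * Z om)))%:E : \bar R).
  by apply/measurable_EFinP; exact: measurable_expRNZ.
rewrite -(ge0_integralZr (k x) measurableT mR); last 2 first.
- by move=> y _; rewrite lee_fin expR_ge0.
- by apply: integral_ge0 => om _; rewrite lee_fin expR_ge0.
apply: eq_integral => y _; rewrite -(ge0_integralZl Pr measurableT mE).
- by apply: eq_integral => om _; rewrite -EFinM mulrDr opprD expRD.
- by move=> om _; rewrite lee_fin expR_ge0.
- by rewrite lee_fin expR_ge0.
Qed.

End convolution_laplace.

Section immigration_semigroup.
Context {R : realType} d (Omega : measurableType d) (Pr : probability Omega R).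
Variables (phi : R -> R) (v : R -> R -> R) (Q : R -> R.-pker R ~> R).
Hypothesis hv : is_cumulant_flow phi v.
Hypothesis hQ : is_CB_semigroup v Q.
Variable Z : R -> R -> Omega -> R.
Hypothesis mZ : forall r t, measurable_fun setT (Z r t).
Hypothesis Z0 : forall r t om, 0 <= Z r t om.
Variable Psi : R -> R -> R -> R.
Hypothesis lapZ : forall r t lambda, 0 <= r -> r <= t -> 0 <= lambda ->
  (\int[Pr]_om (expR (- (lambda * Z r t om)))%:E = (expR (- Psi r t lambda))%:E)%E.
Hypothesis Psi_refl : forall r lambda, 0 <= r -> 0 <= lambda -> Psi r r lambda = 0.
Hypothesis Psi_add : forall r s t lambda, 0 <= r -> r <= s -> s <= t -> 0 <= lambda ->
  Psi r t lambda = Psi r s (v (t - s) lambda) + Psi s t lambda.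

Definition immigration_semigroup r t : R.-pker R ~> R :=
  convolution Pr (Q (t - r)) (mZ r t).

Local Notation P := immigration_semigroup.

Let Q_null r t x : 0 <= r -> r <= t -> 0 <= x -> Q (t - r) x `]-oo, 0[%classic = 0%E.
Proof. by move=> r0 rt x0; have [[+ _ _] _] := hQ; exact. Qed.

Lemma immigration_semigroup_null r t x : 0 <= r -> r <= t -> 0 <= x ->
  P r t x `]-oo, 0[%classic = 0%E.
Proof. by move=> r0 rt x0; apply: convolution_null_neg; [exact: Z0|exact: Q_null]. Qed.

Lemma immigration_semigroup_laplace r t x lambda :
  0 <= r -> r <= t -> 0 <= x -> 0 <= lambda ->
  laplace (P r t x) lambda = (expR (- (x * v (t - r) lambda) - Psi r t lambda))%:E.
Proof.
move=> r0 rt x0 l0; rewrite convolution_laplace//; last exact: Q_null.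
by rewrite (CB_laplace hQ)// ?subr_ge0// lapZ// -EFinM -expRD.
Qed.

Let prob_fin (k : R.-pker R ~> R) x : (k x setT < +oo)%E.
Proof. by rewrite prob_kernel ltry. Qed.

(** Each identity of measures is checked on Laplace transforms; Chapman-Kolmogorov reduces to
    [cumulant_flow] and the cocycle identity [Psi_add]. *)
Lemma immigration_semigroup_transition : is_transition_semigroup P.
Proof.
split; first exact: immigration_semigroup_null.
- move=> r x A r0 x0 mA; apply: laplace_unique_pos => //.
  + by have := ltry (1 : R); congr (_ < _)%E; exact: esym (diracT R x).
  + exact: immigration_semigroup_null.
  + apply: (etrans (diracE R x _)); rewrite memNset//= in_itv/=.
    by apply/negP; rewrite -leNgt.
  move=> lambda l0; rewrite immigration_semigroup_laplace// subrr (cumulant0 hv)//.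
  rewrite Psi_refl// subr0 /laplace integral_dirac//=; last first.
    by apply/measurable_EFinP; apply: measurable_funTS; exact: measurable_expRNZ.
  by rewrite diracE mem_set ?mul1e 1?mulrC//= in_itv/= x0.
move=> r s t x A r0 rs st x0 mA; have s0 := le_trans r0 rs; have rt := le_trans rs st.
have mpos : measurable (`[0%R, +oo[%classic : set R) by [].
pose M : {measure set R -> \bar R} :=
  mixture (P r s x) (k := P s t) mpos (measurable_kernel (P s t)).
have ME B : M B = (\int[P r s x]_(y in `[0%R, +oo[) P s t y B)%E by [].
have pos_in (y : R) : y \in (`[0%R, +oo[%classic : set R) -> 0 <= y.
  by move=> /set_mem/=; rewrite in_itv/= andbT.
rewrite -(ME A); apply: laplace_unique_pos => //.
- rewrite ME; under eq_integral do rewrite prob_kernel.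
  rewrite integral_cst// mul1e; apply: le_lt_trans (prob_fin (P r s) x).
  by apply: le_measure => //; exact/mem_set.
- exact: immigration_semigroup_null.
- rewrite ME integral0_eq// => y /mem_set/pos_in y0.
  exact: immigration_semigroup_null.
move=> lambda l0; have vl0 : 0 <= v (t - s) lambda by rewrite (cumulant_ge0 hv)// subr_ge0.
rewrite immigration_semigroup_laplace// [RHS]laplaceE.
rewrite integral_mixture; last 2 first.
- exact: laplace_integrand_ge0.
- exact: measurable_laplace_integrand.
rewrite (eq_integral (fun y => ((expR (- Psi s t lambda))%:E *
    (expR (- (v (t - s) lambda * y)))%:E)%E)); last first.
  move=> y /pos_in y0; rewrite -laplaceE immigration_semigroup_laplace//.
  by rewrite -EFinM -expRD addrC mulrC.
have mL : measurable_fun (`[0%R, +oo[%classic : set R)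
    (fun y => (expR (- (v (t - s) lambda * y)))%:E).
  by apply/measurable_EFinP; apply: measurable_funTS; exact: measurable_expRNZ.
rewrite (ge0_integralZl (P r s x) mpos mL); last 2 first.
- by move=> y _; rewrite lee_fin expR_ge0.
- by rewrite lee_fin expR_ge0.
rewrite -/(laplace _ _) immigration_semigroup_laplace// -EFinM -expRD.
rewrite -(cumulant_flow hv hQ) ?subr_ge0// (Psi_add r0 rs st l0).
congr (expR _)%:E.
have -> : s - r + (t - s) = t - r by ring.
by ring.
Qed.

End immigration_semigroup.

(** * Conditional laws *)

Section bounded_integrals.
Context d (T : measurableType d) (R : realType) (mu : {measure set T -> \bar R}).
Hypothesis mufin : (mu setT < +oo)%E.

Lemma bounded_integrable (D : set T) (u : T -> R) (C : R) : measurable D ->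
  measurable_fun setT u -> (forall x, `|u x| <= C) -> mu.-integrable D (EFin \o u).
Proof.
move=> mD mu_ uC; apply: (@integrableS _ _ _ _ setT) => //.
apply: measurable_bounded_integrable => //.
by exists C; split; [exact: num_real|move=> y Cy x _; exact: le_trans (uC x) (ltW Cy)].
Qed.

(** Adding the bound [C] reduces a bounded function to a nonnegative one, for which the monotone
    tools are available. *)
Lemma integral_shift_bound (D : set T) (u : T -> R) (C : R) : measurable D ->
  measurable_fun setT u -> (forall x, `|u x| <= C) ->
  (\int[mu]_(x in D) (u x)%:E = \int[mu]_(x in D) (u x + C)%:E - C%:E * mu D)%E.
Proof.
move=> mD mu_ uC.
have muD : (mu D < +oo)%E.
  by apply: le_lt_trans mufin; apply: le_measure => //; exact/mem_set.
have iu := bounded_integrable mD mu_ uC.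
have iC : mu.-integrable D (EFin \o (fun=> C)).
  by apply: (@bounded_integrable _ (fun=> C) `|C|).
have -> : (\int[mu]_(x in D) (u x + C)%:E = \int[mu]_(x in D) (u x)%:E + C%:E * mu D)%E.
  have := integralD_EFin mD iu iC; rewrite (integral_cst mu mD C%:E) => <-.
  by apply: eq_integral => x _; rewrite EFinD.
by rewrite addeK// fin_numM// ge0_fin_numE.
Qed.

End bounded_integrals.

Section conditional_law.
Context {R : realType} d (Omega : measurableType d) (Pr : probability Omega R).
Local Notation E := (R * cadlag R)%type.
Variable mu : {sigma_finite_measure set E -> \bar R}.
Variable N : Omega -> {measure set E -> \bar R}.
Hypothesis hN : is_poisson_random_measure Pr mu N.
Variables (P : R.-pker R ~> R) (r : R) (v Psi : R -> R).
Hypothesis v0 : forall lambda, 0 <= lambda -> 0 <= v lambda.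
Hypothesis Pnull : forall x, 0 <= x -> P x `]-oo, 0[%classic = 0%E.
Hypothesis lapP : forall x lambda, 0 <= x -> 0 <= lambda ->
  laplace (P x) lambda = (expR (- (x * v lambda) - Psi lambda))%:E.
Variables Yr Yt : Omega -> \bar R.
Hypothesis Yr0 : forall om, (0 <= Yr om)%E.
Hypothesis Yt0 : forall om, (0 <= Yt om)%E.
Hypothesis mYt : measurable_fun setT Yt.
Hypothesis oYr : observable Pr N r Yr.
Hypothesis Yr_fin : Pr [set om | Yr om = +oo%E] = 0%E.
Hypothesis Yt_fin : Pr [set om | Yt om = +oo%E] = 0%E.
Hypothesis key : forall lambda S, 0 <= lambda -> past_functional r S ->
  (\int[Pr]_om (expeR (- (lambda%:E * Yt om)) * expeR (- \int[N om]_p (S p)%:E)) =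
   (expR (- Psi lambda))%:E *
   \int[Pr]_om (expeR (- ((v lambda)%:E * Yr om)) * expeR (- \int[N om]_p (S p)%:E)))%E.

Let F := augmented Pr (immigration_filtration N) r.

Let mYr : measurable_fun setT Yr. Proof. exact: (observable_measurable hN oYr). Qed.

Let Pr_fin : (Pr setT < +oo)%E. Proof. by rewrite probability_setT ltry. Qed.

Let e (a : R) (Y : Omega -> \bar R) om : R := fine (expeR (- (a%:E * Y om)))%E.

Let eE a Y om : 0 <= a -> (0 <= Y om)%E -> expeR (- (a%:E * Y om))%E = (e a Y om)%:E.
Proof. by move=> a0 Y0; rewrite fineK// expeRN_fin_num// mule_ge0. Qed.

Let e0 a Y om : 0 <= e a Y om.
Proof. by rewrite fine_ge0// expeR_ge0. Qed.

Let e1 a Y om : 0 <= a -> (0 <= Y om)%E -> e a Y om <= 1.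
Proof. by move=> a0 Y0; rewrite -lee_fin -eE// expeRN_le1// mule_ge0. Qed.

Let me a Y : measurable_fun setT Y -> measurable_fun setT (e a Y).
Proof.
move=> mY; apply: measurable_fineT.
apply: (measurableT_comp measurable_expeR); apply: measurableT_comp => //.
exact: measurable_funeM.
Qed.

Let me2 c a Y : measurable_fun setT Y -> measurable_fun setT (fun om => c * e a Y om).
Proof. by move=> mY; apply: measurable_funM => //; exact: me. Qed.

Let ce0 c a Y om : 0 <= c -> 0 <= c * e a Y om.
Proof. by move=> c0; rewrite mulr_ge0. Qed.

Let dens_fin c a Y (c0 : 0 <= c) (mY : measurable_fun setT Y) : 0 <= a ->
  (forall om, 0 <= Y om)%E ->
  (density Pr (fun om => ce0 a Y om c0) (me2 c a mY) setT < +oo)%E.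
Proof.
move=> a0 Y0; rewrite (densityE Pr _ _ measurableT).
apply: (@le_lt_trans _ _ (\int[Pr]_om (cst c%:E om))%E).
  apply: (ge0_le_integral Pr measurableT).
  - by move=> om _; rewrite lee_fin ce0.
  - by apply/measurable_EFinP; exact: me2.
  - exact: measurable_cst.
  - by move=> om _; rewrite lee_fin ler_piMr// e1.
by rewrite integral_cst// lte_mul_pinfty// lee_fin.
Qed.

(** Both sides are the masses of [A] under two finite measures with densities with respect to [Pr].
    Their agreement on exponentials of past functionals is [key], and counts of past rectangles
    together with null events generate the sigma-algebra of [A]. *)
Lemma conditional_laplace A lambda : F A -> 0 <= lambda ->
  (\int[Pr]_(om in A) (e lambda Yt om)%:E =
   \int[Pr]_(om in A) (expR (- Psi lambda) * e (v lambda) Yr om)%:E)%E.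
Proof.
move=> FA l0; have mA := augmented_measurable hN FA.
have vl0 := v0 l0; have c0 : 0 <= expR (- Psi lambda) by exact: expR_ge0.
pose M1 := density Pr (fun om => ce0 lambda Yt om ler01) (me2 1 lambda mYt).
pose M2 := density Pr (fun om => ce0 (v lambda) Yr om c0) (me2 _ (v lambda) mYr).
suff : M1 A = M2 A.
  rewrite /M1 /M2 (densityE Pr _ _ mA) (densityE Pr _ _ mA) => <-.
  by apply: eq_integral => om _; rewrite mul1r.
pose G := [set X : Omega -> \bar R | exists2 B, past_rectangle r B & X = fun om => N om B].
pose H := [set X : Omega -> \bar R | exists2 S, past_functional r S &
  X = fun om => (\int[N om]_p (S p)%:E)%E].
pose Z := [set A | measurable A /\ Pr A = 0%E].
have mint S : past_functional r S -> measurable_fun setT (fun om => \int[N om]_p (S p)%:E)%E.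
  move=> [mS S0 _ _]; apply: (measurable_prm_integral hN).
    by move=> p; rewrite lee_fin.
  exact/measurable_EFinP.
have int0 S om : past_functional r S -> (0 <= \int[N om]_p (S p)%:E)%E.
  by move=> [_ S0 _ _]; apply: integral_ge0 => p _; rewrite lee_fin.
apply: (@sigma_laplace_unique _ _ _ M1 M2 _ _ G H Z).
- exact: dens_fin.
- exact: dens_fin.
- by move=> _ [B pB ->]; apply: (measurable_prm hN); exact: measurable_past_rectangle pB.
- by move=> _ [S pS ->]; exact: mint.
- by move=> _ om [B pB ->]; exact: measure_ge0.
- by move=> _ om [S pS ->]; exact: int0.
- move=> _ _ a [S pS ->] [B pB ->] a0; have mB := measurable_past_rectangle pB.
  exists (fun p => S p + a * \1_B p); first exact: past_functionalD.
  have [mS S0 _ _] := pS.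
  have mSE : measurable_fun setT (fun p => (S p)%:E : \bar R) by exact/measurable_EFinP.
  have mB1 : measurable_fun setT (fun p : E => (\1_B p)%:E : \bar R).
    by apply/measurable_EFinP; exact: measurable_indic.
  have i1 om : (\int[N om]_p (S p + a * \1_B p)%:E =
      \int[N om]_p (S p)%:E + \int[N om]_p (a%:E * (\1_B p)%:E))%E.
    rewrite -(ge0_integralD (N om) measurableT)//.
    + by move=> p _; rewrite lee_fin.
    + by move=> p _; rewrite mule_ge0// lee_fin.
    + exact: measurable_funeM.
  apply/funext => om; rewrite i1 (ge0_integralZl (N om) measurableT mB1)//.
  by rewrite integral_indic// setIT.
- exists (fun=> 0); first exact: past_functional0.
  by apply/funext => om; rewrite integral0.
- move=> _ [S pS ->].
  have mex : measurable_fun setT (fun om => expeR (- \int[N om]_p (S p)%:E))%E.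
    by apply: (measurableT_comp measurable_expeR); apply: measurableT_comp => //; exact: mint.
  have ex0 om : (0 <= expeR (- \int[N om]_p (S p)%:E))%E by exact: expeR_ge0.
  rewrite /M1 /M2 (integral_density Pr _ _ ex0 mex) (integral_density Pr _ _ ex0 mex).
  transitivity (\int[Pr]_om (expeR (- (lambda%:E * Yt om)) *
      expeR (- \int[N om]_p (S p)%:E)))%E.
    by apply: eq_integral => om _; rewrite mul1r eE.
  rewrite key// -ge0_integralZl//.
  + by apply: eq_integral => om _; rewrite EFinM eE// muleA.
  + apply: emeasurable_funM => //; apply: (measurableT_comp measurable_expeR).
    by apply: measurableT_comp => //; exact: measurable_funeM.
  + by move=> om _; rewrite mule_ge0// expeR_ge0.
- by move=> B [].
- move=> B [mB PB]; rewrite /M1 (densityE Pr _ _ mB).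
  by rewrite null_set_integral//; apply/measurable_EFinP; apply: measurable_funTS; exact: me2.
- move=> B [mB PB]; rewrite /M2 (densityE Pr _ _ mB).
  by rewrite null_set_integral//; apply/measurable_EFinP; apply: measurable_funTS; exact: me2.
apply: smallest_sub FA; first exact: smallest_sigma_algebra.
move=> B [FB|ZB]; last by apply: sub_sigma_algebra; right.
apply: smallest_sub FB; first exact: smallest_sigma_algebra.
move=> _ [u [A' [C [ur FA' mC ->]]]]; apply: sub_sigma_algebra; left.
exists (fun om => N om (`]0%R, u] `*` A')); first by exists (`]0%R, u] `*` A') => //; exists u, A'.
by exists C.
Qed.

(** Infinite values matter here: [fine] sends [+oo] to 0, so the two integrands may differ there, on
    a null event. *)
Let e_fin a (Y : Omega -> \bar R) (A : set Omega) (c : R) : 0 <= a -> 0 <= c -> measurable A ->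
  measurable_fun setT Y -> (forall om, 0 <= Y om)%E ->
  Pr [set om | Y om = +oo%E] = 0%E ->
  (\int[Pr]_(om in A) (c * e a Y om)%:E =
   \int[Pr]_(om in A) (c * expR (- (a * fine (Y om))))%:E)%E.
Proof.
move=> a0 c0 mA mY Y0 Yfin; apply: ge0_ae_eq_integral => //.
- by apply/measurable_EFinP; apply: measurable_funTS; exact: me2.
- apply/measurable_EFinP; apply: measurable_funTS; apply: measurable_funM => //.
  by apply: measurable_expRNZ; apply: (measurable_fineT mY).
- by move=> om _; rewrite lee_fin ce0.
- by move=> om _; rewrite lee_fin mulr_ge0// expR_ge0.
exists [set om | Y om = +oo%E]; split => //.
  by have := mY measurableT _ (emeasurable_set1 +oo%E); rewrite setTI.
move=> om /= h; apply: contrapT => Yom; apply: h => _; congr (_%:E); congr (_ * _).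
rewrite /e; have := Y0 om; move: Yom; case: (Y om) => [z _ _| |]//=.
Qed.

Let k1 om : {measure set R -> \bar R} := \d_(fine (Yt om)).

Let mk1 U : measurable U -> measurable_fun setT (k1 ^~ U).
Proof.
move=> mU; apply/measurable_EFinP.
exact: (measurableT_comp (measurable_indic mU) (measurable_fineT mYt)).
Qed.

Let k2 om : {measure set R -> \bar R} := P (fine (Yr om)).

Let mk2 U : measurable U -> measurable_fun setT (k2 ^~ U).
Proof.
move=> mU.
exact: (measurableT_comp (measurable_kernel P U mU) (measurable_fineT mYr)).
Qed.

(** For fixed [A], both sides are measures in [C] given by mixtures over [A], and
    [conditional_laplace] together with [lapP] equates their transforms. *)
Lemma conditional_law A C : F A -> measurable C ->
  (\int[Pr]_(om in A) (\d_(fine (Yt om)) C) = \int[Pr]_(om in A) P (fine (Yr om)) C)%E.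
Proof.
move=> FA mC; have mA := augmented_measurable hN FA.
pose m1 : {measure set R -> \bar R} := mixture Pr (k := k1) mA mk1.
pose m2 : {measure set R -> \bar R} := mixture Pr (k := k2) mA mk2.
have fY0 (Y : Omega -> \bar R) om : (forall om, 0 <= Y om)%E -> 0 <= fine (Y om).
  by move=> Y0; rewrite fine_ge0.
have PA : (\int[Pr]_(om in A) (1 : \bar R) < +oo)%E.
  rewrite integral_cst// mul1e; apply: le_lt_trans Pr_fin.
  by apply: le_measure => //; exact/mem_set.
suff : m1 C = m2 C by [].
apply: laplace_unique_pos => //.
- apply: le_lt_trans PA; rewrite le_eqVlt; apply/orP; left; apply/eqP.
  by apply: eq_integral => om _; exact: diracT.
- apply: le_lt_trans PA; rewrite le_eqVlt; apply/orP; left; apply/eqP.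
  by apply: eq_integral => om _; rewrite /k2 prob_kernel.
- apply: integral0_eq => om _; apply: (etrans (diracE R _ _)).
  by rewrite memNset//= in_itv/=; apply/negP; rewrite -leNgt fY0.
- by apply: integral0_eq => om _; apply: Pnull; exact: fY0.
move=> lambda l0; rewrite !laplaceE.
have h0 := laplace_integrand_ge0 lambda; have hm := @measurable_laplace_integrand R lambda.
rewrite (@integral_mixture _ _ _ _ _ Pr A k1 mA mk1 _ h0 hm) (@integral_mixture _ _ _ _ _ Pr A k2 mA mk2 _ h0 hm).
transitivity (\int[Pr]_(om in A) (1 * e lambda Yt om)%:E)%E.
  rewrite e_fin//; apply: eq_integral => om _.
  rewrite integral_dirac// diracT mul1e mul1r patchE mem_set//= in_itv/=.
  by rewrite fY0.
transitivity (\int[Pr]_(om in A) (e lambda Yt om)%:E)%E.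
  by apply: eq_integral => om _; rewrite mul1r.
rewrite (conditional_laplace FA l0).
rewrite (e_fin (v0 l0) (expR_ge0 (- Psi lambda)) mA mYr Yr0 Yr_fin).
apply: eq_integral => om _; rewrite -laplaceE /k2 lapP ?fY0//.
by rewrite -expRD addrC mulrC.
Qed.

Lemma conditional_integral A (g : R -> R) : F A -> measurable_fun setT g ->
  (forall y, 0 <= g y) ->
  (\int[Pr]_(om in A) (g (fine (Yt om)))%:E =
   \int[Pr]_(om in A) \int[P (fine (Yr om))]_z (g z)%:E)%E.
Proof.
move=> FA mg g0; have mA := augmented_measurable hN FA.
have gE0 z : (0 <= (g z)%:E)%E by rewrite lee_fin.
have mgE : measurable_fun setT (fun z => (g z)%:E : \bar R) by exact/measurable_EFinP.
rewrite -[RHS](@integral_mixture _ _ _ _ _ Pr A k2 mA mk2 _ gE0 mgE).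
transitivity (\int[mixture Pr (k := k1) mA mk1]_z (g z)%:E)%E.
  rewrite (@integral_mixture _ _ _ _ _ Pr A k1 mA mk1 _ gE0 mgE); apply: eq_integral => om _.
  by rewrite integral_dirac// diracT mul1e.
by apply: eq_measure_integral => C mC _; exact: conditional_law.
Qed.

(** The nonnegative case is applied to [f + C], and the constant is then subtracted on both sides,
    all masses being finite. *)
Lemma conditional_expectation (f : R -> R) (C : R) : measurable_fun setT f ->
  (forall z, `|f z| <= C) ->
  is_conditional_expectation Pr F (f \o (fun om => fine (Yt om)))
    (fun om => \int[P (fine (Yr om))]_(z in `[0, +oo[) f z).
Proof.
move=> mf fC.
have C0 : 0 <= C by apply: le_trans (fC 0).
pose g z := f z + C.
have g0 z : 0 <= g z by rewrite /g -lerBlDr sub0r; have := fC z; rewrite ler_norml => /andP[].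
have g2 z : g z <= C + C.
  by rewrite lerD2r; have := fC z; rewrite ler_norml => /andP[].
have mg : measurable_fun setT g by exact: measurable_funD.
have mgE : measurable_fun setT (fun z => (g z)%:E : \bar R) by exact/measurable_EFinP.
pose I x : \bar R := (\int[P x]_z (g z)%:E)%E.
have I0 x : (0 <= I x)%E by apply: integral_ge0 => z _; rewrite lee_fin.
have I2 y : (I y <= (C + C)%:E)%E.
  rewrite -[leRHS]mule1 -(@prob_kernel _ _ _ _ _ P y) -(integral_cst (P y) measurableT).
  apply: (ge0_le_integral (P y) measurableT).
  - by move=> z _; rewrite lee_fin.
  - exact: mgE.
  - exact: measurable_cst.
  - by move=> z _; rewrite lee_fin.
have finI z : I z \is a fin_num by rewrite ge0_fin_numE// (le_lt_trans (I2 z))// ltry.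
have mI : measurable_fun setT I.
  by apply: measurable_integral_kernel => //; exact: measurable_kernel.
have yr0 om : 0 <= fine (Yr om) by rewrite fine_ge0.
pose h x := fine (I x) - C.
have mh : measurable_fun setT h.
  by apply: measurable_funB => //; exact: (measurable_fineT mI).
have hC x : `|h x| <= C.
  have i0 : 0 <= fine (I x) by rewrite fine_ge0.
  have i2 : fine (I x) <= C + C by rewrite -lee_fin fineK.
  by rewrite /h ler_norml; apply/andP; split; lra.
have Pfin x : (P x setT < +oo)%E by rewrite prob_kernel ltry.
have hE om : \int[P (fine (Yr om))]_(z in `[0, +oo[) f z = h (fine (Yr om)).
  have mpos : measurable (`[0%R, +oo[%classic : set R) by [].
  have Px := Pnull (yr0 om).
  have Ppos : P (fine (Yr om)) `[0, +oo[%classic = 1%E.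
    have := measureTC (P (fine (Yr om))) (measurable_itv `]-oo, 0[).
    by rewrite setCitvl Px add0e prob_kernel => <-.
  rewrite /Rintegral (integral_shift_bound (Pfin _) mpos mf fC) Ppos mule1.
  rewrite -(integral_null_neg Px _ mgE); last by move=> z; rewrite lee_fin.
  by apply: (fineB (finI _)).
have eE' : (fun om => \int[P (fine (Yr om))]_(z in `[0, +oo[) f z) = h \o (fun om => fine (Yr om)).
  by apply/funext => om; exact: hE.
rewrite eE'.
have oh : observable Pr N r (h \o (fun om => fine (Yr om))).
  apply: (measurableT_comp mh).
  exact: (measurable_fineT oYr).
have moh := observable_measurable hN oh.
have mft : measurable_fun setT (f \o (fun om => fine (Yt om))).
  apply: (measurableT_comp mf).
  exact: (measurable_fineT mYt).
split.
- by move=> B mB; rewrite -[X in F X]setTI; exact: oh.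
- exact: (bounded_integrable Pr_fin measurableT moh (fun om => hC _)).
move=> A FA; have mA := augmented_measurable hN FA.
rewrite (integral_shift_bound Pr_fin mA moh (fun om => hC _)).
rewrite [RHS](integral_shift_bound Pr_fin mA mft (fun om => fC _)).
congr (_ - _)%E; rewrite [RHS](conditional_integral FA mg g0).
by apply: eq_integral => om _ /=; rewrite /h subrK fineK.
Qed.

End conditional_law.

(** * The Markov property of the immigration process *)

Section sigma_finite_extra.
Local Open Scope ereal_scope.

Section alias.
Context d (T : measurableType d) (R : realType) (m : {measure set T -> \bar R}).
Hypothesis sm : sigma_finite setT m.

(** The proof is an argument so that a sigma-finite structure can be attached to a measure whose
    sigma-finiteness has been proved separately; the set function is unchanged. *)
Definition sigma_finite_alias of sigma_finite setT m : set T -> \bar R := m.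

HB.instance Definition _ := Measure.copy (sigma_finite_alias sm) m.

HB.instance Definition _ :=
  @Measure_isSigmaFinite.Build d T R (sigma_finite_alias sm) sm.

End alias.

Lemma product_sigma_finite d1 d2 (T1 : measurableType d1) (T2 : measurableType d2)
    (R : realType) (m1 : {sigma_finite_measure set T1 -> \bar R})
    (m2 : {sigma_finite_measure set T2 -> \bar R}) :
  sigma_finite setT (m1 \x m2).
Proof.
have seqs d (T : measurableType d) (m : {sigma_finite_measure set T -> \bar R}) :
  exists S : (set T)^nat, [/\ setT = \bigcup_i S i,
    nondecreasing_seq S & forall i, measurable (S i) /\ m (S i) < +oo].
  exact/sigma_finiteP/sigma_finiteT.
have [A [AT ndA mA]] := seqs _ _ m1; have [B [BT ndB mB]] := seqs _ _ m2.
exists (fun n => A n `*` B n).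
  apply/seteqP; split => // -[x y] _.
  have [i _ Ax] : (\bigcup_i A i) x by rewrite -AT.
  have [j _ By] : (\bigcup_i B i) y by rewrite -BT.
  exists (maxn i j) => //; split => /=.
    by have /subsetPset := ndA _ _ (leq_maxl i j); exact.
  by have /subsetPset := ndB _ _ (leq_maxr i j); exact.
move=> n; have [mAn finA] := mA n; have [mBn finB] := mB n.
split; first exact: measurableX.
by rewrite product_measure1E// lte_mul_pinfty// ge0_fin_numE.
Qed.

End sigma_finite_extra.

Section immigration_process_facts.
Context {R : realType} d (Omega : measurableType d).
Local Notation E := (R * cadlag R)%type.
Variable N : Omega -> {measure set E -> \bar R}.

Lemma immigration_processE t om :
  immigration_process N t om = (\int[N om]_p (immigrants 0 t p)%:E)%E.
Proof.
rewrite /immigration_process [LHS]integral_mkcond; apply: eq_integral => p _.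
rewrite patchE /immigrants; have [h|/negP h] := boolP (0 < p.1 <= t).
  by rewrite mem_set//; split => //=; rewrite in_itv.
by rewrite memNset// => -[/=]; rewrite in_itv.
Qed.

Variables (K : Omega -> set nat) (s : nat -> Omega -> R) (w : nat -> Omega -> cadlag R).
Hypothesis hs : forall om i, K om i -> 0 < s i om.
Hypothesis hNatoms : forall om A, measurable A ->
  N om A = \esum_(i in K om) \d_(s i om, w i om) A.

Lemma immigration_process_esum t om : 
  immigration_process N t om =
  \esum_(i in K om `&` [set i | s i om <= t]) (w i om (t - s i om))%:E.
Proof.
rewrite immigration_processE.
(* Indices outside [K om] receive the zero measure, which turns [N om] into a series of measures
   over all of [nat]. *)
pose d_ i : {measure set E -> \bar R} := \d_(s i om, w i om).
pose z_ : {measure set E -> \bar R} := mzero.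
pose m_ i : {measure set E -> \bar R} := if `[< K om i >] then d_ i else z_.
have mE i A : m_ i A = (if i \in K om then \d_(s i om, w i om) A else 0)%E.
  rewrite /m_; case: asboolP => [Ki|nKi]; first by rewrite mem_set.
  by rewrite memNset.
have i0 p : (0 <= (immigrants 0 t p)%:E :> \bar R)%E by rewrite lee_fin immigrants_ge0.
have mi : measurable_fun setT (fun p : E => (immigrants 0 t p)%:E : \bar R).
  by apply/measurable_EFinP; exact: measurable_immigrants.
rewrite (eq_measure_integral (mseries m_ 0)); last first.
  move=> A mA _; rewrite hNatoms//= /mseries esum_mkcond nneseries_esumT//.
  by apply: eq_esum => i _; rewrite mE.
rewrite ge0_integral_measure_series// nneseries_esumT; last first.
  by move=> i; apply: integral_ge0.
rewrite [RHS]esum_mkcond; apply: eq_esum => i _.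
rewrite /m_; case: asboolP => [Ki|nKi]; last first.
  by rewrite integral_measure_zero memNset// => -[].
rewrite integral_dirac// diracT mul1e /immigrants/= hs//=.
by case: ifPn => [st|/negP st]; [rewrite mem_set|rewrite memNset// => -[_]].
Qed.

End immigration_process_facts.

Section immigration_markov_process.
Context {R : realType}.
Local Notation E := (R * cadlag R)%type.
Variables (rho : {measure set R -> \bar R}).
Hypothesis hrho1 : forall t : R, 0 < t -> (rho `]0%R, t]%classic < +oo)%E.
Variable L : {sigma_finite_measure set (cadlag R) -> \bar R}.
Variable mu : {sigma_finite_measure set E -> \bar R}.
Hypothesis hmu : forall f : E -> \bar R, (forall p, 0 <= f p)%E ->
  measurable_fun setT f -> (\int[mu]_p f p = \int[rho]_s \int[L]_w f (s, w))%E.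
Variables (phi : R -> R) (v : R -> R -> R) (Q : R -> R.-pker R ~> R).
Hypothesis hv : is_cumulant_flow phi v.
Hypothesis hQ : is_CB_semigroup v Q.
Variables (beta : R) (psi : R -> R).
Hypothesis hbeta : 0 <= beta.
Hypothesis psi_le : exists2 C, 0 <= C & forall z, 0 <= z -> psi z <= C * z.
Hypothesis hL : forall q lambda, 0 <= q -> (0 < q \/ beta = 0) -> 0 <= lambda ->
  (\int[L]_w (1 - expR (- (lambda * w q)))%:E = (psi (v q lambda))%:E)%E.
Hypothesis hL0 : forall lambda, 0 <= lambda ->
  (\int[L]_w (1 - expR (- (lambda * w 0)))%:E = (psi lambda - beta * lambda)%:E)%E.
Hypothesis hmarkov : forall p q lambda (xi : cadlag R -> \bar R),
  0 <= q -> (0 < q \/ beta = 0) -> q <= p -> 0 <= lambda ->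
  (forall w, 0 <= xi w)%E -> adapted `[0, q] xi ->
  (\int[L]_w ((1 - expR (- (lambda * w p)))%:E * xi w) =
   \int[L]_w ((1 - expR (- (v (p - q) lambda * w q)))%:E * xi w))%E.
Hypothesis hjump : forall u, 0 < u -> (\int[L]_w jump_gap u w = 0)%E.

(* The Laplace exponent of [w q] under [L]; at [q = 0] the drift [beta] is lost. *)
Let n (q lambda : R) : R := psi (v q lambda) - (if q == 0 then beta * lambda else 0).

Let v0 t lambda : 0 <= t -> 0 <= lambda -> 0 <= v t lambda.
Proof. by move=> t0 l0; exact: (cumulant_ge0 hv t0 l0). Qed.

Let hn q lambda : 0 <= q -> 0 <= lambda ->
  (\int[L]_w (1 - expR (- (lambda * w q)))%:E = (n q lambda)%:E)%E.
Proof.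
move=> q0 l0; rewrite /n; case: eqP => [->|/eqP qn0]; first by rewrite (cumulant0 hv l0) hL0.
by rewrite hL// ?subr0//; left; rewrite lt_def qn0.
Qed.

Let n_ge0 q lambda : 0 <= q -> 0 <= lambda -> 0 <= n q lambda.
Proof.
move=> q0 l0; rewrite -lee_fin -hn//; apply: integral_ge0 => w _.
by rewrite lee_fin onem_expRN_ge0// mulr_ge0// path_ge0.
Qed.

Let window_sub r t : 0 <= r -> (`]r, t]%classic : set R) `<=` `]0, t].
Proof. by move=> r0; apply: subset_itvr; rewrite bnd_simp. Qed.

Let mwin r t : measurable (`]r, t]%classic : set R). Proof. exact: measurable_itv. Qed.

Let rho_win_lty r t : 0 <= r -> (rho `]r, t]%classic < +oo)%E.
Proof.
move=> r0; have [t0|t0] := ltP 0 t.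
  apply: le_lt_trans (hrho1 t0); apply: le_measure; [exact/mem_set|exact/mem_set|].
  exact: window_sub.
by rewrite set_itv_ge ?measure0// bnd_simp -leNgt (le_trans t0).
Qed.

Let rho_point_lty t : 0 < t -> (rho [set t] < +oo)%E.
Proof.
move=> t0; apply: le_lt_trans (hrho1 t0).
apply: le_measure; [apply/mem_set; exact: measurable_set1|exact/mem_set|].
by move=> _ ->; rewrite /= in_itv/= t0 lexx.
Qed.

Let mwindow r t lambda : 0 <= r -> 0 <= lambda ->
  measurable_fun (`]r, t]%classic : set R) (fun s => (n (t - s) lambda)%:E).
Proof. by move=> r0 l0; exact: (measurable_window hn r0 l0). Qed.

Let W r t lambda := (\int[rho]_(s in `]r, t]) (n (t - s) lambda)%:E)%E.

Let window_in r t s : (`]r, t]%classic : set R) s -> 0 <= t - s.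
Proof. by rewrite /= in_itv/= subr_ge0 => /andP[]. Qed.

(** The exponent is bounded on the window by the linear bound on [psi] and the bound on the
    cumulants, and [rho] is finite there. *)
Let window_lty r t lambda : 0 <= r -> 0 <= lambda -> (W r t lambda < +oo)%E.
Proof.
move=> r0 l0; have [rt|tr] := ltP r t; last first.
  by rewrite /W set_itv_ge ?integral_set0// bnd_simp -leNgt.
have t0 : 0 <= t by rewrite ltW// (le_lt_trans r0).
have [C C0 hC] := psi_le; have [B B0 hB] := cumulant_bounded hv t0 l0.
apply: (@le_lt_trans _ _ (\int[rho]_(s in `]r, t]) (cst (C * B)%:E s))%E); last first.
  rewrite integral_cst//; apply: lte_mul_pinfty; rewrite ?lee_fin ?mulr_ge0//.
  exact: rho_win_lty.
apply: (ge0_le_integral rho (mwin r t)).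
- by move=> s /window_in ts0; rewrite lee_fin n_ge0.
- exact: mwindow.
- exact: measurable_cst.
move=> s h; have ts0 := window_in h; rewrite lee_fin.
apply: (@le_trans _ _ (psi (v (t - s) lambda))).
  rewrite /n; case: ifP => _; last by rewrite subr0.
  by rewrite gerBl mulr_ge0.
apply: (le_trans (hC _ (v0 ts0 l0))); rewrite ler_wpM2l// hB// ts0/= gerBl.
by move: h; rewrite /= in_itv/= => /andP[/(le_lt_trans r0)/ltW].
Qed.

Let W_ge0 r t lambda : 0 <= lambda -> (0 <= W r t lambda)%E.
Proof. by move=> l0; apply: integral_ge0 => s /window_in ts0; rewrite lee_fin n_ge0. Qed.

(* The immigration started exactly at time [t], invisible in [Yw r t]. *)
Let drift r t : R := if r < t then beta * fine (rho [set t]) else 0.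

Let drift_ge0 r t : 0 <= drift r t.
Proof. by rewrite /drift; case: ifP => // _; rewrite mulr_ge0// fine_ge0. Qed.

Let ipsi r t lambda := (\int[rho]_(u in `]r, t]) (psi (v (t - u) lambda))%:E)%E.

(** Pointwise, $\psi(v_{t-s}(\lambda))$ is [n (t - s) lambda] plus $\beta\lambda$ at $s=t$;
    integrating the extra term gives the drift. *)
Let ipsiE r t lambda : 0 <= r -> 0 <= lambda ->
  ipsi r t lambda = (W r t lambda + (lambda * drift r t)%:E)%E.
Proof.
move=> r0 l0.
have m1 : measurable_fun (`]r, t]%classic : set R) (fun s => (\1_[set t] s)%:E : \bar R).
  by apply/measurable_EFinP; apply: measurable_funTS; exact: measurable_indic.
have bl0 : (0 <= (beta * lambda)%:E :> \bar R)%E by rewrite lee_fin mulr_ge0.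
transitivity (\int[rho]_(s in `]r, t]) ((n (t - s) lambda)%:E +
    (beta * lambda)%:E * (\1_[set t] s)%:E))%E.
  apply: eq_integral => s _; rewrite -EFinM -EFinD /n indicE subr_eq0 eq_sym.
  case: eqP => [->|/eqP st]; first by rewrite mem_set// mulr1 subrK.
  by rewrite memNset; [rewrite mulr0 addr0 subr0|move/eqP; apply/negP].
rewrite (ge0_integralD rho (mwin r t)).
- congr (_ + _)%E.
  rewrite (ge0_integralZl rho (mwin r t) m1)//.
  rewrite integral_indic// /drift; case: ifPn => rt.
    rewrite (_ : [set t] `&` _ = [set t]); last first.
      by apply/setIidPl => _ ->; rewrite /= in_itv/= rt lexx.
    rewrite -[X in (_ * X)%E]fineK ?ge0_fin_numE//; last first.
      by rewrite rho_point_lty// (le_lt_trans r0).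
    by rewrite -EFinM mulrAC mulrC.
  by rewrite set_itv_ge ?setI0 ?measure0 ?mule0 ?mulr0// bnd_simp.
- by move=> s /window_in ts0; rewrite lee_fin n_ge0.
- exact: mwindow.
- by move=> s _; rewrite mule_ge0// lee_fin.
- exact: measurable_funeM.
Qed.

Let Psi r t lambda : R := \int[rho]_(u in `]r, t]) psi (v (t - u) lambda).

Let PsiE r t lambda : 0 <= r -> 0 <= lambda -> (Psi r t lambda)%:E = ipsi r t lambda.
Proof.
move=> r0 l0; rewrite /Psi /Rintegral fineK// -/(ipsi _ _ _) ipsiE//.
by rewrite fin_numD// ge0_fin_numE ?W_ge0// window_lty.
Qed.

Context d (Omega : measurableType d) (Pr : probability Omega R).
Variable N : Omega -> {measure set E -> \bar R}.
Hypothesis hN : is_poisson_random_measure Pr mu N.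

Let Yw r t om : \bar R := (\int[N om]_p (immigrants r t p)%:E)%E.

Let Yw_ge0 r t om : (0 <= Yw r t om)%E.
Proof. by apply: integral_ge0 => p _; rewrite lee_fin immigrants_ge0. Qed.

Let mYw r t : measurable_fun setT (Yw r t).
Proof.
apply: (measurable_prm_integral hN).
  by move=> p; rewrite lee_fin immigrants_ge0.
by apply/measurable_EFinP; exact: measurable_immigrants.
Qed.

Let Yw_fin r t : 0 <= r -> Pr [set om | Yw r t om = +oo%E] = 0%E.
Proof.
move=> r0; apply: (prm_integral_lty hN).
- exact: immigrants_ge0.
- exact: measurable_immigrants.
have := integral_window hmu hn t r0 ler01.
under eq_integral do rewrite mul1r.
by move=> ->; exact: window_lty.
Qed.

Lemma immigration_lty t : {ae Pr, forall om, (\int[N om]_p (immigrants 0 t p)%:E < +oo)%E}.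
Proof.
exists [set om | Yw 0 t om = +oo%E]; split.
- by have := mYw 0 t measurableT (emeasurable_set1 +oo%E); rewrite setTI.
- exact: Yw_fin.
by move=> om /= /negP; rewrite -leNgt leye_eq => /eqP.
Qed.

(** With [drift] the exponent of [Z] is the full integral of [psi]. This is what makes [Psi_add]
    hold when [rho] charges the intermediate time, so that the kernels form a semigroup at all
    times. *)
Let Z r t om : R := fine (Yw r t om) + drift r t.

Let Z_ge0 r t om : 0 <= Z r t om.
Proof. by rewrite addr_ge0// fine_ge0. Qed.

Let mZ r t : measurable_fun setT (Z r t).
Proof.
apply: measurable_funD => //.
exact: (measurable_fineT (mYw r t)).
Qed.

Let laplace_window r t lambda : 0 <= r -> 0 <= lambda ->
  (\int[Pr]_om (expR (- (lambda * fine (Yw r t om))))%:E = expeR (- W r t lambda))%E.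
Proof.
move=> r0 l0; rewrite -(window_laplace hmu hn hN t r0 l0).
apply: ge0_ae_eq_integral => //.
- apply/measurable_EFinP; apply: measurable_expRNZ.
  exact: (measurable_fineT (mYw r t)).
- apply: (measurableT_comp measurable_expeR); apply: measurableT_comp => //.
  by apply: measurable_funeM; exact: mYw.
- by move=> om _; exact: expeR_ge0.
exists [set om | Yw r t om = +oo%E]; split.
- by have := mYw r t measurableT (emeasurable_set1 +oo%E); rewrite setTI.
- exact: Yw_fin.
move=> om /= h; apply: contrapT => Yom; apply: h => _.
rewrite -/(Yw r t om); have := Yw_ge0 r t om; move: Yom.
by case: (Yw r t om).
Qed.

Let laplace_Z r t lambda : 0 <= r -> r <= t -> 0 <= lambda ->
  (\int[Pr]_om (expR (- (lambda * Z r t om)))%:E = (expR (- Psi r t lambda))%:E)%E.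
Proof.
move=> r0 rt l0.
have mE : measurable_fun setT (fun om => (expR (- (lambda * fine (Yw r t om))))%:E : \bar R).
  apply/measurable_EFinP; apply: measurable_expRNZ.
  exact: (measurable_fineT (mYw r t)).
transitivity (\int[Pr]_om ((expR (- (lambda * drift r t)))%:E *
    (expR (- (lambda * fine (Yw r t om))))%:E))%E.
  by apply: eq_integral => om _; rewrite -EFinM -expRD /Z mulrDr opprD addrC.
rewrite (ge0_integralZl Pr measurableT mE); last 2 first.
- by move=> om _; rewrite lee_fin expR_ge0.
- by rewrite lee_fin expR_ge0.
rewrite laplace_window//.
have Wf : W r t lambda \is a fin_num by rewrite ge0_fin_numE ?W_ge0// window_lty.
have -> : Psi r t lambda = fine (W r t lambda) + lambda * drift r t.
  by apply: EFin_inj; rewrite PsiE// ipsiE// EFinD fineK.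
by rewrite -{1}(fineK Wf) /= -EFinM -expRD opprD addrC.
Qed.

Let Psi_refl r lambda : 0 <= r -> 0 <= lambda -> Psi r r lambda = 0.
Proof. by move=> _ _; rewrite /Psi set_itv_ge ?Rintegral_set0// bnd_simp ltxx. Qed.

Let psi_ge0 q lambda : 0 <= q -> 0 <= lambda -> 0 <= psi (v q lambda).
Proof.
move=> q0 l0; have := n_ge0 q0 l0; rewrite /n; case: ifP => _; last by rewrite subr0.
by rewrite subr_ge0; apply: le_trans; rewrite mulr_ge0.
Qed.

Let mpsi r t lambda : 0 <= r -> 0 <= lambda ->
  measurable_fun (`]r, t]%classic : set R) (fun u => (psi (v (t - u) lambda))%:E).
Proof.
move=> r0 l0.
have m1 : measurable_fun (`]r, t]%classic : set R) (fun s => (\1_[set t] s)%:E : \bar R).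
  by apply/measurable_EFinP; apply: measurable_funTS; exact: measurable_indic.
rewrite (_ : (fun _ => _) = (fun s => (n (t - s) lambda)%:E +
    (beta * lambda)%:E * (\1_[set t] s)%:E)%E).
  by apply: emeasurable_funD; [exact: mwindow|exact: measurable_funeM].
apply/funext => s; rewrite -EFinM -EFinD /n indicE subr_eq0 eq_sym.
case: eqP => [->|/eqP st]; first by rewrite mem_set// mulr1 subrK.
by rewrite memNset; [rewrite mulr0 addr0 subr0|move/eqP; apply/negP].
Qed.

Let Psi_add r s t lambda : 0 <= r -> r <= s -> s <= t -> 0 <= lambda ->
  Psi r t lambda = Psi r s (v (t - s) lambda) + Psi s t lambda.
Proof.
move=> r0 rs st l0; have s0 := le_trans r0 rs.
have vl0 : 0 <= v (t - s) lambda by rewrite v0// subr_ge0.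
apply: EFin_inj; rewrite EFinD !PsiE// /ipsi.
have tU : (`]r, t]%classic : set R) = `]r, s] `|` `]s, t].
  apply/seteqP; split => u /=; rewrite !in_itv/=.
    by move=> /andP[ru ut]; have [us|su] := leP u s; [left|right]; rewrite ?ru// ut.
  move=> [/andP[-> us]|/andP[su ->]]; first exact: le_trans us st.
  by rewrite andbT (le_lt_trans rs su).
rewrite tU (ge0_integral_setU rho (mwin r s) (mwin s t)).
- congr (_ + _)%E; apply: eq_integral => u /set_mem h.
  rewrite -(cumulant_flow hv hQ) ?subr_ge0//; last by move: h; rewrite /= in_itv/= => /andP[].
  by congr (psi (v _ _))%:E; ring.
- by rewrite -tU; exact: mpsi.
- by rewrite -tU => u /window_in ts0; rewrite lee_fin psi_ge0.
apply/disj_setPS => u [/=]; rewrite !in_itv/= => /andP[_ us] /andP[su _].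
by move: us; rewrite leNgt su.
Qed.

Let P := immigration_semigroup Pr Q mZ.

(** The age $r-s$ is 0 only at $s=r$, which [rho] does not charge when [beta] is positive. *)
Let good_ae r : 0 <= r -> (0 < beta -> rho [set r] = 0%E) ->
  {ae rho, forall s, 0 < s -> s <= r -> 0 < r - s \/ beta = 0}.
Proof.
move=> r0 hr; have [b0|] := ltP 0 beta; last first.
  by move=> b0; apply: aeW => s _ _; right; apply/eqP; rewrite eq_le b0.
exists [set r]; split; [exact: measurable_set1|exact: hr|].
move=> s /= h; apply: contrapT => sr; apply: h => s0 sr'; left.
by rewrite subr_gt0 lt_neqAle sr' andbT; apply/eqP.
Qed.

Let Psi_window r t lambda : 0 <= r -> 0 <= lambda -> (0 < beta -> rho [set t] = 0%E) ->
  expeR (- W r t lambda) = (expR (- Psi r t lambda))%:E.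
Proof.
move=> r0 l0 ht; have Wf : W r t lambda \is a fin_num by rewrite ge0_fin_numE ?W_ge0// window_lty.
have -> : Psi r t lambda = fine (W r t lambda); last by rewrite -{1}(fineK Wf).
apply: EFin_inj; rewrite PsiE// ipsiE// fineK// /drift.
have -> : (if r < t then beta * fine (rho [set t]) else 0) = 0.
  case: ifP => // _; have [b0|] := ltP 0 beta; first by rewrite ht// mulr0.
  by move=> b0; have -> : beta = 0 by [apply/eqP; rewrite eq_le b0]; rewrite mul0r.
by rewrite mulr0 adde0.
Qed.

Lemma immigration_markov_process : exists P' : R -> R -> R.-pker R ~> R,
  [/\ is_transition_semigroup P',
      forall r t x lambda : R, 0 <= r -> r <= t -> 0 <= x -> 0 <= lambda ->
        laplace (P' r t x) lambda =
        (expR (- (x * v (t - r) lambda)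
               - \int[rho]_(u in `]r, t]) psi (v (t - u) lambda)))%:E &
      is_markov_process Pr
        [set t | 0 <= t /\ (0 < beta -> rho [set t] = 0%E)]
        (augmented Pr (immigration_filtration N))
        (fun t om => fine (\int[N om]_p (immigrants 0 t p)%:E)%E) P'].
Proof.
exists P; split.
- exact: (immigration_semigroup_transition hv hQ mZ Z_ge0 laplace_Z Psi_refl Psi_add).
- exact: (immigration_semigroup_laplace hQ mZ Z_ge0 laplace_Z).
have obs t : 0 <= t -> observable Pr N t (Yw 0 t).
  apply: (observable_immigrants hrho1 hmu _ hjump hN) => q q0.
  by rewrite hn// ltry.
split; first split.
- by move=> t _; exact: smallest_sigma_algebra.
- by move=> t _; exact: (augmented_measurable hN).
- move=> r t _ _ rt; apply: sub_sigma_algebra2 => A [FA|]; last by right.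
  left; apply: sub_sigma_algebra2 FA => B [u [A' [C [/andP[u0 ur] FA' mC ->]]]].
  exists u, A', C; split => //; first by rewrite u0 (le_trans ur rt).
  by apply: coordinate_sigmaS FA'; apply: subset_itvl; rewrite bnd_simp lerB.
- by move=> t om _; apply: fine_ge0; exact: Yw_ge0.
- move=> t B [t0 _] mB.
  have h : observable Pr N t (fun om => fine (Yw 0 t om)).
    exact: (measurable_fineT (obs t t0)).
  by have := h measurableT B mB; rewrite setTI.
move=> r t f [r0 hr] [t0 ht] rt mf [M fM].
apply: (conditional_expectation hN (P := P r t) (v := v (t - r)) (Psi := Psi r t)
  _ _ _ (Yw_ge0 0 r) (Yw_ge0 0 t) (mYw 0 t) (obs r r0) (Yw_fin r (lexx 0))
  (Yw_fin t (lexx 0)) _ mf fM).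
- by move=> lambda l0; apply: v0 => //; rewrite subr_ge0.
- by move=> x x0; exact: (immigration_semigroup_null Pr hQ mZ Z_ge0 r0 rt x0).
- move=> x lambda x0 l0.
  exact: (immigration_semigroup_laplace hQ mZ Z_ge0 laplace_Z r0 rt x0 l0).
(* The two restrictions on times enter here: [ht] removes the drift at [t], and [hr] gives the
   Markov property at positive ages for almost every immigrant before [r]. *)
- move=> lambda S l0 pS; rewrite -Psi_window//.
  exact: (past_laplace hmu v0 hn hmarkov hN r0 rt l0 (window_lty t r0 l0) pS (good_ae r0 hr)).
Qed.

End immigration_markov_process.

Lemma locally_finite_sigma_finite (R : realType) (rho : {measure set R -> \bar R}) :
  on_pos rho -> (forall t : R, 0 < t -> (rho `]0%R, t]%classic < +oo)%E) ->
  sigma_finite setT rho.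
Proof.
move=> hrho hrho1; exists (fun k => (`]-oo, k.+1%:R]%classic : set R)).
  apply/seteqP; split => // x _; exists (Num.truncn x) => //=.
  by rewrite in_itv/=; apply: ltW; exact: truncnS_gt.
move=> k; split; first exact: measurable_itv.
have e : (`]-oo, k.+1%:R]%classic : set R) = `]0, k.+1%:R] `|` `]-oo, 0].
  apply/seteqP; split => x /=; rewrite !in_itv/=.
    by move=> xk; have [x0|x0] := leP x 0; [right|left; rewrite xk].
  by move=> [/andP[]//|x0]; exact: le_trans x0 _.
by rewrite [X in rho X]e measureU0//; exact: hrho1.
Qed.

Theorem theorem6p4 (R : realType)
    (* branching mechanism and the CB-process *)
    (b c : R) (m : {sigma_finite_measure set R -> \bar R})
    (phi : R -> R) (v : R -> R -> R) (Q : R -> R.-pker R ~> R)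
    (QQ : R.-pker R ~> cadlag R)
    (hm : branching_parameters c m)
    (hphi : phi = branching_mechanism b c m)
    (hv : is_cumulant_flow phi v)
    (hQ : is_CB_semigroup v Q)
    (hQQ : is_CB_law Q QQ)
    (* immigration: beta, nu, the excursion law, rho *)
    (beta : R) (nu : {sigma_finite_measure set R -> \bar R})
    (l : R -> {sigma_finite_measure set R -> \bar R})
    (N0 : {sigma_finite_measure set (cadlag R) -> \bar R})
    (rho : {measure set R -> \bar R})
    (hbeta : 0 <= beta)
    (hnu : on_pos nu)
    (hnu1 : (\int[nu]_(u in `]0%R, +oo[) u%:E < +oo)%E)
    (hslope : 0 < beta -> infinite_slope phi)
    (hl : 0 < beta -> is_entrance_family v l)
    (hN0 : 0 < beta -> is_excursion_law Q l N0)
    (hrho : on_pos rho)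
    (hrho1 : forall t : R, 0 < t -> (rho `]0%R, t]%classic < +oo)%E)
    (* the Poisson random measure and its atoms (s i om, w i om), i in K om *)
    (d : measure_display) (Omega : measurableType d) (Pr : probability Omega R)
    (N : Omega -> {measure set (R * cadlag R) -> \bar R})
    (K : Omega -> set nat) (s : nat -> Omega -> R) (w : nat -> Omega -> cadlag R)
    (hN : is_poisson_random_measure Pr
            (rho \x immigration_law beta N0 nu QQ)%E N)
    (hs : forall om i, K om i -> 0 < s i om)
    (hNatoms : forall om A, measurable A ->
       N om A = \esum_(i in K om) \d_(s i om, w i om) A) :
  let Y := immigration_process N in
  let psi := immigration_mechanism beta nu in
  [/\ forall (t : R) om, 0 <= t ->
        Y t om = \esum_(i in K om `&` [set i | s i om <= t])
                   (w i om (t - s i om))%:E,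
      forall t : R, 0 <= t -> {ae Pr, forall om, (Y t om < +oo)%E} &
      exists P : R -> R -> R.-pker R ~> R,
        [/\ is_transition_semigroup P,
            forall r t x lambda : R, 0 <= r -> r <= t -> 0 <= x -> 0 <= lambda ->
              laplace (P r t x) lambda =
              (expR (- (x * v (t - r) lambda)
                     - \int[rho]_(u in `]r, t]) psi (v (t - u) lambda)))%:E &
            (* At a time t with rho {t} > 0 the excursions starting at time t
               have w 0 = 0 and contribute nothing to Y t, whereas the Laplace
               exponent contains the term rho {t} * beta * lambda for them;
               these times are excluded from the index set when beta > 0. *)
            is_markov_process Pr
              [set t | 0 <= t /\ (0 < beta -> rho [set t] = 0%E)]
              (augmented Pr (immigration_filtration N))
              (fun t om => fine (Y t om)) P]].
Proof.
(* Fubini and Campbell's formula need sigma-finite structures. The aliases provide them without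
   changing the set functions, so that [hN] transfers to [mu]. *)
pose sL := sigma_finite_immigration_measure hQQ nu hbeta hN0.
pose L : {sigma_finite_measure set (cadlag R) -> \bar R} := sigma_finite_alias sL.
pose srho := locally_finite_sigma_finite hrho hrho1.
pose rho' : {sigma_finite_measure set R -> \bar R} := sigma_finite_alias srho.
pose mu : {sigma_finite_measure set (R * cadlag R)%type -> \bar R} :=
  sigma_finite_alias (product_sigma_finite rho' L).
have hmu (f : R * cadlag R -> \bar R) : (forall p, 0 <= f p)%E -> measurable_fun setT f ->
    (\int[mu]_p f p = \int[rho]_s \int[L]_w f (s, w))%E.
  by move=> f0 mf; exact: (@fubini_tonelli1 _ _ _ _ _ rho' L f mf f0).
have hN' : is_poisson_random_measure Pr mu N.
  by move: hN; rewrite -(immigration_measureE QQ nu N0 hbeta).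
have hlty := immigration_lty hrho1 hmu hv hbeta
  (immigration_mechanism_le hbeta hnu1)
  (fun q lambda q0 hq l0 => immigration_onem hv hQ hQQ hbeta hnu1 hl hN0 q0 hq l0)
  (fun lambda l0 => immigration_onem0 hv hQ hQQ hbeta hnu1 hN0 l0) hN'.
have hmark := immigration_markov_process hrho1 hmu hv hQ hbeta
  (immigration_mechanism_le hbeta hnu1)
  (fun q lambda q0 hq l0 => immigration_onem hv hQ hQQ hbeta hnu1 hl hN0 q0 hq l0)
  (fun lambda l0 => immigration_onem0 hv hQ hQQ hbeta hnu1 hN0 l0)
  (fun p q lambda xi q0 hq qp l0 xi0 axi =>
    immigration_markov hv hQ hQQ nu hbeta hl hN0 q0 hq qp l0 xi0 axi)
  (fun u u0 => immigration_jump_gap hv hQ hQQ nu hbeta hl hN0 u0) hN'.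
move=> Y psi; split.
- by move=> t om _; exact: immigration_process_esum.
- move=> t _; apply: filterS (hlty t) => om.
  by rewrite /Y immigration_processE.
rewrite (_ : (fun t om => fine (Y t om)) =
    (fun t om => fine (\int[N om]_p (immigrants 0 t p)%:E)%E)); first exact: hmark.
by apply/funext => t; apply/funext => om; rewrite /Y immigration_processE.
Qed.
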